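(* Let $\sigma,\tau\in\mathcal{W}_0$ with associated weight matrices $\mathcal{M}_\sigma=\{\mathbf{S}^{(\ell)}:\ell>0\}$ and $\mathcal{M}_\tau=\{\mathbf{T}^{(\ell)}:\ell>0\}$. Let $0<\alpha<2$, $\mu\in\mathbb{C}$ with $|\mu|>1$, $\psi(x):=x^2+\frac14$ for $x\in\mathbb{R}$, and $R_\mu:=\sum_{m=0}^{+\infty}\frac{C_{\psi_m}}{\mu^{m+1}}$ (i.e. $R_\mu=(\mu-C_\psi)^{-1}$). Assume: (a) there exists $\ell_0>0$ such that $\gamma(\mathbf{S}^{(\ell_0)})>\alpha+1$; (b) $\sigma(t)=o(t^{1/\alpha})$ as $t\to+\infty$; (c) there exists $k_0>0$ such that $\mathbf{T}^{(k_0)}\preceq\mathbf{S}^{(\ell)}$ for all $\ell>0$. Then there exists $$f\in\mathcal{S}_{((((\sigma^\alpha)^\star)^\iota)^{1/\alpha})}(\mathbb{R})=\mathcal{S}_{(\sigma\widehat{\star}\,\mathrm{id}^{1/\alpha})}(\mathbb{R})=\mathcal{S}_{(\frac{\mathcal{M}_\sigma}{\mathbf{G}^\alpha})}(\mathbb{R})$$ such that $R_\mu(f)\notin\mathcal{S}_{(\tau)}(\mathbb{R})$.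
   Context: $\mathbb{N}=\{0,1,2,\dots\}$. $\mathcal{W}_0$ is the set of all continuous, non-decreasing $\omega:[0,+\infty)\to[0,+\infty)$ with $\omega(t)=0$ for $t\in[0,1]$, $\lim_{t\to+\infty}\omega(t)=+\infty$, $\log t=o(\omega(t))$ as $t\to+\infty$, and $\varphi_\omega:t\mapsto\omega(e^t)$ convex on $\mathbb{R}$. Associated weight matrix: $\varphi^*_\omega(x):=\sup_{y\ge0}\{xy-\varphi_\omega(y)\}$, $x\ge0$, and $\mathcal{M}_\omega:=\{\mathbf{W}^{(\ell)}:\ell>0\}$ with $W^{(\ell)}_p:=\exp(\frac1\ell\varphi^*_\omega(\ell p))$. Each $\mathbf{W}^{(\ell)}$ is log-convex with $W^{(\ell)}_0=1$ and $(W^{(\ell)}_p)^{1/p}\to+\infty$. Growth index of Thilliez for a log-convex positive sequence $\mathbf{M}$ with $M_0=1$, $M_p^{1/p}\to+\infty$: with $\mu_p:=M_p/M_{p-1}$ ($p\ge1$), $\gamma(\mathbf{M})$ is the supremum of all $\beta>0$ for which there are a constant $a\ge1$ and a non-decreasing positive sequence $(\lambda_p)_{p\ge1}$ with $a^{-1}\lambda_p\le\mu_pp^{-\beta}\le a\lambda_p$ for all $p\ge1$ ($\gamma(\mathbf{M}):=0$ if there is none). It is known that, for $\beta\ge0$, $\gamma(\mathbf{M})>\beta$ holds if and only if there is an integer $Q\ge2$ with $\liminf_{p\to+\infty}\mu_{Qp}/\mu_p>Q^\beta$. $\mathbf{M}\preceq\mathbf{N}$ means $\sup_{p\ge1}(M_p/N_p)^{1/p}<+\infty$.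 $\mathbf{G}^\alpha:=(p!^\alpha)_p$ and $\frac{\mathcal{M}_\sigma}{\mathbf{G}^\alpha}:=\{(S^{(\ell)}_p/p!^\alpha)_p:\ell>0\}$. Conjugates: $\sigma\widehat{\star}\tau(t):=\sup_{s\ge0}\{\sigma(s)-\tau(s/t)\}$ for $t>0$, $\sigma\widehat{\star}\tau(0):=\sigma(0)-\tau(0)$; $\mathrm{id}^{1/\alpha}(t):=t^{1/\alpha}$; $h^\iota(t):=h(1/t)$, $h^\beta(t):=h(t^\beta)$ for $\beta>0$, $h^\star(t):=\sup_{s\ge0}\{h(s)-ts\}$, so $(((\sigma^\alpha)^\star)^\iota)^{1/\alpha}(t)=\sup_{s\ge0}\{\sigma(s^\alpha)-st^{-1/\alpha}\}$ for $t>0$, with value $0$ at $t=0$. Spaces: for a non-decreasing $\omega:[0,+\infty)\to[0,+\infty)$ with $\log t=o(\omega(t))$, $$\mathcal{S}_{(\omega)}(\mathbb{R}):=\Big\{f\in C^\infty(\mathbb{R}):\ \sup_{x\in\mathbb{R},\,j,k\in\mathbb{N}}\frac{(1+|x|)^k|f^{(j)}(x)|}{W^{(\ell)}_{j+k}}<+\infty\ \ \forall\,\ell>0\Big\},$$ where $W^{(\ell)}_p=\exp(\frac1\ell\varphi^*_\omega(\ell p))$ and, if $\omega$ is not zero on $[0,1]$, $\varphi^*_\omega(x):=\sup_{y\in\mathbb{R}}\{xy-\omega(e^y)\}$. For a family $\mathcal{M}=\{\mathbf{M}^{(\ell)}:\ell>0\}$ of positive sequences, $$\mathcal{S}_{(\mathcal{M})}(\mathbb{R}):=\Big\{f\in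 C^\infty(\mathbb{R}):\ \sup_{x\in\mathbb{R},\,j,k\in\mathbb{N}}\frac{(1+|x|)^k|f^{(j)}(x)|}{h^{j+k}M^{(\ell)}_{j+k}}<+\infty\ \ \forall\,\ell,h>0\Big\}.$$ Composition operators: $C_\psi f:=f\circ\psi$; $\psi_m$ is the $m$-fold iterate of $\psi$ ($\psi_0=\mathrm{id}$), so $R_\mu f=\sum_{m\ge0}\mu^{-m-1}\,f\circ\psi_m$. *)

(* Defs.v *)
From Stdlib Require Export Factorial Reals.
From Coquelicot Require Export Coquelicot.
Open Scope R_scope.

(* Functions on [0,+oo) are represented by functions R -> R of which only the
   values at nonnegative arguments are used. *)

(* Every supremum taken below is that of a nonempty set which is bounded above
   under the assumptions of the theorem; the value is meaningless otherwise. *)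
Definition Rsup (E : R -> Prop) : R := real (Lub_Rbar E).

(* [Rpower 0 b] is 1 in the standard library, hence the case distinction. *)
Definition rpow (t b : R) : R :=
  if Rle_dec t 0 then 0 else Rpower t b.

Definition little_o_infty (f g : R -> R) : Prop :=
  is_domin (Rbar_locally p_infty) g f.

Definition phi (omega : R -> R) (t : R) : R := omega (exp t).

Definition convex (f : R -> R) : Prop :=
  forall x y c, 0 <= c <= 1 ->
    f (c * x + (1 - c) * y) <= c * f x + (1 - c) * f y.

Record W0 (omega : R -> R) : Prop := {
  W0_nonneg : forall t, 0 <= t -> 0 <= omega t;
  W0_continuous : continuous_on (fun t => 0 <= t) omega;
  W0_nondecreasing : forall s t, 0 <= s -> s <= t -> omega s <= omega t;
  W0_zero : forall t, 0 <= t <= 1 -> omega t = 0;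
  W0_lim : is_lim omega p_infty p_infty;
  W0_log : little_o_infty ln omega;
  W0_convex : convex (phi omega)
}.

Definition zero_on_unit_interval (omega : R -> R) : Prop :=
  forall t, 0 <= t <= 1 -> omega t = 0.

(* The supremum of x y - omega (e^y) over y >= 0 if omega vanishes on [0,1],
   and over all real y otherwise. *)
Definition phi_star (omega : R -> R) (x : R) : R :=
  Rsup (fun z => exists y,
    (zero_on_unit_interval omega -> 0 <= y) /\ z = x * y - phi omega y).

Definition weight_matrix (omega : R -> R) (l : R) (p : nat) : R :=
  exp (phi_star omega (l * INR p) / l).

(* The quotient mu_p = M_p / M_(p-1), meaningful for p >= 1 only. *)
Definition quot (M : nat -> R) (p : nat) : R := M p / M (pred p).

Definition almost_increasing_quot (M : nat -> R) (beta : R) : Prop :=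
  exists (a : R) (lambda : nat -> R),
    1 <= a /\
    (forall p, (1 <= p)%nat -> 0 < lambda p) /\
    (forall p q, (1 <= p)%nat -> (p <= q)%nat -> lambda p <= lambda q) /\
    (forall p, (1 <= p)%nat ->
       / a * lambda p <= quot M p * Rpower (INR p) (- beta) <= a * lambda p).

(* Thilliez's index, with values in [0,+oo]; adjoining 0 to the set of
   admissible beta > 0 makes the supremum 0 when there is none. *)
Definition growth_index (M : nat -> R) : Rbar :=
  Lub_Rbar (fun beta =>
    beta = 0 \/ (0 < beta /\ almost_increasing_quot M beta)).

Definition seq_preceq (M N : nat -> R) : Prop :=
  exists K, forall p, (1 <= p)%nat -> Rpower (M p / N p) (/ INR p) <= K.

Definition div_gevrey (M : R -> nat -> R) (alpha : R) (l : R) (p : nat) : R :=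
  M l p / Rpower (INR (fact p)) alpha.

Definition conj_hat (sigma tau : R -> R) (t : R) : R :=
  if Req_dec_T t 0 then sigma 0 - tau 0
  else Rsup (fun z => exists s, 0 <= s /\ z = sigma s - tau (s / t)).

Definition id_pow (b : R) (t : R) : R := rpow t b.

(* h^b, i.e. t |-> h (t^b) *)
Definition arg_pow (h : R -> R) (b : R) (t : R) : R := h (rpow t b).

(* h^iota, i.e. t |-> h (1/t), with the convention that the value at 0 is 0 *)
Definition iota (h : R -> R) (t : R) : R :=
  if Req_dec_T t 0 then 0 else h (1 / t).

(* h^star, the upper Legendre conjugate *)
Definition legendre (h : R -> R) (t : R) : R :=
  Rsup (fun z => exists s, 0 <= s /\ z = h s - t * s).

Definition re_part (f : R -> C) (x : R) : R := Re (f x).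
Definition im_part (f : R -> C) (x : R) : R := Im (f x).

Definition smooth (f : R -> C) : Prop :=
  forall n x, ex_derive_n (re_part f) n x /\ ex_derive_n (im_part f) n x.

Definition CDerive_n (f : R -> C) (n : nat) (x : R) : C :=
  (Derive_n (re_part f) n x, Derive_n (im_part f) n x).

Definition schwartz_weight (omega : R -> R) (f : R -> C) : Prop :=
  smooth f /\
  forall l, 0 < l -> exists K, forall x (j k : nat),
    (1 + Rabs x) ^ k * Cmod (CDerive_n f j x)
      / weight_matrix omega l (j + k) <= K.

Definition schwartz_matrix (M : R -> nat -> R) (f : R -> C) : Prop :=
  smooth f /\
  forall l h, 0 < l -> 0 < h -> exists K, forall x (j k : nat),
    (1 + Rabs x) ^ k * Cmod (CDerive_n f j x)
      / (h ^ (j + k) * M l (j + k)%nat) <= K.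

Definition psi (x : R) : R := x ^ 2 + 1 / 4.

Definition resolvent_term (mu : C) (f : R -> C) (x : R) (m : nat) : C :=
  Cdiv (f (Nat.iter m psi x)) (Cpow mu (m + 1)).

(* The pointwise sum; [Series] is total, so that convergence has to be
   asserted separately. *)
Definition resolvent (mu : C) (f : R -> C) (x : R) : C :=
  (Series (fun m => Re (resolvent_term mu f x m)),
   Series (fun m => Im (resolvent_term mu f x m))).

(* Main.v *)
(** The spaces. With F the Young conjugate of phi(u) = sigma(e^u), the condition on the growth
    index says that the slopes of F increase at least like beta ln x for some beta > alpha + 1.
    This makes sigma ^* id^(1/alpha) have conjugate F(x) - alpha x ln x + O(x), and lets the
    parameter of the weight matrix swallow geometric factors.

    The counterexample. psi has the parabolic fixed point 1/2, so that the m-th inverse iterate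
    contracts a neighbourhood of 3/4 by a factor of order 1/m^2 near the point x_m with
    psi_m(x_m) = 3/4. If f is supported in a wandering interval around 3/4, then near x_m the
    function u = R_mu f equals f(psi_m) / mu^(m+1), hence f = mu^(m+1) u(psi_m^(-1)) near 3/4.
    A bound of u^(k) by T_k, for all k, therefore bounds f^(n)(3/4) / n! by
    C^n |mu|^m sum_k T_k m^(-2k) / k!, and for m = n this is at most C^n S_n n^(-a n) / n! with
    a = min(beta - 1, 2) > alpha. A lacunary trigonometric series, cut off by a Gevrey plateau
    function, has derivatives at 3/4 which exceed this bound although f belongs to the class
    of S / G^alpha. *)

Require Import Defs.
From Stdlib Require Import Lra Lia Classical ClassicalEpsilon List.
Open Scope R_scope.

(** * Suprema and the Young conjugate of a weight function *)

(** The spaces are of Beurling type: one f has to obey the bounds for all l and h at once. The upper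
    estimate, for its part, holds for every l, but with an uncontrolled factor e^(Q_l n), and for a
    fixed l the classes of smaller l may lie far below it. Hence a gliding hump: the j-th term of
    the series is built for l = h = 1/(j+1), obeys every weaker bound, and beats the estimate for
    that same l by the factor j, which finally exceeds the unknown constant in the bound assumed for
    R_mu f. What pays for e^(Q_l n) is the superexponential gain n^((a - alpha) n). The inequality
    beta - 1 > alpha serves a second time: it leaves room for a non-quasianalytic cutoff, Gevrey of
    some order s with 1 < s < beta - alpha. Since R_mu f is at best smooth, Cauchy's estimates are
    replaced by estimates on jets: polynomials with the norm sum |c_k| rho^k instead of analytic
    functions with a supremum over a complex disc. *)

Lemma Rsup_is_lub (E : R -> Prop) (B : R) :
  (exists x, E x) -> (forall x, E x -> x <= B) -> is_lub E (Rsup E).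
Proof.
intros HE HB.
assert (Hb : bound E) by (exists B; exact HB).
destruct (completeness E Hb HE) as [l Hl].
unfold Rsup. rewrite (is_lub_Rbar_unique E l); [exact Hl|].
split; [intros x Hx; apply Hl; exact Hx|].
intros [b| |] Hbb; simpl; auto.
- apply Hl. intros x Hx. apply (Hbb x Hx).
- destruct HE as [x Hx]. apply (Hbb x Hx).
Qed.

Lemma Rsup_ub (E : R -> Prop) (B x : R) :
  (forall x, E x -> x <= B) -> E x -> x <= Rsup E.
Proof.
intros HB Hx. apply (Rsup_is_lub E B); eauto.
Qed.

Lemma Rsup_le (E : R -> Prop) (B : R) :
  (exists x, E x) -> (forall x, E x -> x <= B) -> Rsup E <= B.
Proof. intros HE HB. apply (Rsup_is_lub E B); auto. Qed.

Lemma Rsup_near (E : R -> Prop) (B eps : R) :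
  (exists x, E x) -> (forall x, E x -> x <= B) -> 0 < eps ->
  exists x, E x /\ Rsup E - eps < x.
Proof.
intros HE HB He. apply NNPP. intro Hn.
assert (H : Rsup E <= Rsup E - eps); [|lra].
apply (Rsup_is_lub E B HE HB). intros x Hx.
destruct (Rle_dec x (Rsup E - eps)) as [|Hg]; [assumption|].
exfalso. apply Hn. exists x. split; [assumption|lra].
Qed.

Lemma Rsup_ext (E E' : R -> Prop) : (forall x, E x <-> E' x) -> Rsup E = Rsup E'.
Proof.
intros H. unfold Rsup. now rewrite (Lub_Rbar_eqset E E' H).
Qed.

Section Weight.

Variable sigma : R -> R.
Hypothesis Hs : W0 sigma.

Let ph := phi sigma.
Let F := phi_star sigma.

Lemma W0_zero_on_unit : zero_on_unit_interval sigma.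
Proof. intros t Ht. apply (W0_zero _ Hs t Ht). Qed.

Lemma phi_nonneg y : 0 <= ph y.
Proof. apply (W0_nonneg _ Hs), Rlt_le, exp_pos. Qed.

Lemma phi_monotone x y : x <= y -> ph x <= ph y.
Proof.
intros [H| ->]; [|lra].
apply (W0_nondecreasing _ Hs); [apply Rlt_le, exp_pos|].
apply Rlt_le, exp_increasing, H.
Qed.

Lemma phi_zero : ph 0 = 0.
Proof. unfold ph, phi. rewrite exp_0. apply (W0_zero _ Hs). lra. Qed.

(** This is log t = o(sigma(t)) read at t = e^y; it makes the conjugate finite everywhere. *)
Lemma phi_superlinear x : exists y1, 0 <= y1 /\ forall y, y1 <= y -> x * y <= ph y.
Proof.
destruct (W0_log _ Hs (mkposreal (/ (Rabs x + 1)) (Rinv_0_lt_compat _ (Rle_lt_0_plus_1 _ (Rabs_pos x)))))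
  as [M HM].
exists (Rmax 0 (ln (Rmax M 1) + 1)). split; [apply Rmax_l|].
intros y Hy.
assert (H0 : 0 <= y) by (apply Rle_trans with (2 := Hy), Rmax_l).
assert (H1 : ln (Rmax M 1) + 1 <= y) by (apply Rle_trans with (2 := Hy), Rmax_r).
assert (HMy : M < exp y).
{ apply Rle_lt_trans with (Rmax M 1); [apply Rmax_l|].
  rewrite <- (exp_ln (Rmax M 1)) by (apply Rlt_le_trans with (2 := Rmax_r _ _); lra).
  apply exp_increasing. lra. }
specialize (HM _ HMy). simpl in HM. unfold norm in HM; simpl in HM; unfold abs in HM; simpl in HM.
rewrite ln_exp, (Rabs_pos_eq y H0), (Rabs_pos_eq (sigma (exp y))) in HM
  by (apply (phi_nonneg y)).
fold (phi sigma y) in HM. fold ph in HM.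
assert (Hp := Rabs_pos x).
apply (Rmult_le_compat_l (Rabs x + 1)) in HM; [|lra].
rewrite <- Rmult_assoc, Rinv_r, Rmult_1_l in HM by lra.
assert (Hx := Rle_abs x). nra.
Qed.

Lemma phi_star_bounded x : 0 <= x -> exists B, forall y, x * y - ph y <= B.
Proof.
intros Hx. destruct (phi_superlinear x) as [y1 [H1 H2]].
exists (x * y1). intro y.
destruct (Rle_dec y1 y) as [h|h].
- specialize (H2 y h). nra.
- assert (H := phi_nonneg y). nra.
Qed.

(** The supremum runs over y >= 0 only, but a negative y gives at most 0, the value at y = 0. Later
    uses therefore need no sign condition on y. *)
Lemma phi_star_ub x y : 0 <= x -> x * y - ph y <= F x.
Proof.
intros Hx. destruct (phi_star_bounded x Hx) as [B HB].
assert (Hub : forall z, 0 <= z -> x * z - ph z <= F x).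
{ intros z Hz. apply (Rsup_ub _ B).
  - intros w [v [_ ->]]. apply HB.
  - exists z. split; [intros _; exact Hz|reflexivity]. }
destruct (Rle_dec 0 y) as [h|h]; [now apply Hub|].
apply Rle_trans with (2 := Hub 0 (Rle_refl _)).
assert (ph y <= ph 0) by (apply phi_monotone; lra).
assert (H0 := phi_zero).
assert (H1 := phi_nonneg y). nra.
Qed.

Lemma phi_star_le x B : (forall y, 0 <= y -> x * y - ph y <= B) -> F x <= B.
Proof.
intros HB. apply Rsup_le.
- exists (x * 0 - phi sigma 0), 0. split; [intros _; lra|reflexivity].
- intros z [y [Hy ->]]. apply HB, Hy, W0_zero_on_unit.
Qed.

Lemma phi_star_near x eps : 0 <= x -> 0 < eps ->
  exists y, 0 <= y /\ F x - eps < x * y - ph y.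
Proof.
intros Hx He. destruct (phi_star_bounded x Hx) as [B HB].
destruct (Rsup_near (fun z => exists y,
    (zero_on_unit_interval sigma -> 0 <= y) /\ z = x * y - phi sigma y) B eps)
  as [z [[y [Hy ->]] Hz]]; auto.
- exists (x * 0 - phi sigma 0), 0. split; [intros _; lra|reflexivity].
- intros z [y [Hy ->]]. apply HB.
- exists y. split; [apply Hy, W0_zero_on_unit|exact Hz].
Qed.

Lemma phi_star_nonneg x : 0 <= x -> 0 <= F x.
Proof.
intros Hx. assert (H := phi_star_ub x 0 Hx). rewrite phi_zero in H. lra.
Qed.

Lemma phi_star_zero : F 0 = 0.
Proof.
apply Rle_antisym; [|apply phi_star_nonneg; lra].
apply phi_star_le. intros y _. assert (H := phi_nonneg y). lra.
Qed.

Lemma phi_star_monotone x y : 0 <= x <= y -> F x <= F y.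
Proof.
intros Hxy. apply phi_star_le. intros u Hu.
assert (H := phi_star_ub y u). nra.
Qed.

Lemma phi_star_convex x y c : 0 <= x -> 0 <= y -> 0 <= c <= 1 ->
  F (c * x + (1 - c) * y) <= c * F x + (1 - c) * F y.
Proof.
intros Hx Hy Hc. apply phi_star_le. intros u Hu.
assert (H1 := phi_star_ub x u Hx). assert (H2 := phi_star_ub y u Hy). nra.
Qed.

(** Chord slopes of a convex function increase with both endpoints: both chords are compared with
    the chord over [x, y + e], of length w. The slopes are cross-multiplied to avoid quotients. *)
Lemma phi_star_chord x d y e : 0 <= x -> 0 < d -> 0 < e -> x <= y -> x + d <= y + e ->
  (F (x + d) - F x) * e <= (F (y + e) - F y) * d.
Proof.
intros Hx Hd He Hxy Hxy'.
set (w := y + e - x).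
assert (Hw : 0 < w) by (unfold w; lra).
assert (E1 : F (x + d) * w <= (w - d) * F x + d * F (y + e)).
{ assert (H := phi_star_convex x (y + e) ((w - d) / w) Hx ltac:(lra)).
  replace ((w - d) / w * x + (1 - (w - d) / w) * (y + e)) with (x + d) in H
    by (unfold w in *; field; lra).
  assert (Hc : 0 <= (w - d) / w <= 1).
  { split; [apply Rdiv_le_0_compat; unfold w; lra|].
    apply Rle_div_l; lra. }
  specialize (H Hc). apply (Rmult_le_compat_r w) in H; [|lra].
  replace (((w - d) / w * F x + (1 - (w - d) / w) * F (y + e)) * w)
    with ((w - d) * F x + d * F (y + e)) in H by (field; lra). exact H. }
assert (E2 : F y * w <= e * F x + (w - e) * F (y + e)).
{ assert (H := phi_star_convex x (y + e) (e / w) Hx ltac:(lra)).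
  replace (e / w * x + (1 - e / w) * (y + e)) with y in H
    by (unfold w in *; field; lra).
  assert (Hc : 0 <= e / w <= 1).
  { split; [apply Rdiv_le_0_compat; lra|].
    apply Rle_div_l; unfold w; lra. }
  specialize (H Hc). apply (Rmult_le_compat_r w) in H; [|lra].
  replace ((e / w * F x + (1 - e / w) * F (y + e)) * w)
    with (e * F x + (w - e) * F (y + e)) in H by (field; lra). exact H. }
apply Rmult_le_reg_r with (1 := Hw).
assert (H1 := Rmult_le_compat_l e _ _ (Rlt_le _ _ He) E1).
assert (H2 := Rmult_le_compat_l d _ _ (Rlt_le _ _ Hd) E2).
nra.
Qed.

Lemma phi_star_over_id x y : 0 < x -> x <= y -> F x / x <= F y / y.
Proof.
intros Hx Hxy.
assert (H := phi_star_chord 0 x 0 y ltac:(lra) Hx ltac:(lra) ltac:(lra) ltac:(lra)).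
rewrite phi_star_zero, !Rplus_0_l, !Rminus_0_r in H.
apply Rle_div_l; [lra|].
replace (F y / y * x) with (F y * x / y) by (field; lra).
apply Rle_div_r; lra.
Qed.

(** z is the left derivative of the convex function [ph], the supremum of the left difference
    quotients; every right quotient bounds it from above. Equality in Young's inequality holds at a
    subgradient. *)
Lemma phi_subgradient u : exists z, 0 <= z /\
  (forall y, ph u + z * (y - u) <= ph y) /\ F z = z * u - ph u.
Proof.
set (E := fun q => exists d, 0 < d /\ q = (ph u - ph (u - d)) / d).
assert (Hslope : forall d e, 0 < d -> 0 < e ->
  (ph u - ph (u - d)) / d <= (ph (u + e) - ph u) / e).
{ intros d e Hd He.
  assert (H := W0_convex _ Hs (u - d) (u + e) (e / (d + e))). fold ph in H.
  replace (e / (d + e) * (u - d) + (1 - e / (d + e)) * (u + e)) with u in H by (field; lra).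
  assert (Hc : 0 <= e / (d + e) <= 1).
  { split; [apply Rdiv_le_0_compat; lra|]. apply Rle_div_l; lra. }
  specialize (H Hc).
  apply (Rmult_le_compat_r (d + e)) in H; [|lra].
  replace ((e / (d + e) * ph (u - d) + (1 - e / (d + e)) * ph (u + e)) * (d + e))
   with (e * ph (u - d) + d * ph (u + e)) in H by (field; lra).
  apply Rle_div_l; [lra|].
  replace ((ph (u + e) - ph u) / e * d) with ((ph (u + e) - ph u) * d / e) by (field; lra).
  apply Rle_div_r; lra. }
assert (Hne : exists x, E x) by (exists ((ph u - ph (u - 1)) / 1), 1; split; [lra|reflexivity]).
assert (HB : forall e, 0 < e -> forall x, E x -> x <= (ph (u + e) - ph u) / e).
{ intros e He x [d [Hd ->]]. now apply Hslope. }
set (z := Rsup E).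
assert (Hz0 : 0 <= z).
{ apply Rle_trans with ((ph u - ph (u - 1)) / 1).
  - apply Rdiv_le_0_compat; [|lra]. assert (ph (u-1) <= ph u) by (apply phi_monotone; lra). lra.
  - apply (Rsup_ub E _ _ (HB 1 Rlt_0_1)). exists 1. split; [lra|reflexivity]. }
assert (Hsub : forall y, ph u + z * (y - u) <= ph y).
{ intro y. destruct (Rtotal_order y u) as [h|[->|h]].
  - assert (H : (ph u - ph (u - (u - y))) / (u - y) <= z).
    { apply (Rsup_ub E _ _ (HB 1 Rlt_0_1)). exists (u - y). split; [lra|reflexivity]. }
    replace (u - (u - y)) with y in H by ring.
    apply Rle_div_l in H; [|lra]. lra.
  - lra.
  - assert (H : z <= (ph (u + (y - u)) - ph u) / (y - u)).
    { apply Rsup_le; [exact Hne|]. apply HB. lra. }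
    replace (u + (y - u)) with y in H by ring.
    apply Rle_div_r in H; [|lra]. lra. }
exists z. split; [exact Hz0|]. split; [exact Hsub|].
apply Rle_antisym.
- apply phi_star_le. intros y _. specialize (Hsub y). lra.
- apply phi_star_ub, Hz0.
Qed.

End Weight.

(** * The growth index and the slopes of the conjugate *)

Lemma growth_index_gt (M : nat -> R) (b : R) : 0 <= b -> Rbar_lt b (growth_index M) ->
  exists beta, b < beta /\ almost_increasing_quot M beta.
Proof.
intros Hb H. apply NNPP. intro Hn.
apply (Rbar_lt_not_le _ _ H). unfold growth_index.
apply Lub_Rbar_correct. intros x [->|[Hx Hq]]; simpl; [exact Hb|].
destruct (Rle_dec x b) as [|h]; [assumption|].
exfalso. apply Hn. exists x. split; [lra|exact Hq].
Qed.

Lemma ln_le_sub x : 0 < x -> ln x <= x - 1.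
Proof.
intros Hx. destruct (Req_dec x 1) as [->|h]; [rewrite ln_1; lra|].
assert (H := exp_ineq1_le (ln x)). rewrite exp_ln in H by assumption. lra.
Qed.

Lemma ln_monotone x y : 0 < x -> x <= y -> ln x <= ln y.
Proof. intros Hx [H| ->]; [left; now apply ln_increasing|lra]. Qed.

Lemma exp_monotone x y : x <= y -> exp x <= exp y.
Proof. intros [H| ->]; [left; now apply exp_increasing|lra]. Qed.

Lemma ln_nonneg x : 1 <= x -> 0 <= ln x.
Proof. intros Hx. rewrite <- ln_1. apply ln_monotone; lra. Qed.

Lemma almost_increasing_quot_ln (M : nat -> R) (beta : R) :
  (forall p, 0 < M p) -> almost_increasing_quot M beta ->
  exists C, 0 <= C /\
    (forall p q, (1 <= p)%nat -> (p <= q)%nat ->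
     beta * (ln (INR q) - ln (INR p)) - C <= ln (quot M q) - ln (quot M p)) /\
    (forall p, (1 <= p)%nat -> beta * ln (INR p) - C <= ln (quot M p)).
Proof.
intros HM (a & lam & Ha & Hl & Hi & Hq).
assert (Hqp : forall p, 0 < quot M p) by (intro p; apply Rdiv_lt_0_compat; apply HM).
assert (Hlna := ln_nonneg a Ha).
assert (Hup : forall p, (1 <= p)%nat -> ln (quot M p) - beta * ln (INR p) <= ln a + ln (lam p)).
{ intros p Hp. destruct (Hq p Hp) as [_ H].
  apply ln_monotone in H; [|apply Rmult_lt_0_compat; [apply Hqp|apply exp_pos]].
  rewrite !ln_mult in H; auto; try lra; try apply exp_pos.
  unfold Rpower in H. rewrite ln_exp in H. lra. }
assert (Hlo : forall p, (1 <= p)%nat -> - ln a + ln (lam p) <= ln (quot M p) - beta * ln (INR p)).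
{ intros p Hp. destruct (Hq p Hp) as [H _].
  assert (0 < / a) by (apply Rinv_0_lt_compat; lra).
  apply ln_monotone in H; [|apply Rmult_lt_0_compat; auto].
  rewrite !ln_mult, ln_Rinv in H; auto; try lra; try apply exp_pos.
  unfold Rpower in H. rewrite ln_exp in H. lra. }
assert (Hll : forall p q, (1 <= p)%nat -> (p <= q)%nat -> ln (lam p) <= ln (lam q)).
{ intros p q Hp Hpq. apply ln_monotone; auto. }
exists (2 * ln a + Rabs (ln (lam 1%nat))). split.
{ assert (H := Rabs_pos (ln (lam 1%nat))). lra. }
split.
- intros p q Hp Hpq. assert (H1 := Hup p Hp). assert (H2 := Hlo q ltac:(lia)).
  assert (H3 := Hll p q Hp Hpq). assert (H := Rabs_pos (ln (lam 1%nat))). lra.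
- intros p Hp. assert (H2 := Hlo p Hp). assert (H3 := Hll 1%nat p (le_n _) Hp).
  assert (H4 := Rabs_maj2 (ln (lam 1%nat))). lra.
Qed.

Lemma INR_pos n : (1 <= n)%nat -> 1 <= INR n.
Proof. intro H. apply (le_INR 1) in H. simpl in H. exact H. Qed.

Lemma nfloor x : 0 <= x -> exists n, INR n <= x < INR n + 1.
Proof. intro H. destruct (nfloor_ex x H) as [n Hn]. exists n. exact Hn. Qed.

Section Growth.

Variable sigma : R -> R.
Hypothesis Hs : W0 sigma.
Variables l0 beta : R.
Hypothesis Hl0 : 0 < l0.
Hypothesis Hbeta : 0 < beta.
Hypothesis Hq : almost_increasing_quot (weight_matrix sigma l0) beta.

Let F := phi_star sigma.
Let s x := (F (x + l0) - F x) / l0.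

Lemma slope_monotone x y : 0 <= x <= y -> s x <= s y.
Proof.
intros [Hx Hxy]. assert (H := phi_star_chord sigma Hs x l0 y l0 Hx Hl0 Hl0 Hxy ltac:(lra)).
apply Rmult_le_reg_r in H; [|assumption]. unfold s.
apply Rmult_le_compat_r; [left; now apply Rinv_0_lt_compat|exact H].
Qed.

Lemma ln_quot_weight p : (1 <= p)%nat ->
  ln (quot (weight_matrix sigma l0) p) = s (l0 * INR (pred p)).
Proof.
intro Hp. unfold quot, weight_matrix.
rewrite ln_div by apply exp_pos. rewrite !ln_exp. unfold s. fold F.
replace (l0 * INR (pred p) + l0) with (l0 * INR p); [field; lra|].
destruct p; [lia|]. simpl pred. rewrite S_INR. ring.
Qed.

(** The hypothesis controls s only on the grid of multiples of l0. Since s is monotone, x can be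
    rounded up and y down; as x >= l0, the rounded index of x is at most 3x/l0, which costs beta ln
    3. *)
Lemma slope_growth : exists C, 0 <= C /\
  (forall x y, l0 <= x -> x <= y -> beta * (ln y - ln x) - C <= s y - s x) /\
  (forall x, l0 <= x -> beta * ln x - C <= s x).
Proof.
destruct (almost_increasing_quot_ln (weight_matrix sigma l0) beta (fun p => exp_pos _) Hq) as (C & HC & H1 & H2).
assert (Hln3 : 0 < ln 3) by (rewrite <- ln_1; apply ln_increasing; lra).
assert (Hup : forall y, l0 <= y -> exists q, (1 <= q)%nat /\
  ln y - ln l0 <= ln (INR q) /\ l0 * INR (pred q) <= y /\ y < l0 * INR q).
{ intros y Hy. destruct (nfloor (y / l0)) as [n Hn]; [apply Rdiv_le_0_compat; lra|].
  exists (S n). split; [lia|]. rewrite S_INR; simpl pred.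
  destruct Hn as [Hn1 Hn2]. apply Rle_div_r in Hn1; [|lra].
  assert (Hn2' := Hn2). apply Rlt_div_l in Hn2; [|lra].
  split; [|lra]. rewrite <- ln_div by lra. apply ln_monotone; [|lra].
  apply Rdiv_lt_0_compat; lra. }
assert (Hsq : forall q y, (1 <= q)%nat -> l0 * INR (pred q) <= y ->
  ln (quot (weight_matrix sigma l0) q) <= s y).
{ intros q y Hq1 Hy. rewrite ln_quot_weight by assumption. apply slope_monotone.
  split; [|assumption]. apply Rmult_le_pos; [lra|apply pos_INR]. }
exists (C + beta * ln 3 + beta * Rabs (ln l0)).
assert (Ha := Rabs_pos (ln l0)).
assert (Hp : 0 <= beta * ln 3) by (apply Rmult_le_pos; lra).
assert (Hp' : 0 <= beta * Rabs (ln l0)) by (apply Rmult_le_pos; lra).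
split; [lra|]. split.
- intros x y Hx Hxy.
  destruct (Hup x Hx) as (n & Hn & Hn1 & Hn2 & Hn3).
  set (p := S n).
  assert (Hsx : s x <= ln (quot (weight_matrix sigma l0) p)).
  { rewrite ln_quot_weight by (unfold p; lia). unfold p; simpl pred.
    apply slope_monotone. lra. }
  assert (Hp1 : (1 <= p)%nat) by (unfold p; lia).
  assert (HpR : ln (INR p) <= ln x - ln l0 + ln 3).
  { assert (0 < x / l0) by (apply Rdiv_lt_0_compat; lra).
    rewrite <- ln_div, <- ln_mult by lra.
    apply ln_monotone; [apply lt_0_INR; lia|].
    assert (1 <= x / l0) by (apply Rle_div_r; lra).
    assert (INR (pred n) <= x / l0) by (apply Rle_div_r; lra).
    unfold p. rewrite S_INR. destruct n; [lia|]. rewrite S_INR. simpl pred in *. lra. }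
  destruct (Hup y ltac:(lra)) as (q & Hq1 & Hq2 & Hq3 & Hq4).
  assert (Hsy := Hsq q y Hq1 Hq3).
  (* If the rounded indices cross, then y <= 3x and monotonicity of s suffices. *)
  destruct (Compare_dec.le_lt_dec p q) as [h|h].
  + specialize (H1 p q Hp1 h).
    assert (beta * (ln y - ln x - ln 3) <= beta * (ln (INR q) - ln (INR p)))
      by (apply Rmult_le_compat_l; lra). lra.
  + assert (Hl : ln (INR q) <= ln (INR p)).
    { apply ln_monotone; [apply lt_0_INR; lia|apply le_INR; lia]. }
    assert (Hxy' := slope_monotone x y ltac:(lra)).
    assert (beta * (ln y - ln x) <= beta * ln 3) by (apply Rmult_le_compat_l; lra). lra.
- intros x Hx. destruct (Hup x Hx) as (q & Hq1 & Hq2 & Hq3 & Hq4).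
  assert (Hsx := Hsq q x Hq1 Hq3). specialize (H2 q Hq1).
  assert (H := Rabs_maj2 (ln l0)).
  assert (beta * (ln x - Rabs (ln l0) - ln (INR q)) <= 0)
    by (rewrite <- (Rmult_0_r beta); apply Rmult_le_compat_l; [lra|]; assert (Hu := Rle_abs (ln l0)); lra).
  lra.
Qed.

(* Passing from the step l to l/K multiplies the p-th term of the weight matrix by at most
   a constant times (e^A K^alpha)^(-p). *)
Lemma phi_star_dilation alpha A : 0 < alpha < beta ->
  exists K c, 1 <= K /\ forall x, 0 <= x ->
    (A + alpha * ln K) * x - c <= F x - K * F (x / K).
Proof.
intros Ha.
destruct slope_growth as (C & HC & Hsl & _).
set (A' := Rmax A 0).
(* Solves beta ln K - C = A' + alpha ln K: the left side is the guaranteed gain in slope from y/K to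
   y, the right side is what has to be paid per unit of x. *)
set (K := exp ((A' + C) / (beta - alpha))).
assert (HA' : 0 <= A') by apply Rmax_r.
assert (HK : 1 <= K).
{ rewrite <- exp_0. apply exp_monotone. apply Rdiv_le_0_compat; lra. }
assert (HlnK : ln K = (A' + C) / (beta - alpha)) by apply ln_exp.
assert (HlnK' : beta * ln K - C = A' + alpha * ln K).
{ rewrite HlnK. field. lra. }
assert (HlnK0 := ln_nonneg K HK).
set (a := A' + alpha * ln K) in *.
assert (Ha0 : 0 <= a) by (unfold a; nra).
set (c := K * F (2 * l0) + a * (2 * K * l0)).
exists K, c. split; [exact HK|].
(* Induction in steps of length K l0, under which x/K moves by l0. The first interval has twice that
   length, so that afterwards y/K >= l0 and [slope_growth] applies; c absorbs it. *)
assert (Hind : forall n x, 0 <= x -> x <= (INR n + 2) * (K * l0) ->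
  a * x - c <= F x - K * F (x / K)).
{ induction n as [|n IH].
  - intros x Hx Hx2. simpl in Hx2.
    assert (H1 := phi_star_nonneg sigma Hs x Hx). fold F in H1.
    assert (H2 : F (x / K) <= F (2 * l0)).
    { apply (phi_star_monotone sigma Hs). split; [apply Rdiv_le_0_compat; lra|].
      apply Rle_div_l; lra. }
    assert (K * F (x / K) <= K * F (2 * l0)) by (apply Rmult_le_compat_l; lra).
    assert (a * x <= a * (2 * K * l0)) by (apply Rmult_le_compat_l; lra).
    unfold c. lra.
  - intros x Hx Hx2. rewrite S_INR in Hx2.
    destruct (Rle_dec x ((INR n + 2) * (K * l0))) as [h|h]; [now apply IH|].
    assert (HKl : 0 < K * l0) by (apply Rmult_lt_0_compat; lra).
    assert (Hn := pos_INR n).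
    set (y := x - K * l0).
    assert (Hy : K * l0 <= y) by (unfold y; nra).
    specialize (IH y ltac:(lra) ltac:(unfold y; nra)).
    assert (HyK : l0 <= y / K) by (apply Rle_div_r; lra).
    assert (E1 := Hsl (y / K) y HyK ltac:(apply Rle_div_l; nra)).
    rewrite (ln_div y K) in E1 by lra.
    assert (E2 := phi_star_chord sigma Hs y l0 y (K * l0) ltac:(lra) Hl0 HKl ltac:(lra) ltac:(nra)).
    fold F in E2.
    replace (y + K * l0) with x in E2 by (unfold y; ring).
    replace (x / K) with (y / K + l0) by (unfold y; field; lra).
    assert (E3 : K * (F (y + l0) - F y) <= F x - F y).
    { apply Rmult_le_reg_r with l0; [assumption|]. lra. }
    assert (E4 : l0 * s y = F (y + l0) - F y) by (unfold s; field; lra).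
    assert (E5 : l0 * s (y / K) = F (y / K + l0) - F (y / K)) by (unfold s; field; lra).
    assert (E6 : K * l0 * a <= K * (l0 * s y - l0 * s (y / K))).
    { rewrite <- HlnK'. replace (K * (l0 * s y - l0 * s (y / K))) with (K * l0 * (s y - s (y / K))) by ring.
      apply Rmult_le_compat_l; lra. }
    rewrite E4, E5 in E6.
    replace (a * x) with (a * y + K * l0 * a) by (unfold y; ring). nra. }
intros x Hx.
assert (HKl : 0 < K * l0) by (apply Rmult_lt_0_compat; lra).
destruct (nfloor (x / (K * l0))) as [n Hn]; [apply Rdiv_le_0_compat; lra|].
assert (H := Hind n x Hx).
assert (Hx' : x <= (INR n + 2) * (K * l0)).
{ apply Rle_div_l; lra. }
specialize (H Hx'). unfold a in H. assert (A * x <= A' * x) by (apply Rmult_le_compat_r; [lra|apply Rmax_l]). lra.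
Qed.

End Growth.

(** * The conjugate of the convolved weight function *)

Lemma rpow_pos t b : 0 < t -> rpow t b = Rpower t b.
Proof. intro H. unfold rpow. destruct (Rle_dec t 0); [lra|reflexivity]. Qed.

Lemma rpow_nonneg t b : 0 <= rpow t b.
Proof. unfold rpow. destruct (Rle_dec t 0); [lra|]. left; apply exp_pos. Qed.

Section Conjugate.

Variable sigma : R -> R.
Hypothesis Hs : W0 sigma.
Variable alpha : R.
Hypothesis Halpha : 0 < alpha.
Hypothesis Hb : little_o_infty sigma (id_pow (1 / alpha)).

Let ph := phi sigma.
Let F := phi_star sigma.
Let om := conj_hat sigma (id_pow (1 / alpha)).
Let Om := phi om.

Lemma rpow_exp_quotient u y :
  rpow (exp u / exp y) (1 / alpha) = exp ((u - y) / alpha).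
Proof.
rewrite rpow_pos by (apply Rdiv_lt_0_compat; apply exp_pos).
unfold Rpower. rewrite ln_div, !ln_exp by apply exp_pos. f_equal. field. lra.
Qed.

Lemma conj_hat_exp y : Om y =
  Rsup (fun z => exists s, 0 <= s /\ z = sigma s - id_pow (1 / alpha) (s / exp y)).
Proof.
unfold Om, om, phi, conj_hat.
destruct (Req_dec_T (exp y) 0) as [h|h]; [|reflexivity].
assert (H := exp_pos y). lra.
Qed.

Lemma sigma_zero_at_0 : sigma 0 = 0.
Proof. apply (W0_zero _ Hs). lra. Qed.

Lemma conj_hat_bounded y : exists B, forall s, 0 <= s ->
  sigma s - id_pow (1 / alpha) (s / exp y) <= B.
Proof.
(* For eps = e^(-y/alpha) the little-o bound reads sigma s <= (s/e^y)^(1/alpha), so beyond M the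
   difference is not positive. *)
destruct (Hb (mkposreal _ (exp_pos (- y / alpha)))) as [M HM].
exists (sigma (Rmax M 0)). intros s Hs0.
destruct (Rle_dec s (Rmax M 0)) as [h|h].
- assert (H := W0_nondecreasing _ Hs s _ Hs0 h).
  assert (H1 := rpow_nonneg (s / exp y) (1 / alpha)). unfold id_pow. lra.
- assert (h1 := Rmax_l M 0). assert (h2 := Rmax_r M 0).
  specialize (HM s ltac:(lra)). simpl in HM. unfold norm in HM; simpl in HM; unfold abs in HM; simpl in HM.
  rewrite (Rabs_pos_eq (sigma s)) in HM by (apply (W0_nonneg _ Hs); lra).
  rewrite (Rabs_pos_eq (id_pow (1 / alpha) s)) in HM by apply rpow_nonneg.
  unfold id_pow in *. rewrite <- (exp_ln s) at 2 by lra. rewrite rpow_exp_quotient.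
  rewrite rpow_pos in HM by lra. unfold Rpower in HM. rewrite <- exp_plus in HM.
  replace (- y / alpha + 1 / alpha * ln s) with ((ln s - y) / alpha) in HM by (field; lra).
  assert (H := W0_nonneg _ Hs (Rmax M 0) h2). lra.
Qed.

Lemma conj_hat_ub u y : ph u - exp ((u - y) / alpha) <= Om y.
Proof.
rewrite conj_hat_exp. destruct (conj_hat_bounded y) as [B HB].
apply (Rsup_ub _ B).
- intros z [s [H ->]]. now apply HB.
- exists (exp u). split; [left; apply exp_pos|]. unfold id_pow. now rewrite rpow_exp_quotient.
Qed.

Lemma conj_hat_nonneg y : 0 <= Om y.
Proof.
rewrite conj_hat_exp. destruct (conj_hat_bounded y) as [B HB].
apply (Rsup_ub _ B).
- intros z [s [H ->]]. now apply HB.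
- exists 0. split; [lra|]. rewrite sigma_zero_at_0. unfold id_pow.
  replace (0 / exp y) with 0 by (unfold Rdiv; ring). unfold rpow.
  destruct (Rle_dec 0 0); lra.
Qed.

Lemma conj_hat_le y B : 0 <= B -> (forall u, ph u - exp ((u - y) / alpha) <= B) -> Om y <= B.
Proof.
intros H0 HB. rewrite conj_hat_exp. apply Rsup_le.
- eexists. exists 0. split; [lra|reflexivity].
- intros z [s [Hs0 ->]]. destruct Hs0 as [Hs0|<-].
  + rewrite <- (exp_ln s Hs0). unfold id_pow. rewrite rpow_exp_quotient. apply HB.
  + rewrite sigma_zero_at_0. assert (H1 := rpow_nonneg (0 / exp y) (1 / alpha)). unfold id_pow. lra.
Qed.

Lemma conj_hat_conjugate_le x y : 0 < x ->
  x * y - Om y <= F x - alpha * x * ln (alpha * x) + alpha * x.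
Proof.
intros Hx. assert (Hax : 0 < alpha * x) by (apply Rmult_lt_0_compat; lra).
(* This u minimises e^((u - y)/alpha) - x (u - y); the exponential then equals alpha x. *)
assert (H := conj_hat_ub (y + alpha * ln (alpha * x)) y).
replace ((y + alpha * ln (alpha * x) - y) / alpha) with (ln (alpha * x)) in H by (field; lra).
rewrite exp_ln in H by assumption.
assert (H2 := phi_star_ub sigma Hs x (y + alpha * ln (alpha * x)) ltac:(lra)).
fold F ph in H2. nra.
Qed.

Lemma conj_hat_conjugate_bounded x : 0 <= x -> exists B, forall y, x * y - Om y <= B.
Proof.
intros [Hx|<-].
- eexists. intro y. now apply conj_hat_conjugate_le.
- exists 0. intro y. assert (H := conj_hat_nonneg y). lra.
Qed.

Lemma phi_star_conj_hat_le x : 0 < x ->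
  phi_star om x <= F x - alpha * x * ln (alpha * x) + alpha * x.
Proof.
intros Hx. apply Rsup_le.
- exists (x * 0 - phi om 0), 0. split; [intros _; lra|reflexivity].
- intros z [y [_ ->]]. now apply conj_hat_conjugate_le.
Qed.

Lemma phi_star_conj_hat_0 : phi_star om 0 <= 0.
Proof.
apply Rsup_le.
- exists (0 * 0 - phi om 0), 0. split; [intros _; lra|reflexivity].
- intros z [y [_ ->]]. assert (H := conj_hat_nonneg y). unfold Om in H. lra.
Qed.

(** Both conventions in [phi_star] have to be covered. If [om] vanishes on [0,1], the supremum is
    over y >= 0 only, but then [Om] is 0 at 0 and y = 0 dominates every negative y. *)
Lemma phi_star_conj_hat_ub x y : 0 <= x -> x * y - Om y <= phi_star om x.
Proof.
intros Hx. destruct (conj_hat_conjugate_bounded x Hx) as [B HB].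
assert (Hub : forall y, (zero_on_unit_interval om -> 0 <= y) -> x * y - Om y <= phi_star om x).
{ intros z Hz. apply (Rsup_ub _ B).
  - intros w [v [_ ->]]. apply HB.
  - exists z. split; [exact Hz|reflexivity]. }
destruct (classic (zero_on_unit_interval om)) as [hz|hz]; [|apply Hub; tauto].
destruct (Rle_dec 0 y) as [h|h]; [apply Hub; auto|].
assert (H0 := Hub 0 (fun _ => Rle_refl 0)).
assert (Om 0 = 0).
{ unfold Om, phi. apply hz. rewrite exp_0. lra. }
assert (H1 := conj_hat_nonneg y). nra.
Qed.

Variables l0 beta : R.
Hypothesis Hl0 : 0 < l0.
Hypothesis Hbeta : alpha < beta.
Hypothesis Hq : almost_increasing_quot (weight_matrix sigma l0) beta.

(** F has slope about u0 to the right of x and at most u to the left of z. As slopes of F grow by at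
    least beta (ln z - ln x) - C, the derivative z of [ph] at u exceeds x at most by a factor of
    order e^((u - u0)/beta). *)
Lemma subgradient_growth : exists C, 1 <= C /\ forall x u0 u z, l0 <= x ->
  F x - 1 <= x * u0 - ph u0 -> u0 < u -> 0 <= z -> F z = z * u - ph u ->
  z <= C * x * exp ((u - u0) / beta).
Proof.
destruct (slope_growth sigma Hs l0 beta Hl0 ltac:(lra) Hq) as (C & HC & Hsl & _).
fold F in Hsl.
set (C2 := C + / l0 + beta * ln 2).
assert (Hln2 := ln_nonneg 2 ltac:(lra)).
assert (Hl0' := Rinv_0_lt_compat _ Hl0).
assert (0 <= C2) by (unfold C2; nra).
assert (Hexp : 1 <= exp (C2 / beta)).
{ rewrite <- exp_0. apply exp_monotone, Rdiv_le_0_compat; lra. }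
exists (2 * exp (C2 / beta)). split; [lra|].
intros x u0 u z Hx Hu0 Hu Hz HFz.
assert (He : 1 <= exp ((u - u0) / beta)).
{ rewrite <- exp_0. apply exp_monotone, Rdiv_le_0_compat; lra. }
destruct (Rle_dec z (2 * x)) as [h|h].
{ apply Rle_trans with (1 := h). assert (1 <= exp (C2 / beta) * exp ((u - u0) / beta)) by nra. nra. }
assert (E1 : (F (z - l0 + l0) - F (z - l0)) / l0 <= u).
{ replace (z - l0 + l0) with z by ring.
  assert (H1 := phi_star_ub sigma Hs (z - l0) u ltac:(lra)). fold F ph in H1.
  apply Rle_div_l; nra. }
assert (E2 : u0 - / l0 <= (F (x + l0) - F x) / l0).
{ assert (H1 := phi_star_ub sigma Hs (x + l0) u0 ltac:(lra)). fold F ph in H1.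
  apply Rle_div_r; [lra|]. rewrite Rmult_minus_distr_r, Rinv_l by lra. nra. }
assert (E3 := Hsl x (z - l0) Hx ltac:(lra)).
assert (E4 : ln z - ln 2 <= ln (z - l0)).
{ rewrite <- ln_div by lra. apply ln_monotone; lra. }
assert (E5 : ln z <= ln x + (u - u0 + C2) / beta).
{ assert ((ln z - ln x) * beta <= u - u0 + C2).
  { assert (beta * (ln z - ln 2 - ln x) <= beta * (ln (z - l0) - ln x)) by (apply Rmult_le_compat_l; lra).
    unfold C2. lra. }
  assert (ln z - ln x <= (u - u0 + C2) / beta) by (apply Rle_div_r; lra). lra. }
rewrite <- (exp_ln z) by lra.
apply Rle_trans with (1 := exp_monotone _ _ E5).
rewrite exp_plus, exp_ln by lra.
replace ((u - u0 + C2) / beta) with (C2 / beta + (u - u0) / beta) by (field; lra).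
rewrite exp_plus. assert (0 < exp (C2 / beta) * exp ((u - u0) / beta)) by nra. nra.
Qed.

(** The near-maximiser u0 for F x, shifted to y = u0 - alpha ln x - D, is tested in the conjugate of
    [om]. For w = u - u0 > 0 the increment of [ph] is at most C3 x w e^(w/beta), and because beta >
    alpha the subtracted term x e^(D/alpha) e^(w/alpha) dominates it. *)
Lemma conj_hat_conjugate_ge : exists C, 0 <= C /\ forall x, l0 <= x ->
  F x - alpha * x * ln x - C * x - 1 <= phi_star om x.
Proof.
destruct subgradient_growth as (C3 & HC3 & Hsub).
set (kap := / alpha - / beta).
assert (Hkap : 0 < kap).
{ unfold kap. assert (/ beta < / alpha); [|lra]. apply Rinv_lt_contravar; [nra|lra]. }
(* Makes e^(D/alpha) >= C3/kap; with e^(kap w) >= kap w this absorbs the factor w. *)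
set (D := Rmax 0 (alpha * ln (C3 / kap))).
assert (HD : 0 <= D) by apply Rmax_l.
assert (HC3k : 0 < C3 / kap) by (apply Rdiv_lt_0_compat; lra).
assert (HD' : C3 / kap <= exp (D / alpha)).
{ rewrite <- (exp_ln (C3 / kap)) at 1 by assumption. apply exp_monotone.
  apply Rle_div_r; [lra|]. rewrite Rmult_comm. apply Rmax_r. }
exists D. split; [exact HD|].
intros x Hx.
destruct (phi_star_near sigma Hs x 1 ltac:(lra) ltac:(lra)) as (u0 & Hu0 & Hn).
fold F ph in Hn.
set (y := u0 - alpha * ln x - D).
apply Rle_trans with (2 := phi_star_conj_hat_ub x y ltac:(lra)).
assert (HOm : Om y <= ph u0).
{ apply conj_hat_le; [apply (phi_nonneg sigma Hs)|]. intro u.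
  destruct (Rle_dec u u0) as [h|h].
  { assert (H := phi_monotone sigma Hs u u0 h). assert (H1 := exp_pos ((u - y) / alpha)). fold ph in H. lra. }
  destruct (phi_subgradient sigma Hs u) as (z & Hz & Hz1 & Hz2). fold ph F in Hz1, Hz2.
  specialize (Hsub x u0 u z Hx ltac:(lra) ltac:(lra) Hz Hz2).
  specialize (Hz1 u0). set (w := u - u0) in *.
  assert (Hw : 0 < w) by (unfold w; lra).
  assert (E : (u - y) / alpha = ln x + D / alpha + (w * kap + w / beta)).
  { unfold y, w, kap. field. lra. }
  rewrite E, !exp_plus, exp_ln by lra.
  assert (H1 := exp_ineq1_le (w * kap)).
  assert (Hew := exp_pos (w / beta)). set (ew := exp (w / beta)) in *.
  assert (H2 : C3 * w <= exp (D / alpha) * exp (w * kap)).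
  { replace (C3 * w) with (C3 / kap * (w * kap)) by (field; lra).
    apply Rmult_le_compat; try nra. }
  assert (H3 : C3 * w * (x * ew) <= exp (D / alpha) * exp (w * kap) * (x * ew)).
  { apply Rmult_le_compat_r; [nra|exact H2]. }
  assert (H4 : z * w <= C3 * x * ew * w) by (apply Rmult_le_compat_r; lra).
  replace (u0 - u) with (- w) in Hz1 by (unfold w; ring). nra. }
assert (E : x * y = x * u0 - alpha * x * ln x - D * x) by (unfold y; ring).
lra.
Qed.

Lemma phi_star_conj_hat_ge : exists C, 0 <= C /\ forall x, 0 <= x ->
  F x - alpha * x * ln x - C * (x + 1) <= phi_star om x.
Proof.
destruct conj_hat_conjugate_ge as (D & HD & HDx).
assert (HOm0 := conj_hat_nonneg 0).
assert (HF0 := phi_star_nonneg sigma Hs l0 ltac:(lra)). fold F in HF0.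
exists (D + 1 + Om 0 + F l0 + alpha). split; [lra|].
intros x Hx. destruct (Rle_dec l0 x) as [h|h].
- specialize (HDx x h).
  assert (0 <= Om 0 * x) by nra. assert (0 <= F l0 * x) by nra. assert (0 <= alpha * x) by nra. nra.
- assert (H := phi_star_conj_hat_ub x 0 Hx).
  assert (H1 := phi_star_monotone sigma Hs x l0 ltac:(lra)). fold F in H1.
  assert (H2 : - 1 <= x * ln x).
  { destruct Hx as [Hx|<-]; [|lra].
    assert (H2 := ln_le_sub (/ x) (Rinv_0_lt_compat _ Hx)). rewrite ln_Rinv in H2 by assumption.
    apply (Rmult_le_compat_l x) in H2; [|lra].
    rewrite Rmult_minus_distr_l, Rinv_r in H2 by lra. lra. }
  assert (0 <= Om 0 * x) by nra. assert (0 <= F l0 * x) by nra. assert (0 <= alpha * x) by nra. nra.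
Qed.

End Conjugate.

(** * The equalities of the spaces *)

Definition lnfact (n : nat) : R := ln (INR (fact n)).

Lemma lnfact_0 : lnfact 0 = 0.
Proof. unfold lnfact. simpl. apply ln_1. Qed.

Lemma lnfact_S n : lnfact (S n) = lnfact n + ln (INR n + 1).
Proof.
unfold lnfact. rewrite fact_simpl, mult_INR, S_INR.
assert (H := pos_INR n).
rewrite ln_mult; [ring|lra|apply INR_fact_lt_0].
Qed.

(** With [lnfact_ge] this is Stirling's formula up to a factor e^n; ln(n + 1) in place of ln n keeps
    n = 0 harmless. *)
Lemma lnfact_le n : lnfact n <= INR n * ln (INR n + 1).
Proof.
induction n as [|n IH]; [rewrite lnfact_0; simpl; lra|].
rewrite lnfact_S, S_INR. assert (Hn := pos_INR n).
assert (H := ln_monotone (INR n + 1) (INR n + 1 + 1) ltac:(lra) ltac:(lra)). nra.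
Qed.

Lemma lnfact_ge n : INR n * ln (INR n + 1) - INR n <= lnfact n.
Proof.
induction n as [|n IH]; [rewrite lnfact_0; simpl; lra|].
rewrite lnfact_S, S_INR. assert (Hn := pos_INR n).
assert (H := ln_le_sub ((INR n + 1 + 1) / (INR n + 1)) ltac:(apply Rdiv_lt_0_compat; lra)).
rewrite ln_div in H by lra.
replace ((INR n + 1 + 1) / (INR n + 1) - 1) with (/ (INR n + 1)) in H by (field; lra).
apply (Rmult_le_compat_l (INR n + 1)) in H; [|lra]. rewrite Rinv_r in H by lra. nra.
Qed.

Lemma div_gevrey_exp sigma alpha l p :
  div_gevrey (weight_matrix sigma) alpha l p =
  exp (phi_star sigma (l * INR p) / l - alpha * lnfact p).
Proof.
unfold div_gevrey, weight_matrix, Rpower, lnfact. unfold Rminus. rewrite exp_plus, exp_Ropp.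
reflexivity.
Qed.

Lemma div_gevrey_pos sigma alpha l p : 0 < div_gevrey (weight_matrix sigma) alpha l p.
Proof. rewrite div_gevrey_exp. apply exp_pos. Qed.

Lemma phi_star_ext om om' x : (forall t, 0 <= t -> om t = om' t) ->
  phi_star om x = phi_star om' x.
Proof.
intro H. apply Rsup_ext. intro z.
assert (Hz : zero_on_unit_interval om <-> zero_on_unit_interval om').
{ split; intros h t Ht; [rewrite <- H|rewrite H]; try apply h; lra. }
split; intros [y [Hy ->]]; exists y; unfold phi; rewrite H by apply Rlt_le, exp_pos; tauto.
Qed.

Lemma schwartz_weight_ext om om' f : (forall t, 0 <= t -> om t = om' t) ->
  schwartz_weight om f <-> schwartz_weight om' f.
Proof.
intro H. unfold schwartz_weight, weight_matrix.
split; intros [H1 H2]; (split; [exact H1|]); intros l Hl; destruct (H2 l Hl) as [K HK];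
  exists K; intros x j k; specialize (HK x j k); rewrite (phi_star_ext om om' _ H) in *; exact HK.
Qed.

(** The substitution of s^alpha for s, a bijection of [0,+oo), identifies the two sets whose suprema
    are taken. At t = 0 both sides are 0 because sigma 0 = 0. *)
Lemma legendre_conj_hat sigma alpha t : sigma 0 = 0 -> 0 < alpha -> 0 <= t ->
  arg_pow (iota (legendre (arg_pow sigma alpha))) (1 / alpha) t =
  conj_hat sigma (id_pow (1 / alpha)) t.
Proof.
intros H0 Ha Ht. unfold arg_pow, iota, conj_hat.
destruct (Req_dec_T t 0) as [->|h].
- assert (E : rpow 0 (1 / alpha) = 0) by (unfold rpow; destruct (Rle_dec 0 0); lra).
  unfold id_pow. rewrite E, H0. destruct (Req_dec_T 0 0); lra.
- assert (Ht' : 0 < t) by lra. rewrite (rpow_pos t) by assumption.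
  assert (Hp : 0 < Rpower t (1 / alpha)) by apply exp_pos.
  destruct (Req_dec_T (Rpower t (1 / alpha)) 0) as [h'|h']; [lra|].
  unfold legendre. apply Rsup_ext. intro z.
  assert (E : forall s, 0 < s -> 1 / Rpower t (1 / alpha) * s =
     id_pow (1 / alpha) (rpow s alpha / t)).
  { intros s Hs. unfold id_pow. rewrite (rpow_pos s) by assumption.
    rewrite rpow_pos by (apply Rdiv_lt_0_compat; [apply exp_pos|assumption]).
    rewrite <- (exp_ln s) at 1 by assumption. unfold Rpower.
    unfold Rdiv at 1. rewrite Rmult_1_l, <- exp_Ropp, <- exp_plus. f_equal.
    rewrite ln_div by (try apply exp_pos; assumption). rewrite ln_exp. field. lra. }
  assert (E0 : rpow 0 alpha = 0) by (unfold rpow; destruct (Rle_dec 0 0); lra).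
  split.
  + intros [s [Hs ->]]. exists (rpow s alpha). split; [apply rpow_nonneg|].
    destruct Hs as [Hs|<-].
    * now rewrite E.
    * rewrite E0. unfold id_pow. replace (0 / t) with 0 by (unfold Rdiv; ring).
      unfold rpow. destruct (Rle_dec 0 0); lra.
  + intros [s [Hs ->]]. exists (rpow s (1 / alpha)). split; [apply rpow_nonneg|].
    destruct Hs as [Hs|<-].
    * assert (Er : rpow (rpow s (1 / alpha)) alpha = s).
      { rewrite (rpow_pos s) by assumption. rewrite rpow_pos by apply exp_pos.
        rewrite Rpower_mult. replace (1 / alpha * alpha) with 1 by (field; lra).
        now apply Rpower_1. }
      rewrite E by (rewrite rpow_pos by assumption; apply exp_pos). now rewrite Er.
    * assert (Ez : forall b, rpow 0 b = 0) by (intro b; unfold rpow; destruct (Rle_dec 0 0); lra).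
      rewrite Ez, E0. unfold id_pow. replace (0 / t) with 0 by (unfold Rdiv; ring). rewrite Ez. lra.
Qed.

Lemma weighted_bound_le A X Y K K0 : 0 <= A -> 0 < X -> 0 < Y -> X <= K0 * Y ->
  A / X <= K -> A / Y <= K * K0.
Proof.
intros HA HX HY HXY HK.
assert (H0 : 0 <= A / X) by (apply Rdiv_le_0_compat; assumption).
assert (HK0 := Rle_trans _ _ _ H0 HK).
apply Rle_div_l in HK; [|assumption]. apply Rle_div_l; [assumption|].
assert (K * X <= K * (K0 * Y)) by (apply Rmult_le_compat_l; lra). lra.
Qed.

Section Equivalence.

Variables (sigma : R -> R) (alpha l0 beta : R).
Hypothesis Hs : W0 sigma.
Hypothesis Halpha : 0 < alpha.
Hypothesis Hb : little_o_infty sigma (id_pow (1 / alpha)).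
Hypothesis Hl0 : 0 < l0.
Hypothesis Hbeta : alpha < beta.
Hypothesis Hq : almost_increasing_quot (weight_matrix sigma l0) beta.

Let om := conj_hat sigma (id_pow (1 / alpha)).
Let M := div_gevrey (weight_matrix sigma) alpha.

(** The weighted space has no geometric factor to offer, so an arbitrary h must be paid by lowering
    l to l/K, using [phi_star_dilation]. *)
Lemma weight_conj_hat_le_div_gevrey l h : 0 < l -> 0 < h ->
  exists l' K, 0 < l' /\ forall p, weight_matrix om l' p <= K * (h ^ p * M l p).
Proof.
intros Hl Hh.
(* Chosen so that, with x = l n, all terms linear in n cancel except n ln h; the ln K of the
   dilation cancels the one from ln(alpha x/K). *)
set (A := - ln h - alpha * ln (alpha * l) + alpha).
destruct (phi_star_dilation sigma Hs l0 beta Hl0 ltac:(lra) Hq alpha A ltac:(lra)) as (K & c & HK & HKc).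
exists (l / K), (exp (Rabs c / l + alpha)). split; [apply Rdiv_lt_0_compat; lra|].
intro p. unfold M. rewrite div_gevrey_exp, <- Rpower_pow by assumption. unfold Rpower, weight_matrix.
rewrite <- !exp_plus. apply exp_monotone.
assert (Hc := Rle_abs c). assert (Hc' := Rabs_pos c).
assert (Hcl : 0 <= Rabs c / l) by (apply Rdiv_le_0_compat; lra).
destruct p as [|p].
{ simpl INR. rewrite lnfact_0, !Rmult_0_r, (phi_star_zero sigma Hs).
  assert (H := phi_star_conj_hat_0 sigma Hs alpha Halpha Hb). fold om in H.
  assert (phi_star om 0 / (l / K) <= 0).
  { apply Rle_div_l; [apply Rdiv_lt_0_compat; lra|]. lra. }
  unfold Rdiv at 3. rewrite Rmult_0_l. lra. }
set (n := INR (S p)).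
assert (Hn : 1 <= n) by (apply INR_pos; lia).
set (x := l * n). assert (Hx : 0 < x) by (unfold x; nra).
replace (l / K * n) with (x / K) by (unfold x; field; lra).
assert (H1 := phi_star_conj_hat_le sigma Hs alpha Halpha Hb (x / K) ltac:(apply Rdiv_lt_0_compat; lra)).
specialize (HKc x ltac:(lra)). fold om in H1.
assert (H2 : phi_star om (x / K) * K <=
   phi_star sigma x - (A + alpha * ln K) * x + c - alpha * x * ln (alpha * (x / K)) + alpha * x).
{ apply (Rmult_le_compat_r K) in H1; [|lra].
  replace ((phi_star sigma (x / K) - alpha * (x / K) * ln (alpha * (x / K)) + alpha * (x / K)) * K)
   with (K * phi_star sigma (x / K) - alpha * x * ln (alpha * (x / K)) + alpha * x) in H1 by (field; lra).
  lra. }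
replace (alpha * (x / K)) with ((alpha * l) * (n / K)) in H2 by (unfold x; field; lra).
rewrite (ln_mult (alpha * l)), ln_div in H2 by (try apply Rdiv_lt_0_compat; nra).
assert (H3 : phi_star om (x / K) / (l / K) <=
  phi_star sigma x / l + ln h * n + c / l - alpha * n * ln n).
{ replace (phi_star om (x / K) / (l / K)) with (phi_star om (x / K) * K / l) by (field; lra).
  apply Rle_div_l; [lra|].
  replace ((phi_star sigma x / l + ln h * n + c / l - alpha * n * ln n) * l) with
   (phi_star sigma x + ln h * x + c - alpha * x * ln n) by (unfold x; field; lra).
  apply Rle_trans with (1 := H2). unfold A. right. ring. }
assert (H4 : c / l <= Rabs c / l) by (apply Rmult_le_compat_r; [left; now apply Rinv_0_lt_compat|lra]).
assert (H5 := lnfact_le p). rewrite lnfact_S.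
replace (INR p + 1) with n in * by (unfold n; now rewrite S_INR).
assert (H6 : lnfact p + ln n <= n * ln n).
{ unfold n in *. rewrite S_INR in *. lra. }
assert (H7 : alpha * (lnfact p + ln n) <= alpha * (n * ln n)) by (apply Rmult_le_compat_l; lra).
lra.
Qed.

(** Here l is kept and the geometric loss goes into h, over which the space of the matrix
    quantifies. *)
Lemma div_gevrey_le_weight_conj_hat l : 0 < l ->
  exists h K, 0 < h /\ forall p, h ^ p * M l p <= K * weight_matrix om l p.
Proof.
intros Hl.
destruct (phi_star_conj_hat_ge sigma Hs alpha Halpha Hb l0 beta Hl0 Hbeta Hq) as (C & HC & HCx).
fold om in HCx.
exists (exp (- (C + alpha + alpha * Rabs (ln l)))), (exp (C / l)). split; [apply exp_pos|].
intro p. unfold M. rewrite div_gevrey_exp, <- Rpower_pow by apply exp_pos. unfold Rpower, weight_matrix.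
rewrite <- !exp_plus, ln_exp. apply exp_monotone.
set (n := INR p). assert (Hn : 0 <= n) by apply pos_INR.
specialize (HCx (l * n) ltac:(nra)).
assert (H1 : alpha * n * ln (l * n) <= alpha * (lnfact p + n) + n * (alpha * Rabs (ln l))).
{ destruct Hn as [Hn|Hn].
  - rewrite ln_mult by assumption.
    assert (H1 := lnfact_ge p). fold n in H1.
    assert (H2 := ln_monotone n (n + 1) Hn ltac:(lra)).
    assert (H3 := Rle_abs (ln l)).
    assert (alpha * n * ln l <= alpha * n * Rabs (ln l)) by (apply Rmult_le_compat_l; nra).
    assert (alpha * (n * ln n) <= alpha * (lnfact p + n)) by (apply Rmult_le_compat_l; nra). lra.
  - assert (p = 0)%nat by (apply INR_eq; simpl; fold n; lra). subst p.
    rewrite lnfact_0, <- Hn. lra. }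
assert (H2 : phi_star sigma (l * n) / l <= alpha * n * ln (l * n) + C * n + C / l + phi_star om (l * n) / l).
{ apply Rle_div_l; [lra|].
  replace ((alpha * n * ln (l * n) + C * n + C / l + phi_star om (l * n) / l) * l)
   with (alpha * (l * n) * ln (l * n) + C * (l * n + 1) + phi_star om (l * n)) by (field; lra). lra. }
lra.
Qed.

Lemma schwartz_conj_hat_div_gevrey f : schwartz_weight om f <-> schwartz_matrix M f.
Proof.
assert (Hnn : forall x (j k : nat), 0 <= (1 + Rabs x) ^ k * Cmod (CDerive_n f j x)).
{ intros x j k. apply Rmult_le_pos; [|apply Cmod_ge_0]. apply pow_le.
  assert (H := Rabs_pos x). lra. }
split; intros [H1 H2]; (split; [exact H1|]).
- intros l h Hl Hh.
  destruct (weight_conj_hat_le_div_gevrey l h Hl Hh) as (l' & K0 & Hl' & HK0).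
  destruct (H2 l' Hl') as [K HK]. exists (K * K0). intros x j k.
  eapply weighted_bound_le; [apply Hnn| |  |apply HK0|apply HK].
  + apply exp_pos.
  + apply Rmult_lt_0_compat; [now apply pow_lt|apply div_gevrey_pos].
- intros l Hl. destruct (div_gevrey_le_weight_conj_hat l Hl) as (h & K0 & Hh & HK0).
  destruct (H2 l h Hl Hh) as [K HK]. exists (K * K0). intros x j k.
  eapply weighted_bound_le; [apply Hnn| |  |apply HK0|apply HK].
  + apply Rmult_lt_0_compat; [now apply pow_lt|apply div_gevrey_pos].
  + apply exp_pos.
Qed.

End Equivalence.

(** * Products of families of derivatives and a flat Gevrey function *)

(** All derivatives are carried along as explicit functions, and estimates are made on them;
    [deriv_family_Derive_n] translates back to [Derive_n]. *)
Definition deriv_family (D : nat -> R -> R) : Prop :=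
  forall n x, is_derive (D n) x (D (S n) x).

Lemma deriv_family_Derive_n D n x : deriv_family D -> Derive_n (D 0%nat) n x = D n x.
Proof.
intro HD. revert x. induction n as [|n IH]; intro x; [reflexivity|].
simpl. rewrite (Derive_ext _ (D n)) by exact IH. apply is_derive_unique, HD.
Qed.

Lemma deriv_family_ex_derive_n D n x : deriv_family D -> ex_derive_n (D 0%nat) n x.
Proof.
intro HD. destruct n as [|n]; [exact I|]. simpl.
apply ex_derive_ext with (D n); [intro t; symmetry; now apply deriv_family_Derive_n|].
exists (D (S n) x). apply HD.
Qed.

(** Serves where the rules of calculus do not reach: the flat function at 0 and termwise
    differentiation of the trigonometric series. *)
Lemma is_derive_quadratic (f : R -> R) x l K :
  (forall h, Rabs (f (x + h) - f x - h * l) <= K * h ^ 2) -> is_derive f x l.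
Proof.
intro HK. apply is_derive_Reals. intros eps Heps.
assert (HK0 : 0 <= K).
{ specialize (HK 1). assert (H := Rabs_pos (f (x + 1) - f x - 1 * l)). lra. }
assert (Hd : 0 < eps / (K + 1)) by (apply Rdiv_lt_0_compat; lra).
exists (mkposreal _ Hd). intros h Hh Hhd. simpl in Hhd.
specialize (HK h).
replace ((f (x + h) - f x) / h - l) with ((f (x + h) - f x - h * l) / h) by (field; assumption).
unfold Rdiv. rewrite Rabs_mult, Rabs_inv.
assert (Hah := Rabs_pos_lt h Hh).
apply Rlt_div_l; [assumption|].
rewrite <- pow2_abs in HK.
apply Rlt_div_r in Hhd; [|lra]. nra.
Qed.

(* [prod_family A B n i j] is the n-th derivative of the product of the i-th
   derivative of A and the j-th derivative of B, which spares the binomial coefficients. *)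
Fixpoint prod_family (A B : nat -> R -> R) (n i j : nat) (x : R) : R :=
  match n with
  | O => A i x * B j x
  | S n => prod_family A B n (S i) j x + prod_family A B n i (S j) x
  end.

Lemma prod_family_deriv A B i j : deriv_family A -> deriv_family B ->
  deriv_family (fun n => prod_family A B n i j).
Proof.
intros HA HB n. revert i j. induction n as [|n IH]; intros i j x.
- simpl. apply (is_derive_mult (A i) (B j) x); auto. intros; apply Rmult_comm.
- apply (is_derive_plus (prod_family A B n (S i) j) (prod_family A B n i (S j))); apply IH.
Qed.

(** Each differentiation falls on A, costing e, or on B, costing h, and the total order in W is the
    same either way; so the binomial theorem produces (e + h)^n. *)
Lemma prod_family_bound A B W e h x :
  (forall i j, Rabs (A i x * B j x) <= e ^ i * h ^ j * W (i + j)%nat) ->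
  forall n i j, Rabs (prod_family A B n i j x) <= (e + h) ^ n * (e ^ i * h ^ j * W (n + i + j)%nat).
Proof.
intros H n. induction n as [|n IH]; intros i j; simpl prod_family.
- rewrite Rmult_1_l. apply H.
- apply Rle_trans with (1 := Rabs_triang _ _).
  assert (H1 := IH (S i) j). assert (H2 := IH i (S j)).
  replace (n + S i + j)%nat with (S n + i + j)%nat in H1 by lia.
  replace (n + i + S j)%nat with (S n + i + j)%nat in H2 by lia.
  simpl pow in *. nra.
Qed.

Lemma prod_family_zero_l A B x : (forall n, A n x = 0) -> forall n i j, prod_family A B n i j x = 0.
Proof.
intros H n. induction n as [|n IH]; intros i j; simpl; [rewrite H|rewrite !IH]; ring.
Qed.

Lemma prod_family_zero_r A B x : (forall n, B n x = 0) -> forall n i j, prod_family A B n i j x = 0.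
Proof.
intros H n. induction n as [|n IH]; intros i j; simpl; [rewrite H|rewrite !IH]; ring.
Qed.

Lemma prod_family_const_l A B x : A 0%nat x = 1 -> (forall n, A (S n) x = 0) ->
  forall n j, prod_family A B n 0 j x = B (n + j)%nat x.
Proof.
intros H0 H n.
assert (HS : forall n i j, prod_family A B n (S i) j x = 0).
{ clear n. intro n. induction n as [|n IH]; intros i j; simpl; [rewrite H|rewrite !IH]; ring. }
induction n as [|n IH]; intros j; simpl.
- rewrite H0. ring.
- rewrite HS, IH. replace (n + S j)%nat with (S (n + j)) by lia. ring.
Qed.

Definition gevrey (s : R) (D : nat -> R -> R) : Prop :=
  exists C B, 0 <= C /\ forall n x, Rabs (D n x) <= C * exp (B * INR n + s * lnfact n).

Lemma lnfact_superadditive i j : lnfact i + lnfact j <= lnfact (i + j).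
Proof.
induction i as [|i IH]; simpl Nat.add; [rewrite lnfact_0; lra|].
rewrite !lnfact_S. assert (H := pos_INR i).
assert (ln (INR i + 1) <= ln (INR (i + j) + 1)); [|lra].
apply ln_monotone; [lra|]. rewrite plus_INR. assert (H' := pos_INR j). lra.
Qed.

Lemma gevrey_prod s A B : 0 <= s -> gevrey s A -> gevrey s B ->
  gevrey s (fun n => prod_family A B n 0 0).
Proof.
intros Hs (C1 & B1 & HC1 & H1) (C2 & B2 & HC2 & H2).
set (D := Rmax B1 B2).
exists (C1 * C2), (ln 2 + D). split; [now apply Rmult_le_pos|].
intros n x.
set (W := fun n => C1 * C2 * exp (D * INR n + s * lnfact n)).
assert (H : Rabs (prod_family A B n 0 0 x) <= (1 + 1) ^ n * (1 ^ 0 * 1 ^ 0 * W (n + 0 + 0)%nat)).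
{ apply prod_family_bound. intros i j. rewrite !pow1, !Rmult_1_l, Rabs_mult. unfold W.
  apply Rle_trans with ((C1 * exp (B1 * INR i + s * lnfact i)) * (C2 * exp (B2 * INR j + s * lnfact j))).
  { apply Rmult_le_compat; auto using Rabs_pos. }
  replace ((C1 * exp (B1 * INR i + s * lnfact i)) * (C2 * exp (B2 * INR j + s * lnfact j)))
   with (C1 * C2 * (exp (B1 * INR i + s * lnfact i) * exp (B2 * INR j + s * lnfact j))) by ring.
  apply Rmult_le_compat_l; [now apply Rmult_le_pos|]. rewrite <- exp_plus. apply exp_monotone.
  rewrite plus_INR. assert (Hl := lnfact_superadditive i j).
  assert (Hi := pos_INR i). assert (Hj := pos_INR j).
  assert (B1 * INR i <= D * INR i) by (apply Rmult_le_compat_r; [assumption|apply Rmax_l]).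
  assert (B2 * INR j <= D * INR j) by (apply Rmult_le_compat_r; [assumption|apply Rmax_r]).
  nra. }
apply Rle_trans with (1 := H). simpl. rewrite !Rmult_1_l, !Nat.add_0_r.
rewrite <- (Rpower_pow n (1 + 1)) by lra. unfold Rpower, W.
replace (1 + 1) with 2 by ring.
rewrite (Rmult_comm (exp _)), Rmult_assoc, <- exp_plus.
right. f_equal. f_equal. ring.
Qed.

Section Flat.

Variable p : nat.
Hypothesis Hp1 : (1 <= p)%nat.

(* [flat n a] is the n-th derivative of y^a exp (- y^p), where y = 1/x, extended by 0 to
   x <= 0. *)
Fixpoint flat (n a : nat) (x : R) : R :=
  match n with
  | O => if Rlt_dec 0 x then (/ x) ^ a * exp (- (/ x) ^ p) else 0
  | S n => - INR a * flat n (S a) x + INR p * flat n (a + p + 1) x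
  end.

Lemma flat_nonpos n a x : x <= 0 -> flat n a x = 0.
Proof.
intro Hx. revert a. induction n as [|n IH]; intro a; simpl.
- destruct (Rlt_dec 0 x); lra.
- rewrite !IH. ring.
Qed.

Lemma flat_0_pos x : 0 < x -> 0 < flat 0 0 x.
Proof.
intro Hx. simpl. destruct (Rlt_dec 0 x); [|lra]. rewrite Rmult_1_l. apply exp_pos.
Qed.

(** With w = p ln y and c = a/p the exponent is c w - e^w, whose maximum is c ln c - c. Stating the
    bound with any L >= a lets one L serve all indices met in [flat_bound]. *)
Lemma flat_0_bound a x L : 0 < L -> INR a <= L ->
  0 <= flat 0 a x <= exp (INR a / INR p * ln L).
Proof.
intros HL HaL. simpl. destruct (Rlt_dec 0 x) as [Hx|Hx].
2:{ split; [lra|left; apply exp_pos]. }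
assert (Hy : 0 < / x) by now apply Rinv_0_lt_compat.
set (y := / x) in *.
split.
{ apply Rmult_le_pos; [apply pow_le; lra|left; apply exp_pos]. }
rewrite <- (Rpower_pow a), <- (Rpower_pow p) by assumption. unfold Rpower. rewrite <- exp_plus.
apply exp_monotone.
assert (Hp : 1 <= INR p) by (apply INR_pos; exact Hp1).
set (w := INR p * ln y).
assert (Ha := pos_INR a).
set (c := INR a / INR p).
assert (Hc : 0 <= c) by (apply Rdiv_le_0_compat; lra).
replace (INR a * ln y) with (c * w) by (unfold c, w; field; lra).
destruct Hc as [Hc|Hc].
- assert (H := exp_ineq1_le (w - ln c)). unfold Rminus in H. rewrite exp_plus, exp_Ropp, exp_ln in H by assumption.
  apply (Rmult_le_compat_l c) in H; [|lra].
  replace (c * (exp w * / c)) with (exp w) in H by (field; lra).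
  assert (Hl : ln c <= ln L).
  { apply ln_monotone; [assumption|]. apply Rle_trans with (2 := HaL). unfold c.
    apply Rle_div_l; [lra|]. rewrite <- (Rmult_1_r (INR a)) at 1. apply Rmult_le_compat_l; lra. }
  assert (c * ln c <= c * ln L) by (apply Rmult_le_compat_l; lra). nra.
- rewrite <- Hc. assert (H := exp_pos w). lra.
Qed.

Lemma flat_derive_0 a x : is_derive (flat 0 a) x (flat 1 a x).
Proof.
destruct (Rtotal_order x 0) as [h|[->|h]].
- rewrite flat_nonpos by lra.
  apply is_derive_ext_loc with (fun _ => 0); [|apply (is_derive_const 0 x)].
  exists (mkposreal (- x) ltac:(lra)). intros y Hy.
  unfold ball in Hy; simpl in Hy; unfold AbsRing_ball, abs, minus, plus, opp in Hy; simpl in Hy.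
  apply Rabs_def2 in Hy. symmetry. apply flat_nonpos. lra.
- rewrite flat_nonpos by lra.
  set (L := INR (a + 2)).
  assert (HL : 0 < L) by (apply lt_0_INR; lia).
  (* Two more powers of y = 1/x cost a bounded factor and yield the factor h^2. *)
  apply (is_derive_quadratic _ _ _ (exp (INR (a + 2) / INR p * ln L))).
  intro h. rewrite Rplus_0_l, (flat_nonpos 0 a 0), Rmult_0_r, !Rminus_0_r by lra.
  destruct (Rlt_dec 0 h) as [H|H].
  + destruct (flat_0_bound (a + 2) h L HL ltac:(unfold L; lra)) as [H1 H2].
    assert (E : flat 0 a h = flat 0 (a + 2) h * h ^ 2).
    { simpl. destruct (Rlt_dec 0 h); [|lra]. rewrite pow_add. simpl. field. lra. }
    rewrite E, Rabs_pos_eq by (apply Rmult_le_pos; [assumption|apply pow2_ge_0]).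
    apply Rmult_le_compat_r; [apply pow2_ge_0|assumption].
  + rewrite flat_nonpos, Rabs_R0 by lra.
    apply Rmult_le_pos; [left; apply exp_pos|apply pow2_ge_0].
- apply is_derive_ext_loc with (fun x => (/ x) ^ a * exp (- (/ x) ^ p)).
  { exists (mkposreal x h). intros y Hy.
    unfold ball in Hy; simpl in Hy; unfold AbsRing_ball, abs, minus, plus, opp in Hy; simpl in Hy.
    apply Rabs_def2 in Hy. simpl. destruct (Rlt_dec 0 y); [reflexivity|lra]. }
  auto_derive; [lra|]. simpl. destruct (Rlt_dec 0 x) as [_|n]; [|lra].
  rewrite !pow_add. destruct p as [|q]; [lia|].
  destruct a as [|a].
  + simpl. field. lra.
  + simpl pred. rewrite <- !tech_pow_Rmult. field. lra.
Qed.

Lemma flat_deriv a : deriv_family (fun n => flat n a).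
Proof.
intro n. revert a. induction n as [|n IH]; intros a x.
- apply flat_derive_0.
- apply (is_derive_plus (fun x => - INR a * flat n (S a) x) (fun x => INR p * flat n (a + p + 1) x));
  apply is_derive_scal; apply IH.
Qed.

(** L bounds every index reached by n differentiations. In the recursion the first term has a factor
    a <= L; the second raises the index by p more, which is worth L^(p/p) = L. So each derivative
    costs (1 + p) L, besides L^(1/p) for the order. *)
Lemma flat_bound L n a x : 1 <= L -> INR (a + n * (p + 1)) <= L ->
  Rabs (flat n a x) <= ((1 + INR p) * L) ^ n * exp (INR (a + n) / INR p * ln L).
Proof.
intro HL. revert a. induction n as [|n IH]; intros a Ha.
- rewrite Nat.add_0_r in *. destruct (flat_0_bound a x L) as [H1 H2]; [lra|exact Ha|].
  rewrite Rabs_pos_eq by assumption. simpl pow. lra.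
- assert (Hp : 1 <= INR p) by (apply INR_pos; exact Hp1).
  assert (Ha0 := pos_INR a).
  assert (HaL : INR a <= L).
  { apply Rle_trans with (2 := Ha). apply le_INR. lia. }
  simpl flat. apply Rle_trans with (1 := Rabs_triang _ _).
  rewrite !Rabs_mult, Rabs_Ropp, !(Rabs_pos_eq (INR _)) by apply pos_INR.
  assert (H1 := IH (S a)). assert (H2 := IH (a + p + 1)%nat).
  assert (H1' := H1 ltac:(apply Rle_trans with (2 := Ha); apply le_INR; lia)).
  assert (H2' := H2 ltac:(apply Rle_trans with (2 := Ha); apply le_INR; lia)).
  set (X := (1 + INR p) * L) in *.
  replace (S a + n)%nat with (a + S n)%nat in H1' by lia.
  assert (E : exp (INR (a + p + 1 + n) / INR p * ln L) = L * exp (INR (a + S n) / INR p * ln L)).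
  { rewrite <- (exp_ln L) at 2 by lra. rewrite <- exp_plus. f_equal.
    rewrite !plus_INR, !S_INR, INR_0. field. lra. }
  rewrite E in H2'. set (Y := exp (INR (a + S n) / INR p * ln L)) in *.
  assert (HX : 0 <= X ^ n) by (apply pow_le; unfold X; nra).
  assert (HY : 0 <= Y) by (left; apply exp_pos).
  assert (HXY : 0 <= X ^ n * Y) by now apply Rmult_le_pos.
  assert (INR a * Rabs (flat n (S a) x) <= L * (X ^ n * Y)).
  { apply Rmult_le_compat; auto using Rabs_pos. }
  assert (INR p * Rabs (flat n (a + p + 1) x) <= INR p * (X ^ n * (L * Y))).
  { apply Rmult_le_compat_l; [lra|assumption]. }
  simpl pow. unfold X at 1. nra.
Qed.

Lemma flat_gevrey : gevrey (1 + / INR p) (fun n => flat n 0).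
Proof.
assert (Hp : 1 <= INR p) by (apply INR_pos; exact Hp1).
set (b := ln (1 + INR p)).
assert (Hb : 0 <= b) by (apply ln_nonneg; lra).
exists 1, (2 * b + b / INR p + (1 + / INR p)). split; [lra|].
intros n x.
set (L := INR (S n) * (1 + INR p)).
assert (Hn := pos_INR n).
assert (H := flat_bound L n 0 x).
assert (HL1 : 1 <= L) by (unfold L; rewrite S_INR; nra).
specialize (H HL1).
assert (HL2 : INR (0 + n * (p + 1)) <= L).
{ unfold L. rewrite Nat.add_0_l, mult_INR, plus_INR, !S_INR, INR_0. nra. }
specialize (H HL2). apply Rle_trans with (1 := H).
rewrite <- Rpower_pow by nra. unfold Rpower. rewrite <- exp_plus, Rmult_1_l. apply exp_monotone.
assert (HlnL : ln L = ln (INR n + 1) + b).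
{ unfold L. rewrite S_INR. apply ln_mult; lra. }
rewrite ln_mult, HlnL by lra. fold b. rewrite Nat.add_0_l.
assert (Hf := lnfact_ge n). set (t := ln (INR n + 1)) in *.
assert (Hp' : 0 < / INR p) by (apply Rinv_0_lt_compat; lra).
assert (E : (1 + / INR p) * (INR n * t - INR n) <= (1 + / INR p) * lnfact n).
{ apply Rmult_le_compat_l; lra. }
unfold Rdiv. lra.
Qed.

End Flat.

(** * Gevrey plateau functions *)

Definition affine_family (D : nat -> R -> R) (k b : R) (n : nat) (x : R) : R :=
  k ^ n * D n (k * x + b).

Lemma affine_family_deriv D k b : deriv_family D -> deriv_family (affine_family D k b).
Proof.
intros HD n x. unfold affine_family.
replace (k ^ S n * D (S n) (k * x + b)) with (k ^ n * (k * D (S n) (k * x + b))) by (simpl; ring).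
apply is_derive_scal.
apply (is_derive_comp (D n) (fun x => k * x + b) x (D (S n) (k * x + b)) k).
- apply HD.
- auto_derive; [exact I|ring].
Qed.

Lemma affine_family_gevrey s D k b : k <> 0 -> gevrey s D -> gevrey s (affine_family D k b).
Proof.
intros Hk (C & B & HC & H). exists C, (ln (Rabs k) + B). split; [exact HC|].
intros n x. unfold affine_family. rewrite Rabs_mult, <- RPow_abs.
assert (Hk' := Rabs_pos_lt k Hk).
rewrite <- (Rpower_pow n) by assumption. unfold Rpower.
apply Rle_trans with (exp (INR n * ln (Rabs k)) * (C * exp (B * INR n + s * lnfact n))).
{ apply Rmult_le_compat_l; [left; apply exp_pos|apply H]. }
rewrite (Rmult_comm (exp _)), Rmult_assoc, <- exp_plus.
right. f_equal. f_equal. ring.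
Qed.

Lemma deriv_family_continuous D n x : deriv_family D -> continuous (D n) x.
Proof. intro HD. apply (ex_derive_continuous (D n) x). exists (D (S n) x). apply HD. Qed.

Section Plateau.

Variable p : nat.
Hypothesis Hp : (1 <= p)%nat.

Let s := 1 + / INR p.

Lemma exponent_ge_1 : 1 <= s.
Proof.
assert (H := INR_pos p Hp). assert (0 < / INR p) by (apply Rinv_0_lt_compat; lra). unfold s; lra.
Qed.

Let left_part (n : nat) := flat p n 0.
Let right_part := affine_family left_part (-1) 1.

Definition bump (n : nat) : R -> R := prod_family left_part right_part n 0 0.

Lemma bump_deriv : deriv_family bump.
Proof.
apply prod_family_deriv; [|apply affine_family_deriv]; exact (flat_deriv p Hp 0).
Qed.

Lemma bump_gevrey : gevrey s bump.
Proof.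
assert (H := exponent_ge_1).
apply gevrey_prod; [lra| |apply affine_family_gevrey; [lra|]]; exact (flat_gevrey p Hp).
Qed.

Lemma bump_left n x : x <= 0 -> bump n x = 0.
Proof. intro Hx. apply prod_family_zero_l. intro m. now apply flat_nonpos. Qed.

Lemma bump_right n x : 1 <= x -> bump n x = 0.
Proof.
intro Hx. apply prod_family_zero_r. intro m. unfold right_part, affine_family, left_part.
rewrite flat_nonpos by lra. ring.
Qed.

Lemma bump_pos x : 0 < x < 1 -> 0 < bump 0 x.
Proof.
intro Hx. unfold bump, prod_family, right_part, affine_family, left_part.
rewrite pow_O, Rmult_1_l. apply Rmult_lt_0_compat; apply flat_0_pos; lra.
Qed.

Lemma bump_nonneg x : 0 <= bump 0 x.
Proof.
destruct (Rle_dec x 0) as [h|h]; [rewrite bump_left; lra|].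
destruct (Rle_dec 1 x) as [h'|h']; [rewrite bump_right; lra|].
left. apply bump_pos. lra.
Qed.

Lemma bump_ex_RInt a b : ex_RInt (bump 0) a b.
Proof.
apply (ex_RInt_continuous (V := R_CompleteNormedModule)). intros x _. now apply deriv_family_continuous, bump_deriv.
Qed.

Definition step (n : nat) (x : R) : R :=
  match n with O => RInt (bump 0) 0 x | S n => bump n x end.

Lemma step_deriv : deriv_family step.
Proof.
intros [|n] x; [|apply bump_deriv].
apply (is_derive_RInt (bump 0) (step 0) 0 x).
- exists (mkposreal 1 Rlt_0_1). intros y _. apply (RInt_correct (V := R_CompleteNormedModule)), bump_ex_RInt.
- apply deriv_family_continuous, bump_deriv.
Qed.

Lemma RInt_bump_zero a b : (forall x, Rmin a b < x < Rmax a b -> bump 0 x = 0) -> RInt (bump 0) a b = 0.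
Proof.
intro H. rewrite (RInt_ext _ (fun _ => 0)) by exact H.
rewrite RInt_const. unfold scal; simpl; unfold mult; simpl. ring.
Qed.

Lemma step_left x : x <= 0 -> step 0 x = 0.
Proof.
intro Hx. apply RInt_bump_zero. intros y Hy. apply bump_left.
rewrite Rmax_left in Hy by assumption. lra.
Qed.

Lemma step_right x : 1 <= x -> step 0 x = step 0 1.
Proof.
intro Hx. unfold step.
rewrite <- (RInt_Chasles (bump 0) 0 1 x) by apply bump_ex_RInt.
rewrite (RInt_bump_zero 1 x); [unfold plus; simpl; ring|].
intros y Hy. apply bump_right. rewrite Rmin_left in Hy by assumption. lra.
Qed.

Lemma step_1_pos : 0 < step 0 1.
Proof.
unfold step. apply RInt_gt_0; [lra|apply bump_pos|].
intros x _. apply deriv_family_continuous, bump_deriv.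
Qed.

Lemma step_bounds x : 0 <= step 0 x <= step 0 1.
Proof.
assert (H1 := step_1_pos).
destruct (Rle_dec x 0) as [h|h]; [rewrite step_left; lra|].
destruct (Rle_dec 1 x) as [h'|h']; [rewrite step_right; lra|].
assert (H2 : 0 <= RInt (bump 0) 0 x).
{ apply RInt_ge_0; [lra|apply bump_ex_RInt|]. intros; apply bump_nonneg. }
assert (H3 : 0 <= RInt (bump 0) x 1).
{ apply RInt_ge_0; [lra|apply bump_ex_RInt|]. intros; apply bump_nonneg. }
assert (H4 := RInt_Chasles (bump 0) 0 x 1 (bump_ex_RInt _ _) (bump_ex_RInt _ _)).
unfold plus in H4; simpl in H4. unfold step in *. lra.
Qed.

Lemma step_gevrey : gevrey s step.
Proof.
destruct bump_gevrey as (C & B & HC & H).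
assert (Hs := exponent_ge_1).
exists (step 0 1 + C * exp (Rabs B)), (Rabs B).
assert (H1 := step_1_pos).
assert (HB := exp_pos (Rabs B)).
assert (HCB : 0 <= C * exp (Rabs B)) by nra.
split; [lra|].
intros [|n] x.
- destruct (step_bounds x). rewrite Rabs_pos_eq by assumption.
  rewrite lnfact_0. simpl INR. rewrite !Rmult_0_r, Rplus_0_r, exp_0. lra.
- apply Rle_trans with (1 := H n x).
  assert (E : B * INR n + s * lnfact n <= Rabs B * INR (S n) + s * lnfact (S n)).
  { rewrite S_INR, lnfact_S. assert (Hn := pos_INR n). assert (HlnS := ln_nonneg (INR n + 1) ltac:(lra)).
    assert (H2 := Rle_abs B). assert (H3 := Rabs_pos B). nra. }
  assert (E' := exp_monotone _ _ E).
  assert (He := exp_pos (Rabs B * INR (S n) + s * lnfact (S n))).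
  assert (1 <= exp (Rabs B)).
  { rewrite <- exp_0. apply exp_monotone, Rabs_pos. }
  apply Rle_trans with (C * exp (Rabs B * INR (S n) + s * lnfact (S n))).
  { now apply Rmult_le_compat_l. }
  apply Rmult_le_compat_r; nra.
Qed.

Lemma gevrey_plateau a b d : 0 < d -> a + d <= b -> exists g, deriv_family g /\ gevrey s g /\
  (forall n x, x <= a \/ b + d <= x -> g n x = 0) /\
  (forall x, a + d <= x <= b -> g 0%nat x = 1 /\ forall n, g (S n) x = 0).
Proof.
intros Hd Hab.
set (S1 := affine_family step (/ d) (- a / d)).
set (S2 := affine_family step (/ d) (- b / d)).
set (c := step 0 1). assert (Hc : 0 < c) by apply step_1_pos.
assert (Hid : 0 < / d) by now apply Rinv_0_lt_compat.
assert (E1 : forall x e, / d * x + - e / d = (x - e) / d) by (intros; field; lra).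
exists (fun n x => / c * (S1 n x - S2 n x)).
split; [|split; [|split]].
- intros n x. apply is_derive_scal.
  apply (is_derive_minus (S1 n) (S2 n)); apply affine_family_deriv, step_deriv.
- destruct (affine_family_gevrey s step (/ d) (- a / d) ltac:(lra) step_gevrey) as (C1 & B1 & HC1 & H1).
  destruct (affine_family_gevrey s step (/ d) (- b / d) ltac:(lra) step_gevrey) as (C2 & B2 & HC2 & H2).
  exists (/ c * (C1 + C2)), (Rmax B1 B2).
  assert (Hic : 0 < / c) by now apply Rinv_0_lt_compat.
  split; [nra|]. intros n x. rewrite Rabs_mult, (Rabs_pos_eq (/ c)), Rmult_assoc by lra.
  apply Rmult_le_compat_l; [lra|]. unfold Rminus. apply Rle_trans with (1 := Rabs_triang _ _).
  rewrite Rabs_Ropp, Rmult_plus_distr_r.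
  assert (Hn := pos_INR n).
  apply Rplus_le_compat.
  + apply Rle_trans with (1 := H1 n x). apply Rmult_le_compat_l; [assumption|]. apply exp_monotone.
    apply Rplus_le_compat_r, Rmult_le_compat_r; [assumption|apply Rmax_l].
  + apply Rle_trans with (1 := H2 n x). apply Rmult_le_compat_l; [assumption|]. apply exp_monotone.
    apply Rplus_le_compat_r, Rmult_le_compat_r; [assumption|apply Rmax_r].
- intros n x Hx. unfold S1, S2, affine_family. rewrite !E1.
  destruct Hx as [Hx|Hx].
  + assert (Ha : (x - a) / d <= 0) by (apply Rle_div_l; lra).
    assert (Hb : (x - b) / d <= 0) by (apply Rle_div_l; lra).
    destruct n; [rewrite !step_left by assumption|simpl step; rewrite !bump_left by assumption]; ring.
  + assert (Ha : 1 <= (x - a) / d) by (apply Rle_div_r; lra).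
    assert (Hb : 1 <= (x - b) / d) by (apply Rle_div_r; lra).
    destruct n; [rewrite (step_right ((x - a) / d)), (step_right ((x - b) / d)) by assumption|simpl step; rewrite !bump_right by assumption]; ring.
- intros x Hx. unfold S1, S2, affine_family.
  assert (Ha : 1 <= (x - a) / d) by (apply Rle_div_r; lra).
  assert (Hb : (x - b) / d <= 0) by (apply Rle_div_l; lra).
  split; [|intro n]; rewrite !E1.
  + rewrite (step_right ((x - a) / d)), (step_left ((x - b) / d)) by assumption. fold c. simpl. field. lra.
  + simpl step. rewrite bump_right, bump_left by assumption. ring.
Qed.

End Plateau.

(** * Taylor polynomials and lacunary trigonometric series *)

Lemma mean_value_bound (f df : R -> R) a b B : (forall x, is_derive f x (df x)) ->
  (forall x, Rabs (x - a) <= Rabs (b - a) -> Rabs (df x) <= B) -> Rabs (f b - f a) <= B * Rabs (b - a).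
Proof.
intros Hf HB. destruct (MVT_gen f a b df) as (c & Hc & E).
- intros; apply Hf.
- intros x _. apply continuity_pt_filterlim, (ex_derive_continuous f x). eexists; apply Hf.
- rewrite E, Rabs_mult. apply Rmult_le_compat_r; [apply Rabs_pos|]. apply HB.
  unfold Rmin, Rmax in Hc. destruct (Rle_dec a b).
  + rewrite !Rabs_pos_eq; lra.
  + rewrite !Rabs_left1; lra.
Qed.

Definition taylor (D : nat -> R -> R) (x : R) (n : nat) (h : R) : R :=
  sum_n (fun k => D k x / INR (fact k) * h ^ k) n.

Lemma taylor_0 D x n : taylor D x n 0 = D 0%nat x.
Proof.
unfold taylor. induction n as [|n IH].
- rewrite sum_O. simpl. field.
- rewrite sum_Sn, IH, pow_i by lia. unfold plus; simpl. ring.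
Qed.

Lemma taylor_derive D x n h :
  is_derive (taylor D x (S n)) h (taylor (fun k => D (S k)) x n h).
Proof.
induction n as [|n IH].
- unfold taylor. apply is_derive_ext with (fun h => D 0%nat x + D 1%nat x * h).
  + intro t. rewrite sum_Sn, sum_O. unfold plus; simpl. field.
  + rewrite sum_O. auto_derive; [exact I|]. simpl. field.
- apply is_derive_ext with
    (fun h => taylor D x (S n) h + D (S (S n)) x / INR (fact (S (S n))) * h ^ S (S n)).
  + intro t. unfold taylor. rewrite (sum_Sn _ (S n)). reflexivity.
  + unfold taylor at 2. rewrite sum_Sn. apply (is_derive_plus (taylor D x (S n))).
    * exact IH.
    * replace (D (S (S n)) x / INR (fact (S n)) * h ^ S n)
        with (D (S (S n)) x / INR (fact (S (S n))) * (INR (S (S n)) * h ^ S n)).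
      { apply is_derive_scal. auto_derive; [exact I|]. simpl. ring. }
      rewrite (fact_simpl (S n)), mult_INR. field.
      split; [apply INR_fact_neq_0|apply not_0_INR; lia].
Qed.

(** The derivative of the remainder is the remainder of the shifted family, so the mean value
    theorem gives an induction. Only the order in h matters later, so no factorial is kept. *)
Lemma taylor_bound D n x B h : deriv_family D -> (forall y, Rabs (D (S n) y) <= B) ->
  Rabs (D 0%nat (x + h) - taylor D x n h) <= B * Rabs h ^ S n.
Proof.
revert D h. induction n as [|n IH]; intros D h HD HB.
- unfold taylor. rewrite sum_O. simpl.
  replace (D 0%nat x / 1 * 1) with (D 0%nat x) by field.
  assert (H := mean_value_bound (D 0%nat) (D 1%nat) x (x + h) B (HD 0%nat) (fun y _ => HB y)).
  replace (x + h - x) with h in H by ring. rewrite Rmult_1_r. exact H.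
- assert (H := mean_value_bound (fun h => D 0%nat (x + h) - taylor D x (S n) h)
    (fun h => D 1%nat (x + h) - taylor (fun k => D (S k)) x n h) 0 h (B * Rabs h ^ S n)).
  cbv beta in H. rewrite taylor_0, Rplus_0_r in H.
  rewrite Rminus_diag, !Rminus_0_r in H.
  rewrite <- tech_pow_Rmult, (Rmult_comm (Rabs h)), <- Rmult_assoc.
  apply H; clear H.
  + intro t. apply (is_derive_minus (fun h => D 0%nat (x + h)) (taylor D x (S n))).
    * assert (Hc := is_derive_comp (D 0%nat) (fun h => x + h) t (D 1%nat (x + t)) 1 (HD 0%nat _)).
      replace (D 1%nat (x + t)) with (scal 1 (D 1%nat (x + t))) by (unfold scal; simpl; unfold mult; simpl; ring).
      apply Hc. auto_derive; [exact I|ring].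
    * apply taylor_derive.
  + intros t Ht. rewrite Rminus_0_r in Ht.
    apply Rle_trans with (B * Rabs t ^ S n).
    * apply (IH (fun k => D (S k))); [intros k y; apply HD|exact HB].
    * apply Rmult_le_compat_l.
      { apply Rle_trans with (2 := HB 0). apply Rabs_pos. }
      apply pow_incr. split; [apply Rabs_pos|exact Ht].
Qed.

Fixpoint trig_coef (n : nat) : R * R :=
  match n with O => (1, 1) | S n => (snd (trig_coef n), - fst (trig_coef n)) end.

(* The derivatives of cos + sin; none of them vanishes at 0. *)
Definition trig (n : nat) (y : R) : R := fst (trig_coef n) * cos y + snd (trig_coef n) * sin y.

Lemma trig_coef_abs n : Rabs (fst (trig_coef n)) = 1 /\ Rabs (snd (trig_coef n)) = 1.
Proof.
induction n as [|n [H1 H2]]; simpl.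
- now rewrite Rabs_R1.
- now rewrite Rabs_Ropp.
Qed.

Lemma trig_deriv : deriv_family trig.
Proof.
intros n x. unfold trig. simpl. auto_derive; [exact I|ring].
Qed.

Lemma trig_bound n y : Rabs (trig n y) <= 2.
Proof.
unfold trig. destruct (trig_coef_abs n) as [H1 H2].
apply Rle_trans with (1 := Rabs_triang _ _). rewrite !Rabs_mult, H1, H2, !Rmult_1_l.
assert (Hc := Rabs_le (cos y) 1 (COS_bound y)). assert (Hd := Rabs_le (sin y) 1 (SIN_bound y)). lra.
Qed.

Lemma Rabs_trig_0 n : Rabs (trig n 0) = 1.
Proof.
unfold trig. rewrite cos_0, sin_0, Rmult_0_r, Rplus_0_r, Rmult_1_r. apply trig_coef_abs.
Qed.

Lemma trig_quadratic n y k : Rabs (trig n (y + k) - trig n y - k * trig (S n) y) <= 2 * k ^ 2.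
Proof.
assert (H := taylor_bound (fun m => trig (m + n)%nat) 1 y 2 k (fun m => trig_deriv (m + n)%nat) (fun y => trig_bound _ y)).
unfold taylor in H. rewrite sum_Sn, sum_O in H. unfold plus in H; simpl in H.
rewrite <- pow2_abs. simpl.
replace (trig n (y + k) - trig n y - k * trig (S n) y) with
  (trig n (y + k) - (trig n y / 1 * 1 + trig (S n) y / 1 * (k * 1))) by field.
exact H.
Qed.

Section Lacunary.

Variables (a r : nat -> R) (t0 : R).
Hypothesis Ha : forall j, 0 <= a j.
Hypothesis Hr : forall j, 0 <= r j.
Hypothesis Hser : forall n, ex_series (fun j => a j * r j ^ n).

Definition moment (n : nat) : R := Series (fun j => a j * r j ^ n).

Definition trig_series (n : nat) (x : R) : R :=
  Series (fun j => a j * r j ^ n * trig n (r j * (x - t0))).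

Lemma moment_term_nonneg n j : 0 <= a j * r j ^ n.
Proof. apply Rmult_le_pos; [apply Ha|apply pow_le, Hr]. Qed.

Lemma moment_ge_term n j : a j * r j ^ n <= moment n.
Proof.
unfold moment.
rewrite (Series_incr_n _ (S j)); [|lia|apply Hser]. simpl pred.
assert (H1 : 0 <= Series (fun k => a (S j + k)%nat * r (S j + k)%nat ^ n)).
{ rewrite <- (Rmult_0_l (Series (fun k => a (S j + k)%nat * r (S j + k)%nat ^ n))) at 1.
  rewrite <- Series_scal_l. apply Series_le.
  - intro k. rewrite Rmult_0_l. split; [lra|apply moment_term_nonneg].
  - apply (ex_series_incr_n (fun j => a j * r j ^ n)), Hser. }
assert (H2 : a j * r j ^ n <= sum_f_R0 (fun k => a k * r k ^ n) j).
{ destruct j; simpl; [lra|]. assert (H := cond_pos_sum (fun k => a k * r k ^ n) j (moment_term_nonneg n)). simpl in H. lra. }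
lra.
Qed.

Lemma trig_series_ex n m (y : nat -> R) :
  ex_series (fun j => a j * r j ^ n * trig m (y j)).
Proof.
apply (ex_series_le (V := R_CompleteNormedModule) _ (fun j => 2 * (a j * r j ^ n))).
- intro j. unfold norm; simpl; unfold abs; simpl. rewrite Rabs_mult, Rabs_pos_eq by apply moment_term_nonneg.
  rewrite Rmult_comm. apply Rmult_le_compat_r; [apply moment_term_nonneg|apply trig_bound].
- apply (ex_series_scal (V := R_NormedModule) 2). apply Hser.
Qed.

Lemma trig_series_bound n x : Rabs (trig_series n x) <= 2 * moment n.
Proof.
unfold trig_series, moment. rewrite <- Series_scal_l.
assert (H : ex_series (fun j => 2 * (a j * r j ^ n))).
{ apply (ex_series_scal (V := R_NormedModule) 2). apply Hser. }
assert (Hle : forall j, 0 <= Rabs (a j * r j ^ n * trig n (r j * (x - t0))) <= 2 * (a j * r j ^ n)).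
{ intro j. split; [apply Rabs_pos|]. rewrite Rabs_mult, Rabs_pos_eq by apply moment_term_nonneg.
  rewrite Rmult_comm. apply Rmult_le_compat_r; [apply moment_term_nonneg|apply trig_bound]. }
apply Rle_trans with (Series (fun j => Rabs (a j * r j ^ n * trig n (r j * (x - t0))))).
- apply Series_Rabs. apply (ex_series_le (V := R_CompleteNormedModule) _ (fun j => 2 * (a j * r j ^ n))); [|exact H].
  intro j. unfold norm; simpl; unfold abs; simpl. rewrite Rabs_Rabsolu. apply Hle.
- now apply Series_le.
Qed.

(** At t0 the n-th derivatives of all terms share the sign of [trig n 0], which is 1 or -1, so
    nothing cancels and each single term is a lower bound. *)
Lemma trig_series_center n : Rabs (trig_series n t0) = moment n.
Proof.
unfold trig_series.
rewrite (Series_ext _ (fun j => trig n 0 * (a j * r j ^ n))).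
- rewrite Series_scal_l, Rabs_mult, Rabs_trig_0, Rmult_1_l. apply Rabs_pos_eq.
  apply Rle_trans with (2 := moment_ge_term n 0). apply moment_term_nonneg.
- intro j. replace (r j * (t0 - t0)) with 0 by ring. ring.
Qed.

(** Termwise: the quadratic remainder of the j-th term is at most 2 h^2 a_j r_j^(n+2), which is
    summable to [moment (n + 2)]. *)
Lemma trig_series_deriv : deriv_family trig_series.
Proof.
intros n x. apply (is_derive_quadratic _ _ _ (2 * moment (n + 2))). intro h.
unfold trig_series.
rewrite <- Series_minus by apply trig_series_ex.
rewrite <- Series_scal_l.
assert (Hex : ex_series (fun j => h * (a j * r j ^ S n * trig (S n) (r j * (x - t0))))).
{ apply (ex_series_scal (V := R_NormedModule) h). apply trig_series_ex. }
rewrite <- Series_minus; [|apply (ex_series_minus (V := R_NormedModule)); apply trig_series_ex|exact Hex].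
assert (Hle : forall j, 0 <= Rabs (a j * r j ^ n * trig n (r j * (x + h - t0)) -
     a j * r j ^ n * trig n (r j * (x - t0)) -
     h * (a j * r j ^ S n * trig (S n) (r j * (x - t0)))) <= 2 * h ^ 2 * (a j * r j ^ (n + 2))).
{ intro j. split; [apply Rabs_pos|].
  assert (H := trig_quadratic n (r j * (x - t0)) (r j * h)).
  replace (r j * (x - t0) + r j * h) with (r j * (x + h - t0)) in H by ring.
  replace (a j * r j ^ n * trig n (r j * (x + h - t0)) -
     a j * r j ^ n * trig n (r j * (x - t0)) -
     h * (a j * r j ^ S n * trig (S n) (r j * (x - t0)))) with
   (a j * r j ^ n * (trig n (r j * (x + h - t0)) - trig n (r j * (x - t0)) - r j * h * trig (S n) (r j * (x - t0))))
   by (simpl; ring).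
  rewrite Rabs_mult, Rabs_pos_eq by apply moment_term_nonneg.
  replace (2 * h ^ 2 * (a j * r j ^ (n + 2))) with (a j * r j ^ n * (2 * (r j * h) ^ 2))
    by (rewrite pow_add; ring).
  apply Rmult_le_compat_l; [apply moment_term_nonneg|exact H]. }
assert (Hex2 : ex_series (fun j => 2 * h ^ 2 * (a j * r j ^ (n + 2)))).
{ apply (ex_series_scal (V := R_NormedModule) (2 * h ^ 2)). apply Hser. }
replace (2 * moment (n + 2) * h ^ 2) with (2 * h ^ 2 * moment (n + 2)) by ring.
unfold moment. rewrite <- Series_scal_l.
eapply Rle_trans; [apply Series_Rabs|apply Series_le; [exact Hle|exact Hex2]].
apply (ex_series_le (V := R_CompleteNormedModule) _ (fun j => 2 * h ^ 2 * (a j * r j ^ (n + 2)))); [|exact Hex2].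
intro j. unfold norm; simpl; unfold abs; simpl. rewrite Rabs_Rabsolu. apply Hle.
Qed.

End Lacunary.

(** * Jets of the inverse iterates *)

Fixpoint peval (l : list R) (h : R) : R :=
  match l with nil => 0 | a :: l => a + h * peval l h end.

(** The norm sum |c_k| rho^k on coefficient lists. It is submultiplicative, and [pnorm_nth] plays
    the part of Cauchy's estimate. *)
Fixpoint pnorm (rho : R) (l : list R) : R :=
  match l with nil => 0 | a :: l => Rabs a + rho * pnorm rho l end.

Fixpoint padd (l l' : list R) : list R :=
  match l, l' with
  | nil, _ => l'
  | _, nil => l
  | a :: l, b :: l' => (a + b) :: padd l l'
  end.

Fixpoint pscale (c : R) (l : list R) : list R :=
  match l with nil => nil | a :: l => c * a :: pscale c l end.

Fixpoint pmul (l l' : list R) : list R :=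
  match l with nil => nil | a :: l => padd (pscale a l') (0 :: pmul l l') end.

Lemma peval_padd l l' h : peval (padd l l') h = peval l h + peval l' h.
Proof.
revert l'. induction l as [|a l IH]; intros [|b l']; simpl; try ring. rewrite IH. ring.
Qed.

Lemma peval_pscale c l h : peval (pscale c l) h = c * peval l h.
Proof. induction l as [|a l IH]; simpl; [ring|]. rewrite IH. ring. Qed.

Lemma peval_pmul l l' h : peval (pmul l l') h = peval l h * peval l' h.
Proof.
induction l as [|a l IH]; simpl; [ring|].
rewrite peval_padd, peval_pscale. simpl. rewrite IH. ring.
Qed.

Section Norm.

Variable rho : R.
Hypothesis Hrho : 0 < rho.

Lemma pnorm_nonneg l : 0 <= pnorm rho l.
Proof.
induction l as [|a l IH]; simpl; [lra|]. assert (H := Rabs_pos a). nra.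
Qed.

Lemma pnorm_padd l l' : pnorm rho (padd l l') <= pnorm rho l + pnorm rho l'.
Proof.
revert l'. induction l as [|a l IH]; intros [|b l']; simpl; try lra.
assert (H := Rabs_triang a b). specialize (IH l'). nra.
Qed.

Lemma pnorm_pscale c l : pnorm rho (pscale c l) = Rabs c * pnorm rho l.
Proof.
induction l as [|a l IH]; simpl; [ring|]. rewrite IH, Rabs_mult. ring.
Qed.

Lemma pnorm_pmul l l' : pnorm rho (pmul l l') <= pnorm rho l * pnorm rho l'.
Proof.
induction l as [|a l IH]; simpl; [lra|].
apply Rle_trans with (1 := pnorm_padd _ _). rewrite pnorm_pscale. simpl. rewrite Rabs_R0. nra.
Qed.

Lemma pnorm_nth l n : Rabs (nth n l 0) * rho ^ n <= pnorm rho l.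
Proof.
revert n. induction l as [|a l IH]; intros [|n]; simpl; rewrite ?Rabs_R0; try lra.
- assert (H := pnorm_nonneg l). nra.
- specialize (IH n). assert (H := Rabs_pos a). nra.
Qed.

Lemma peval_bound l h : Rabs h <= rho -> Rabs (peval l h) <= pnorm rho l.
Proof.
intro Hh. induction l as [|a l IH]; simpl; [rewrite Rabs_R0; lra|].
apply Rle_trans with (1 := Rabs_triang _ _). apply Rplus_le_compat_l.
rewrite Rabs_mult. apply Rmult_le_compat; auto using Rabs_pos.
Qed.

Definition poly_le (X : R) (P : R -> R) : Prop :=
  exists l, (forall h, P h = peval l h) /\ pnorm rho l <= X.

Lemma poly_le_const c : poly_le (Rabs c) (fun _ => c).
Proof. exists (c :: nil). simpl. split; [intro; ring|lra]. Qed.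

Lemma poly_le_add X Y P Q : poly_le X P -> poly_le Y Q -> poly_le (X + Y) (fun h => P h + Q h).
Proof.
intros (l & Hl & HX) (l' & Hl' & HY). exists (padd l l'). split.
- intro h. now rewrite peval_padd, Hl, Hl'.
- assert (H := pnorm_padd l l'). lra.
Qed.

Lemma poly_le_scale c X P : poly_le X P -> poly_le (Rabs c * X) (fun h => c * P h).
Proof.
intros (l & Hl & HX). exists (pscale c l). split.
- intro h. now rewrite peval_pscale, Hl.
- rewrite pnorm_pscale. apply Rmult_le_compat_l; [apply Rabs_pos|assumption].
Qed.

Lemma poly_le_mul X Y P Q : poly_le X P -> poly_le Y Q -> poly_le (X * Y) (fun h => P h * Q h).
Proof.
intros (l & Hl & HX) (l' & Hl' & HY). exists (pmul l l'). split.
- intro h. now rewrite peval_pmul, Hl, Hl'.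
- apply Rle_trans with (1 := pnorm_pmul l l').
  apply Rmult_le_compat; auto using pnorm_nonneg.
Qed.

Lemma poly_le_pow X P k : poly_le X P -> poly_le (X ^ k) (fun h => P h ^ k).
Proof.
intro H. induction k as [|k IH]; simpl.
- assert (H1 := poly_le_const 1). rewrite Rabs_R1 in H1. exact H1.
- now apply poly_le_mul.
Qed.

(** Method of majorants: composing with P replaces h by the bound X of P, so the formula for higher
    derivatives of a composite is avoided. *)
Lemma poly_le_taylor D x n X P : poly_le X P ->
  poly_le (sum_n (fun k => Rabs (D k x) / INR (fact k) * X ^ k) n) (fun h => taylor D x n (P h)).
Proof.
intro H.
assert (Hk : forall k, poly_le (Rabs (D k x) / INR (fact k) * X ^ k)
   (fun h => D k x / INR (fact k) * P h ^ k)).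
{ intro k. replace (Rabs (D k x) / INR (fact k)) with (Rabs (D k x / INR (fact k))).
  - now apply poly_le_scale, poly_le_pow.
  - unfold Rdiv. rewrite Rabs_mult, (Rabs_pos_eq (/ _)); [reflexivity|].
    left. apply Rinv_0_lt_compat, INR_fact_lt_0. }
induction n as [|n IH].
- destruct (Hk 0%nat) as (l & Hl & Hn). exists l. unfold taylor.
  split; [intro h; rewrite sum_O; apply Hl|rewrite sum_O; exact Hn].
- destruct (poly_le_add _ _ _ _ IH (Hk (S n))) as (l & Hl & Hn). exists l.
  split; [intro h; unfold taylor; rewrite sum_Sn; apply Hl|rewrite sum_Sn; exact Hn].
Qed.

End Norm.

Lemma taylor_list D x n : exists l, length l = S n /\ (forall h, taylor D x n h = peval l h) /\
  nth n l 0 = D n x / INR (fact n).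
Proof.
assert (Happ : forall l c h, peval (l ++ c :: nil) h = peval l h + c * h ^ length l).
{ intros l c h. induction l as [|a l IH]; simpl; [ring|]. rewrite IH. ring. }
induction n as [|n (l & Hn & Hl & _)].
- exists (D 0%nat x / INR (fact 0) :: nil). split; [reflexivity|]. split; [|reflexivity].
  intro h. unfold taylor. rewrite sum_O. simpl. ring.
- exists (l ++ (D (S n) x / INR (fact (S n))) :: nil). split; [rewrite length_app; simpl; lia|]. split.
  + intro h. rewrite Happ, <- Hl, Hn. unfold taylor. rewrite sum_Sn. reflexivity.
  + rewrite app_nth2, Hn, Nat.sub_diag; [reflexivity|lia].
Qed.

(** The neighbourhood is punctured so that [bigO_coef] may divide by h. *)
Definition bigO (n : nat) (E : R -> R) : Prop :=
  exists K d, 0 < d /\ forall h, 0 < Rabs h < d -> Rabs (E h) <= K * Rabs h ^ n.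

Lemma bigO_ext n E E' : (forall h, E h = E' h) -> bigO n E -> bigO n E'.
Proof. intros H (K & d & Hd & HE). exists K, d. split; [exact Hd|]. intros h Hh. rewrite <- H. auto. Qed.

Lemma bigO_nonneg n E : bigO n E -> exists K d, 0 <= K /\ 0 < d /\
  forall h, 0 < Rabs h < d -> Rabs (E h) <= K * Rabs h ^ n.
Proof.
intros (K & d & Hd & HE). exists (Rmax K 0), d. split; [apply Rmax_r|]. split; [exact Hd|].
intros h Hh. apply Rle_trans with (1 := HE h Hh).
apply Rmult_le_compat_r; [apply pow_le, Rabs_pos|apply Rmax_l].
Qed.

Lemma bigO_add n E E' : bigO n E -> bigO n E' -> bigO n (fun h => E h + E' h).
Proof.
intros (K & d & Hd & HE) (K' & d' & Hd' & HE'). exists (K + K'), (Rmin d d').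
split; [now apply Rmin_pos|]. intros h [Hh1 Hh2].
assert (H1 := Rmin_l d d'). assert (H2 := Rmin_r d d').
apply Rle_trans with (1 := Rabs_triang _ _). rewrite Rmult_plus_distr_r.
apply Rplus_le_compat; [apply HE|apply HE']; lra.
Qed.

Lemma bigO_le n E E' : bigO n E -> (exists L d, 0 < d /\ 0 <= L /\
  forall h, 0 < Rabs h < d -> Rabs (E' h) <= L * Rabs (E h)) -> bigO n E'.
Proof.
intros (K & d & Hd & HE) (L & d' & Hd' & HL & HE'). exists (L * K), (Rmin d d').
split; [now apply Rmin_pos|]. intros h [Hh1 Hh2].
assert (H1 := Rmin_l d d'). assert (H2 := Rmin_r d d').
apply Rle_trans with (1 := HE' h ltac:(lra)). rewrite Rmult_assoc.
apply Rmult_le_compat_l; [exact HL|]. apply HE; lra.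
Qed.

Lemma bigO_scale n c E : bigO n E -> bigO n (fun h => c * E h).
Proof.
intro H. apply bigO_le with (1 := H). exists (Rabs c), 1. split; [lra|]. split; [apply Rabs_pos|].
intros h _. rewrite Rabs_mult. lra.
Qed.

Lemma bigO_mul n m E E' : bigO n E -> bigO m E' -> bigO (n + m) (fun h => E h * E' h).
Proof.
intros H H'. apply bigO_nonneg in H, H'.
destruct H as (K & d & HK & Hd & HE). destruct H' as (K' & d' & HK' & Hd' & HE').
exists (K * K'), (Rmin d d').
split; [now apply Rmin_pos|]. intros h [Hh1 Hh2].
assert (H1 := Rmin_l d d'). assert (H2 := Rmin_r d d').
rewrite Rabs_mult, pow_add.
replace (K * K' * (Rabs h ^ n * Rabs h ^ m)) with ((K * Rabs h ^ n) * (K' * Rabs h ^ m)) by ring.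
apply Rmult_le_compat; try apply Rabs_pos; [apply HE|apply HE']; lra.
Qed.

Lemma bigO_poly rho X P : 0 < rho -> poly_le rho X P -> P 0 = 0 -> bigO 1 P.
Proof.
intros Hrho (l & Hl & _) H0. rewrite Hl in H0.
destruct l as [|a l].
- exists 0, 1. split; [lra|]. intros h _. rewrite Hl. simpl. rewrite Rabs_R0. lra.
- simpl in H0. assert (a = 0) by lra. subst a.
  exists (pnorm rho l), rho. split; [exact Hrho|]. intros h Hh. rewrite Hl. simpl.
  rewrite Rplus_0_l, Rabs_mult, Rmult_1_r, Rmult_comm.
  apply Rmult_le_compat_r; [apply Rabs_pos|]. apply peval_bound; lra.
Qed.

Lemma constant_zero_of_linear_bound a C d : 0 < d ->
  (forall h, 0 < h < d -> Rabs a <= C * h) -> a = 0.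
Proof.
intros Hd H.
destruct (Req_dec a 0) as [|h]; [assumption|exfalso].
assert (Ha := Rabs_pos_lt a h).
assert (HC : 0 < Rabs C + 1) by (assert (H1 := Rabs_pos C); lra).
set (x := Rmin (d / 2) (Rabs a / (2 * (Rabs C + 1)))).
assert (Hx : 0 < x).
{ apply Rmin_pos; [lra|]. apply Rdiv_lt_0_compat; lra. }
assert (Hx1 : x <= d / 2) by apply Rmin_l.
assert (Hx2 : x <= Rabs a / (2 * (Rabs C + 1))) by apply Rmin_r.
specialize (H x ltac:(lra)). apply Rle_div_r in Hx2; [|lra].
assert (H1 := Rle_abs C). nra.
Qed.

Lemma bigO_coef n l l' : bigO (S n) (fun h => peval l h - peval l' h) ->
  forall k, (k <= n)%nat -> nth k l 0 = nth k l' 0.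
Proof.
assert (Hhd : forall n l l', bigO (S n) (fun h => peval l h - peval l' h) ->
  nth 0 l 0 = nth 0 l' 0).
{ clear n l l'. intros n l l' H. apply bigO_nonneg in H. destruct H as (K & d & HK & Hd & HE).
  set (G := pnorm 1 (tl l) + pnorm 1 (tl l')).
  apply Rminus_diag_uniq, (constant_zero_of_linear_bound _ (K + G) (Rmin d 1)); [apply Rmin_pos; lra|].
  intros h [Hh Hh']. assert (h1 := Rmin_l d 1). assert (h2 := Rmin_r d 1).
  specialize (HE h). rewrite (Rabs_pos_eq h) in HE by lra. specialize (HE ltac:(lra)).
  set (g := peval (tl l) h - peval (tl l') h).
  assert (Hev : nth 0 l 0 - nth 0 l' 0 = (peval l h - peval l' h) + - (h * g))
    by (unfold g; destruct l, l'; simpl; ring).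
  assert (Hg : Rabs g <= G).
  { unfold g, Rminus. apply Rle_trans with (1 := Rabs_triang _ _). rewrite Rabs_Ropp.
    apply Rplus_le_compat; apply peval_bound; rewrite ?Rabs_pos_eq; lra. }
  assert (Hp : h ^ S n <= h).
  { simpl. rewrite <- (Rmult_1_r h) at 3. apply Rmult_le_compat_l; [lra|].
    rewrite <- (pow1 n). apply pow_incr. lra. }
  rewrite Hev. apply Rle_trans with (1 := Rabs_triang _ _).
  rewrite Rabs_Ropp, Rabs_mult, (Rabs_pos_eq h) by lra.
  assert (K * h ^ S n <= K * h) by (apply Rmult_le_compat_l; lra). nra. }
revert l l'. induction n as [|n IH]; intros l l' H k Hk.
- replace k with 0%nat by lia. now apply (Hhd 0%nat).
- assert (H0 := Hhd _ _ _ H). destruct k as [|k]; [exact H0|].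
  replace (nth (S k) l 0) with (nth k (tl l) 0) by (destruct l; [destruct k|]; reflexivity).
  replace (nth (S k) l' 0) with (nth k (tl l') 0) by (destruct l'; [destruct k|]; reflexivity).
  apply IH; [|lia]. destruct H as (K & d & Hd & HE). exists K, d. split; [exact Hd|].
  intros h Hh. specialize (HE h Hh).
  replace (peval l h - peval l' h) with (h * (peval (tl l) h - peval (tl l') h)) in HE
    by (destruct l, l'; simpl in *; nra).
  rewrite Rabs_mult, <- tech_pow_Rmult in HE.
  apply Rmult_le_reg_l with (Rabs h); lra.
Qed.

(* The fixed point iteration for eta = (P - eta^2) / c gains one order at 0 at each step. *)
Lemma quadratic_jet rho c X Y P n : 0 < rho -> 0 < c -> 0 <= X -> Y + X ^ 2 <= c * X ->
  poly_le rho Y P -> P 0 = 0 ->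
  exists eta, poly_le rho X eta /\ eta 0 = 0 /\ bigO (S n) (fun h => c * eta h + eta h ^ 2 - P h).
Proof.
intros Hrho Hc HX HYX HP HP0.
induction n as [|n (eta & He & He0 & HO)].
- exists (fun _ => 0). split; [|split; [reflexivity|]].
  + exists nil. simpl. split; [reflexivity|exact HX].
  + apply bigO_ext with (fun h => -1 * P h); [intro; ring|]. apply bigO_scale.
    now apply (bigO_poly rho Y).
(* Y + X^2 <= c X says that this map keeps the norm below X, so the bound is the same for every
   order n. *)
- set (eta' := fun h => / c * (P h + -1 * (eta h * eta h))).
  assert (Hic : 0 < / c) by now apply Rinv_0_lt_compat.
  assert (He' : poly_le rho X eta').
  { assert (H := poly_le_scale rho (/ c) _ _ (poly_le_add rho Hrho _ _ _ _ HP
      (poly_le_scale rho (-1) _ _ (poly_le_mul rho Hrho _ _ _ _ He He)))).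
    destruct H as (l & Hl & Hn). exists l. split; [exact Hl|].
    apply Rle_trans with (1 := Hn). rewrite Rabs_pos_eq by lra.
    replace (Rabs (-1)) with 1 by (rewrite Rabs_left; lra).
    apply Rmult_le_reg_l with c; [exact Hc|]. rewrite <- Rmult_assoc, Rinv_r by lra. lra. }
  assert (He0' : eta' 0 = 0) by (unfold eta'; rewrite HP0, He0; ring).
  exists eta'. split; [exact He'|]. split; [exact He0'|].
  (* The new residual is eta'^2 - eta^2 = (eta' - eta)(eta' + eta). The first factor is the old
     residual times -1/c, the second is O(h) since both jets vanish at 0. *)
  apply bigO_ext with (fun h => (- / c * (c * eta h + eta h ^ 2 - P h)) * (eta' h + eta h)).
  + intro h. unfold eta'. field. lra.
  + replace (S (S n)) with (S n + 1)%nat by lia. apply bigO_mul; [now apply bigO_scale|].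
    apply bigO_add; apply (bigO_poly rho X); assumption.
Qed.

Lemma iter_psi_lipschitz m B : exists L, 0 <= L /\ forall x y, Rabs x <= B -> Rabs y <= B ->
  Rabs (Nat.iter m psi x - Nat.iter m psi y) <= L * Rabs (x - y).
Proof.
revert B. induction m as [|m IH]; intro B.
- exists 1. split; [lra|]. intros x y _ _. simpl. lra.
- destruct (IH (B ^ 2 + 1 / 4)) as (L & HL & H). exists (L * (2 * Rabs B)).
  assert (HB := Rabs_pos B).
  split; [nra|]. intros x y Hx Hy. rewrite !Nat.iter_succ_r.
  assert (Hps : forall z, Rabs z <= B -> Rabs (psi z) <= B ^ 2 + 1 / 4).
  { intros z Hz. unfold psi. rewrite Rabs_pos_eq by nra. rewrite <- (pow2_abs z).
    assert (Hz0 := Rabs_pos z). nra. }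
  apply Rle_trans with (1 := H _ _ (Hps x Hx) (Hps y Hy)).
  rewrite Rmult_assoc. apply Rmult_le_compat_l; [exact HL|].
  replace (psi x - psi y) with ((x + y) * (x - y)) by (unfold psi; ring).
  rewrite Rabs_mult. apply Rmult_le_compat_r; [apply Rabs_pos|].
  apply Rle_trans with (1 := Rabs_triang _ _). assert (H1 := Rle_abs B). lra.
Qed.

(* 1/2 + backward m is the point whose m-th iterate under psi is 3/4. *)
Fixpoint backward (m : nat) : R :=
  match m with O => 1 / 4 | S m => (sqrt (1 + 4 * backward m) - 1) / 2 end.

Lemma backward_pos m : 0 < backward m.
Proof.
induction m as [|m IH]; simpl; [lra|].
assert (1 < sqrt (1 + 4 * backward m)); [|lra].
rewrite <- sqrt_1 at 1. apply sqrt_lt_1; lra.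
Qed.

Lemma backward_eq m : backward (S m) + backward (S m) ^ 2 = backward m.
Proof.
assert (H := backward_pos m). simpl.
assert (H1 := sqrt_sqrt (1 + 4 * backward m) ltac:(lra)). nra.
Qed.

(** The constant 8 gives equality at m = 0. If e (m + 9) > 2, then (e + e^2)(m + 8) > (1 + e)(2 - e)
    > 2 because e < 1, against the induction hypothesis. *)
Lemma backward_decay m : backward m * (INR m + 8) <= 2.
Proof.
induction m as [|m IH]; [simpl; lra|].
assert (H1 := backward_eq m). assert (H2 := backward_pos (S m)). rewrite S_INR.
assert (Hm := pos_INR m). set (e := backward (S m)) in *. rewrite <- H1 in IH.
destruct (Rle_dec (e * (INR m + 1 + 8)) 2) as [|h]; [assumption|exfalso].
assert (He : e < 1) by nra.
assert ((1 + e) * (2 - e) <= (1 + e) * (e * (INR m + 8))) by (apply Rmult_le_compat_l; nra).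
nra.
Qed.

(* The shape e^2 (1 - c e) is forced by jet_size_step up to the choice of c; at m = 0 the
   value 1/64 is the norm of the identity jet, which fixes the radius used below. *)
Definition jet_size (m : nat) : R := backward m ^ 2 * (1 - 2 * backward m) / 2.

Lemma backward_le m : backward m <= 1 / 4.
Proof. assert (H := backward_decay m). assert (H1 := pos_INR m). assert (H2 := backward_pos m). nra. Qed.

Lemma jet_size_nonneg m : 0 <= jet_size m.
Proof.
assert (H2 := backward_pos m). assert (H := backward_le m).
unfold jet_size. assert (0 <= backward m ^ 2) by apply pow2_ge_0. nra.
Qed.

Lemma jet_size_le m : jet_size m <= 2 / (INR m + 1) ^ 2.
Proof.
assert (H := backward_decay m). assert (H1 := pos_INR m). assert (H2 := backward_pos m).
assert (H3 := backward_le m).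
unfold jet_size. apply -> Rle_div_r; [|apply pow_lt; lra].
assert (Hb : backward m * (INR m + 1) <= 2) by nra.
assert (Hb2 : (backward m * (INR m + 1)) ^ 2 <= 2 ^ 2) by (apply pow_incr; nra).
rewrite Rpow_mult_distr in Hb2.
assert (0 <= backward m ^ 2) by apply pow2_ge_0. assert (0 <= (INR m + 1) ^ 2) by apply pow2_ge_0.
assert (0 <= backward m ^ 2 * (INR m + 1) ^ 2) by now apply Rmult_le_pos.
simpl pow in *. nra.
Qed.

(** The invariance condition of [quadratic_jet] with c = psi'(1/2 + e) = 1 + 2e. With e =
    [backward (S m)] the right side exceeds the left by e^4/4 + 4 e^5; for the shape e^2 (1 - c e)/2
    the e^4 term would be (c - 3/2)/2, so c has to exceed 3/2. *)
Lemma jet_size_step m :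
  jet_size m + jet_size (S m) ^ 2 <= (1 + 2 * backward (S m)) * jet_size (S m).
Proof.
unfold jet_size. rewrite <- backward_eq.
assert (H := backward_pos (S m)). assert (H1 := backward_le (S m)).
set (e := backward (S m)) in *.
assert (E : 0 <= e ^ 2 * (1 / 2 + 6 * e + 4 * e ^ 2 + e * (2 * (1 - e))) / 2); [|].
{ apply Rdiv_le_0_compat; [|lra]. apply Rmult_le_pos; [apply pow2_ge_0|]. nra. }
assert (He2 : 0 <= e ^ 2) by apply pow2_ge_0.
assert (He4 : 0 <= e ^ 4) by (apply pow_le; lra).
assert (He5 : 0 <= e ^ 5) by (apply pow_le; lra).
assert (He6 : 0 <= e ^ 6) by (apply pow_le; lra).
nra.
Qed.

(** eta represents, up to order n, the branch of the inverse of psi_m taking 3/4 to 1/2 +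
    [backward m]. After subtraction of constants, psi(1/2 + e + eta') = 1/2 + e + e^2 + eta is the
    quadratic equation of [quadratic_jet], and the Lipschitz bound carries its residual through the
    other m iterations. *)
Lemma iter_psi_jet m n : exists eta, poly_le (1 / 64) (jet_size m) eta /\ eta 0 = 0 /\
  bigO (S n) (fun h => Nat.iter m psi (1 / 2 + backward m + eta h) - (3 / 4 + h)).
Proof.
induction m as [|m (eta & He & He0 & HO)].
- exists (fun h => h). split; [|split; [reflexivity|]].
  + exists (0 :: 1 :: nil). split; [intro; simpl; ring|].
    unfold jet_size. simpl. rewrite Rabs_R0, Rabs_R1. lra.
  + apply bigO_ext with (fun h => 0); [intro; simpl; field|].
    exists 0, 1. split; [lra|]. intros h _. rewrite Rabs_R0. lra.
- assert (Hpos := backward_pos (S m)).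
  destruct (quadratic_jet (1 / 64) (1 + 2 * backward (S m)) (jet_size (S m)) (jet_size m) eta n)
    as (eta' & He' & He0' & HO'); auto using jet_size_nonneg, jet_size_step; try lra.
  exists eta'. split; [exact He'|]. split; [exact He0'|].
  set (z' := fun h => psi (1 / 2 + backward (S m) + eta' h)).
  set (z := fun h => 1 / 2 + backward m + eta h).
  assert (Hz : forall h, z' h - z h = (1 + 2 * backward (S m)) * eta' h + eta' h ^ 2 - eta h).
  { intro h. unfold z', z, psi. rewrite <- (backward_eq m). field. }
  apply bigO_ext with (fun h => (Nat.iter m psi (z' h) - Nat.iter m psi (z h)) +
     (Nat.iter m psi (z h) - (3 / 4 + h))).
  { intro h. rewrite Nat.iter_succ_r. unfold z'. ring. }
  apply bigO_add; [|exact HO].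
  apply bigO_le with (1 := HO').
  set (B := 1 + (2 + jet_size (S m)) ^ 2 + jet_size m).
  destruct (iter_psi_lipschitz m B) as (L & HL & HLip).
  exists L, (1 / 64). split; [lra|]. split; [exact HL|]. intros h Hh. rewrite <- Hz.
  assert (Hb := backward_le m). assert (Hb' := backward_le (S m)). assert (Hp := backward_pos m).
  assert (J := jet_size_nonneg m). assert (J' := jet_size_nonneg (S m)).
  apply HLip.
  + destruct He' as (l & Hl & Hn).
    assert (H1 := peval_bound (1 / 64) l h ltac:(lra)). rewrite <- Hl in H1.
    unfold z', psi. apply Rabs_le_between in H1.
    assert (H2 : (1 / 2 + backward (S m) + eta' h) ^ 2 <= (1 + jet_size (S m)) ^ 2).
    { rewrite <- pow2_abs. apply pow_incr. split; [apply Rabs_pos|]. apply Rabs_le_between. lra. }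
    assert (H3 := pow2_ge_0 (1 / 2 + backward (S m) + eta' h)).
    rewrite Rabs_pos_eq by lra. unfold B. nra.
  + destruct He as (l & Hl & Hn).
    assert (H1 := peval_bound (1 / 64) l h ltac:(lra)). rewrite <- Hl in H1.
    unfold z. apply Rabs_le_between in H1. apply Rabs_le_between. unfold B.
    assert (H3 := pow2_ge_0 (2 + jet_size (S m))). nra.
Qed.

(** V is D composed with psi_m near the m-th preimage, so D(3/4 + h) = V(x + eta(h)) up to
    O(h^(n+1)). The Taylor polynomial of V composed with eta thus has the same n-th coefficient as
    that of D, and its norm at radius 1/64 bounds this coefficient. *)
Lemma pullback_derivative_bound (V D : nat -> R -> R) m n del B B1 B2 :
  deriv_family V -> deriv_family D -> 0 < del ->
  (forall x, Rabs (V (S n) x) <= B) -> (forall x, Rabs (D (S n) x) <= B1) ->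
  (forall x, Rabs (D 1%nat x) <= B2) ->
  (forall z, Rabs (Nat.iter m psi z - 3 / 4) < del -> V 0%nat z = D 0%nat (Nat.iter m psi z)) ->
  Rabs (D n (3 / 4)) / INR (fact n) * (1 / 64) ^ n <=
  sum_n (fun k => Rabs (V k (1 / 2 + backward m)) / INR (fact k) * jet_size m ^ k) n.
Proof.
intros HV HD Hdel HB HB1 HB2 Heq.
destruct (iter_psi_jet m n) as (eta & He & He0 & HO).
set (x := 1 / 2 + backward m) in *.
destruct (poly_le_taylor (1 / 64) ltac:(lra) V x n _ _ He) as (l & Hl & Hn).
destruct (taylor_list D (3 / 4) n) as (l' & _ & Hl' & Hn').
assert (Hcoef : nth n l 0 = nth n l' 0).
{ apply (bigO_coef n l l'); [|lia].
  apply bigO_ext with (fun h => -1 * (V 0%nat (x + eta h) - taylor V x n (eta h)) +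
    ((V 0%nat (x + eta h) - D 0%nat (3 / 4 + h)) + (D 0%nat (3 / 4 + h) - taylor D (3 / 4) n h))).
  { intro h. rewrite Hl, Hl'. ring. }
  assert (Heta : bigO 1 eta) by (eapply bigO_poly; [|exact He|exact He0]; lra).
  apply bigO_add; [apply bigO_scale|apply bigO_add].
  - apply bigO_nonneg in Heta. destruct Heta as (K & d & HK & Hd & HE).
    exists (B * K ^ S n), d. split; [exact Hd|]. intros h Hh.
    apply Rle_trans with (1 := taylor_bound V n x B (eta h) HV HB).
    rewrite Rmult_assoc, <- Rpow_mult_distr. apply Rmult_le_compat_l.
    { apply Rle_trans with (2 := HB 0). apply Rabs_pos. }
    apply pow_incr. split; [apply Rabs_pos|]. specialize (HE h Hh). rewrite pow_1 in HE. exact HE.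
  - apply bigO_le with (1 := HO).
    assert (HO' := bigO_nonneg _ _ HO).
    destruct HO' as (K & d & HK & Hd & HE).
    (* For such h the point psi_m(x + eta(h)) is within (K + 1)|h| < del of 3/4, where V and D are
       related. *)
    set (d' := Rmin (Rmin d 1) (del / (K + 2))).
    exists B2, d'. split.
    { apply Rmin_pos; [apply Rmin_pos; lra|]. apply Rdiv_lt_0_compat; lra. }
    split; [apply Rle_trans with (2 := HB2 0); apply Rabs_pos|].
    intros h [Hh Hh'].
    assert (h1 : Rabs h < Rmin d 1) by (apply Rlt_le_trans with (1 := Hh'), Rmin_l).
    assert (h2 : Rabs h < d) by (apply Rlt_le_trans with (1 := h1), Rmin_l).
    assert (h3 : Rabs h < 1) by (apply Rlt_le_trans with (1 := h1), Rmin_r).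
    assert (h4 : Rabs h < del / (K + 2)) by (apply Rlt_le_trans with (1 := Hh'), Rmin_r).
    apply Rlt_div_r in h4; [|lra].
    specialize (HE h ltac:(lra)).
    set (w := Nat.iter m psi (x + eta h)) in *.
    assert (Hp : Rabs h ^ S n <= Rabs h).
    { simpl. rewrite <- (Rmult_1_r (Rabs h)) at 3. apply Rmult_le_compat_l; [lra|].
      rewrite <- (pow1 n). apply pow_incr. lra. }
    rewrite Heq.
    + fold w. apply (mean_value_bound (D 0%nat) (D 1%nat) (3 / 4 + h) w B2 (HD 0%nat)). intros; apply HB2.
    + fold w. replace (w - 3 / 4) with ((w - (3 / 4 + h)) + h) by ring.
      apply Rle_lt_trans with (1 := Rabs_triang _ _).
      assert (K * Rabs h ^ S n <= K * Rabs h) by (apply Rmult_le_compat_l; lra). nra.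
  - exists B1, 1. split; [lra|]. intros h _. now apply taylor_bound. }
assert (Hfac := INR_fact_lt_0 n).
replace (Rabs (D n (3 / 4)) / INR (fact n)) with (Rabs (nth n l 0)).
- apply Rle_trans with (2 := Hn). apply pnorm_nth. lra.
- rewrite Hcoef, Hn'. unfold Rdiv. rewrite Rabs_mult, (Rabs_pos_eq (/ INR (fact n))); [reflexivity|].
  left. now apply Rinv_0_lt_compat.
Qed.

(** * A compactly supported function with large derivatives *)

Lemma lnfact_dominates kap A : 0 < kap -> exists C, 0 <= C /\ forall k, A * INR k - kap * lnfact k <= C.
Proof.
intro Hk. exists (exp ((A + kap) / kap) * Rabs (A + kap)). split.
{ apply Rmult_le_pos; [left; apply exp_pos|apply Rabs_pos]. }
intro k. assert (H := lnfact_ge k). assert (Hn := pos_INR k).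
assert (H0 : kap * (INR k * ln (INR k + 1) - INR k) <= kap * lnfact k) by (apply Rmult_le_compat_l; lra).
assert (Ha := Rabs_pos (A + kap)). assert (Ha' := Rle_abs (A + kap)).
assert (He := exp_pos ((A + kap) / kap)).
destruct (Rle_dec ((A + kap) / kap) (ln (INR k + 1))) as [h|h].
- apply Rle_div_l in h; [|lra].
  assert (INR k * (A + kap) <= INR k * (ln (INR k + 1) * kap)) by (apply Rmult_le_compat_l; lra).
  nra.
- assert (Hl : 0 <= ln (INR k + 1)) by (apply ln_nonneg; lra).
  assert (Hke : INR k + 1 < exp ((A + kap) / kap)).
  { rewrite <- (exp_ln (INR k + 1)) by lra. apply exp_increasing. lra. }
  assert (INR k * (A + kap) <= exp ((A + kap) / kap) * Rabs (A + kap)).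
  { apply Rle_trans with (INR k * Rabs (A + kap)); [apply Rmult_le_compat_l; lra|].
    apply Rmult_le_compat_r; lra. }
  assert (0 <= kap * (INR k * ln (INR k + 1))) by (apply Rmult_le_pos; nra). lra.
Qed.

Lemma n_ln_n_dominates kap A B : 0 < kap -> exists N, forall n, (N <= n)%nat ->
  A * INR n + B <= kap * (INR n * ln (INR n + 1)).
Proof.
intro Hk. set (E := exp ((Rabs A + Rabs B) / kap)).
destruct (nfloor E) as [N HN]; [left; apply exp_pos|].
exists (S N). intros n Hn. assert (Hn1 := INR_pos n ltac:(lia)).
assert (HnN : INR (S N) <= INR n) by now apply le_INR. rewrite S_INR in HnN.
assert (H : (Rabs A + Rabs B) / kap <= ln (INR n + 1)).
{ rewrite <- (ln_exp ((Rabs A + Rabs B) / kap)). apply ln_monotone; [apply exp_pos|]. fold E. lra. }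
apply Rle_div_l in H; [|assumption].
assert (HA := Rle_abs A). assert (HB := Rle_abs B). assert (HB0 := Rabs_pos B).
assert (INR n * (Rabs A + Rabs B) <= INR n * (ln (INR n + 1) * kap)) by (apply Rmult_le_compat_l; lra).
nra.
Qed.

Section Weights.

Variable sigma : R -> R.
Hypothesis Hs : W0 sigma.
Variables l0 alpha beta : R.
Hypothesis Hl0 : 0 < l0.
Hypothesis Halpha : 0 < alpha.
Hypothesis Hbeta : alpha + 1 < beta.
Hypothesis Hq : almost_increasing_quot (weight_matrix sigma l0) beta.

Definition ln_weight (l : R) (n : nat) : R := phi_star sigma (l * INR n) / l.

Let M := div_gevrey (weight_matrix sigma) alpha.

Lemma ln_weight_0 l : 0 < l -> ln_weight l 0 = 0.
Proof.
intro Hl. unfold ln_weight. simpl. rewrite Rmult_0_r, phi_star_zero by assumption.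
unfold Rdiv; ring.
Qed.

(** The hypothesis concerns the single step l0; monotone chord slopes carry it to every l, by
    comparing [l n - l0, l n] with [l n, l n + l]. For n >= q the left endpoint is at least l0 and
    at least l n/2; smaller n are covered by the constant. *)
Lemma ln_weight_growth l : 0 < l -> exists c, 0 <= c /\ forall n,
  beta * ln (INR n + 1) - c <= ln_weight l (S n) - ln_weight l n.
Proof.
intro Hl.
destruct (slope_growth sigma Hs l0 beta Hl0 ltac:(lra) Hq) as (C & HC & _ & Hsl).
set (q := 2 * l0 / l). assert (Hq0 : 0 < q) by (apply Rdiv_lt_0_compat; lra).
assert (Hlnq : 0 <= ln (q + 1)) by (apply ln_nonneg; lra).
assert (Hln2 := ln_nonneg 2 ltac:(lra)).
assert (Hal := Rabs_pos (ln (l / 2))).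
exists (C + beta * (ln (q + 1) + ln 2 + Rabs (ln (l / 2)))). split.
{ assert (0 <= beta * (ln (q + 1) + ln 2 + Rabs (ln (l / 2)))) by (apply Rmult_le_pos; lra). lra. }
intro n. assert (Hn := pos_INR n). unfold ln_weight. rewrite S_INR.
replace (l * (INR n + 1)) with (l * INR n + l) by ring.
replace (phi_star sigma (l * INR n + l) / l - phi_star sigma (l * INR n) / l) with
  ((phi_star sigma (l * INR n + l) - phi_star sigma (l * INR n)) / l) by (field; lra).
destruct (Rle_dec q (INR n)) as [h|h].
- unfold q in h. apply Rle_div_l in h; [|assumption].
  assert (Hn1 : 1 <= INR n).
  { apply INR_pos. destruct n; [simpl in h; lra|lia]. }
  assert (Hch := phi_star_chord sigma Hs (l * INR n - l0) l0 (l * INR n) l ltac:(lra) Hl0 Hl ltac:(lra) ltac:(lra)).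
  specialize (Hsl (l * INR n - l0) ltac:(lra)).
  apply Rle_div_r; [assumption|]. apply Rle_div_r in Hsl; [|assumption].
  set (X := phi_star sigma (l * INR n - l0 + l0) - phi_star sigma (l * INR n - l0)) in *.
  assert (E1 : beta * (ln (INR n + 1) - ln 2 - Rabs (ln (l / 2))) <= beta * ln (l * INR n - l0)).
  { apply Rmult_le_compat_l; [lra|].
    assert (Ha : ln (l / 2 * INR n) <= ln (l * INR n - l0)) by (apply ln_monotone; nra).
    rewrite ln_mult in Ha by lra.
    assert (Hb : ln ((INR n + 1) / 2) <= ln (INR n)) by (apply ln_monotone; lra).
    rewrite ln_div in Hb by lra.
    assert (Hc := Rabs_maj2 (ln (l / 2))). lra. }
  assert (0 <= beta * ln (q + 1)) by (apply Rmult_le_pos; lra).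
  apply Rmult_le_reg_r with l0; [assumption|]. apply Rle_trans with (2 := Hch).
  rewrite Rmult_assoc, (Rmult_comm l), <- Rmult_assoc.
  apply Rmult_le_compat_r; [lra|]. apply Rle_trans with (2 := Hsl).
  apply Rmult_le_compat_r; lra.
- assert (0 <= (phi_star sigma (l * INR n + l) - phi_star sigma (l * INR n)) / l).
  { apply Rdiv_le_0_compat; [|assumption].
    assert (H := phi_star_monotone sigma Hs (l * INR n) (l * INR n + l) ltac:(nra)). lra. }
  assert (beta * ln (INR n + 1) <= beta * (ln (q + 1) + ln 2 + Rabs (ln (l / 2)))).
  { apply Rmult_le_compat_l; [lra|].
    assert (ln (INR n + 1) <= ln (q + 1)) by (apply ln_monotone; lra). lra. }
  lra.
Qed.

Lemma ln_weight_increment l : 0 < l -> exists c, 0 <= c /\ forall n k,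
  beta * (lnfact (k + n) - lnfact n) - c * INR k <= ln_weight l (k + n) - ln_weight l n.
Proof.
intro Hl. destruct (ln_weight_growth l Hl) as (c & Hc & H).
exists c. split; [exact Hc|]. intros n k. induction k as [|k IH].
- simpl. lra.
- simpl Nat.add. rewrite lnfact_S, S_INR. specialize (H (k + n)%nat). lra.
Qed.

Lemma ln_weight_le l l' n : 0 < l <= l' -> ln_weight l n <= ln_weight l' n.
Proof.
intros Hl. destruct n as [|n]; [rewrite !ln_weight_0; lra|].
assert (Hn := INR_pos (S n) ltac:(lia)). unfold ln_weight.
assert (H := phi_star_over_id sigma Hs (l * INR (S n)) (l' * INR (S n)) ltac:(nra) ltac:(nra)).
set (N := INR (S n)) in *.
apply (Rmult_le_compat_r N) in H; [|lra].
replace (phi_star sigma (l * N) / (l * N) * N) with (phi_star sigma (l * N) / l) in H by (field; lra).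
replace (phi_star sigma (l' * N) / (l' * N) * N) with (phi_star sigma (l' * N) / l') in H by (field; lra).
exact H.
Qed.

Lemma div_gevrey_ln l n : M l n = exp (ln_weight l n - alpha * lnfact n).
Proof. apply div_gevrey_exp. Qed.

Lemma div_gevrey_monotone l l' n : 0 < l <= l' -> M l n <= M l' n.
Proof.
intro H. rewrite !div_gevrey_ln. apply exp_monotone. assert (H' := ln_weight_le l l' n H). lra.
Qed.

(** Raising the order by k gains at least k!^(beta - alpha) up to a geometric factor. This pays for
    a Gevrey cutoff of order s, or with s = 0 for any geometric growth. *)
Lemma div_gevrey_absorb l s A : 0 < l -> s < beta - alpha -> exists C, 0 < C /\ forall n k,
  exp (A * INR k + s * lnfact k) * M l n <= C * M l (k + n).
Proof.
intros Hl Hsb. destruct (ln_weight_increment l Hl) as (c & Hc & H).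
destruct (lnfact_dominates (beta - alpha - s) (A + c) ltac:(lra)) as (D & _ & HD).
exists (exp D). split; [apply exp_pos|]. intros n k.
rewrite !div_gevrey_ln, <- !exp_plus. apply exp_monotone.
specialize (H n k). specialize (HD k). assert (Hsup := lnfact_superadditive k n).
assert ((beta - alpha) * lnfact k <= (beta - alpha) * (lnfact (k + n) - lnfact n))
  by (apply Rmult_le_compat_l; lra).
lra.
Qed.

Lemma pow_le_div_gevrey l r h : 0 < l -> 0 <= r -> 0 < h -> exists C, 0 < C /\ forall k,
  r ^ k <= C * (h ^ k * M l k).
Proof.
intros Hl Hr Hh. destruct (div_gevrey_absorb l 0 (ln ((r + 1) / h)) Hl ltac:(lra)) as (C & HC & H).
assert (H0 := div_gevrey_pos sigma alpha l 0 : 0 < M l 0%nat).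
exists (C / M l 0%nat). split; [now apply Rdiv_lt_0_compat|].
intro k. specialize (H 0%nat k). rewrite Nat.add_0_r, Rmult_0_l, Rplus_0_r, Rmult_comm in H.
assert (Hk : exp (ln ((r + 1) / h) * INR k) * h ^ k = (r + 1) ^ k).
{ rewrite (Rmult_comm (ln _)). fold (Rpower ((r + 1) / h) (INR k)).
  rewrite Rpower_pow by (apply Rdiv_lt_0_compat; lra).
  rewrite <- Rpow_mult_distr. f_equal. field. lra. }
assert (Hrk : r ^ k <= (r + 1) ^ k) by (apply pow_incr; lra).
apply Rle_trans with (1 := Hrk). rewrite <- Hk.
assert (Hhk : 0 < h ^ k) by now apply pow_lt.
apply Rmult_le_reg_l with (M l 0%nat); [assumption|].
replace (M l 0%nat * (C / M l 0%nat * (h ^ k * M l k))) with (C * M l k * h ^ k) by (field; lra).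
rewrite <- Rmult_assoc. apply Rmult_le_compat_r; lra.
Qed.

(* The frequency r is taken so large that r^n / (h^n M_n) nearly peaks at some n >= N. *)
Lemma hump l h N : 0 < l -> 0 < h -> exists r a n, 0 <= r /\ 0 < a /\ (N <= n)%nat /\
  (forall k, a * r ^ k <= h ^ k * M l k) /\ h ^ n * M l n / 2 <= a * r ^ n.
Proof.
intros Hl Hh. set (w := fun k => h ^ k * M l k).
assert (Hw : forall k, 0 < w k).
{ intro k. apply Rmult_lt_0_compat; [now apply pow_lt|apply div_gevrey_pos]. }
assert (HZ : exists Z, 0 <= Z /\ forall k, (k < N)%nat -> / w k <= Z).
{ induction N as [|N' (Z & HZ0 & HZ)].
  - exists 0. split; [lra|]. intros k Hk. lia.
  - assert (H := Rinv_0_lt_compat _ (Hw N')). exists (Z + / w N'). split; [lra|].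
    intros k Hk. destruct (Nat.eq_dec k N') as [->|h']; [lra|].
    specialize (HZ k ltac:(lia)). lra. }
destruct HZ as (Z & HZ0 & HZ).
(* With this r, r^n/w_n for n < N is at most half of r^N/w_N, so an index where more than half of
   the supremum is reached is at least N. *)
set (r := 1 + 2 * w N * Z). assert (HwN := Hw N).
assert (Hr : 1 <= r) by (unfold r; nra).
destruct (pow_le_div_gevrey l r h Hl ltac:(lra) Hh) as (C & HC & HCk). fold M in HCk.
assert (HB : forall x, (exists k, x = r ^ k / w k) -> x <= C).
{ intros x [k ->]. apply Rle_div_l; [apply Hw|]. apply HCk. }
assert (Hlub := Rsup_is_lub _ C (ex_intro _ _ (ex_intro _ 0%nat eq_refl)) HB).
set (Q := Rsup (fun x => exists k, x = r ^ k / w k)) in *.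
assert (HQk : forall k, r ^ k / w k <= Q).
{ intro k. apply Hlub. now exists k. }
assert (HQ : 0 < Q).
{ apply Rlt_le_trans with (2 := HQk 0%nat). apply Rdiv_lt_0_compat; [simpl; lra|apply Hw]. }
destruct (Rsup_near _ C (Q / 2) (ex_intro _ _ (ex_intro _ 0%nat eq_refl)) HB ltac:(lra)) as (x & [n ->] & Hn).
fold Q in Hn.
exists r, (/ Q), n. split; [lra|]. split; [now apply Rinv_0_lt_compat|].
split; [|split].
- destruct (Compare_dec.le_lt_dec N n) as [|hn]; [assumption|exfalso].
  destruct N as [|N']; [lia|].
  assert (E1 : r ^ n / w n <= r ^ N' * Z).
  { apply Rmult_le_compat; [apply pow_le; lra|left; apply Rinv_0_lt_compat, Hw| |now apply HZ].
    apply Rle_pow; [lra|lia]. }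
  assert (E2 := HQk (S N')).
  assert (E3 : 2 * (r ^ N' * Z) <= r ^ S N' / w (S N')).
  { apply -> Rle_div_r; [|assumption]. simpl pow.
    assert (Hp : 0 <= r ^ N') by (apply pow_le; lra).
    replace (2 * (r ^ N' * Z) * w (S N')) with ((2 * w (S N') * Z) * r ^ N') by ring.
    apply Rmult_le_compat_r; [assumption|]. unfold r. lra. }
  lra.
- intro k. specialize (HQk k). apply Rle_div_l in HQk; [|apply Hw].
  apply Rmult_le_reg_l with Q; [assumption|]. rewrite <- Rmult_assoc, Rinv_r by lra.
  fold (w k). lra.
- assert (Hn' : Q / 2 <= r ^ n / w n) by lra. apply Rle_div_r in Hn'; [|apply Hw].
  apply Rmult_le_reg_l with Q; [assumption|]. rewrite <- Rmult_assoc, Rinv_r by lra.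
  fold (w n). lra.
Qed.

(* The j-th term of the lacunary series is to exceed U j by the factor j at some order n. *)
Lemma gliding_hump (U : nat -> nat -> R) :
  (forall j, exists N, forall n, (N <= n)%nat ->
     INR j * U j n <= (/ 2) ^ S j * ((/ (INR j + 1)) ^ n * M (/ (INR j + 1)) n)) ->
  exists a r : nat -> R, (forall j, 0 <= a j) /\ (forall j, 0 <= r j) /\
   (forall l h, 0 < l -> 0 < h -> exists C, 0 <= C /\ forall j n,
      a j * r j ^ n <= C * (h ^ n * M l n) * (/ 2) ^ j) /\
   (forall j, exists n, INR j * U j n <= a j * r j ^ n).
Proof.
intro HU.
assert (Hpos : forall j, 0 < / (INR j + 1)).
{ intro j. apply Rinv_0_lt_compat. assert (H := pos_INR j). lra. }
assert (Hh2 : forall j, 0 < (/ 2) ^ j) by (intro j; apply pow_lt; lra).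
assert (Hex : forall j, exists t : R * R, 0 <= fst t /\ 0 <= snd t /\
  (forall k, fst t * snd t ^ k <= (/ 2) ^ j * ((/ (INR j + 1)) ^ k * M (/ (INR j + 1)) k)) /\
  exists n, INR j * U j n <= fst t * snd t ^ n).
{ intro j. destruct (HU j) as [N HN].
  destruct (hump _ _ N (Hpos j) (Hpos j)) as (r & a & n & Hr & Ha & Hn & Hk & Hge).
  exists ((/ 2) ^ j * a, r). simpl. assert (H2 := Hh2 j).
  split; [nra|]. split; [exact Hr|]. split.
  - intro k. rewrite Rmult_assoc. apply Rmult_le_compat_l; [lra|apply Hk].
  - exists n. apply Rle_trans with (1 := HN n Hn). simpl pow.
    apply (Rmult_le_compat_l ((/ 2) ^ j)) in Hge; [|lra]. unfold M in *. lra. }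
set (t := fun j => proj1_sig (constructive_indefinite_description _ (Hex j))).
assert (Ht : forall j, 0 <= fst (t j) /\ 0 <= snd (t j) /\
  (forall k, fst (t j) * snd (t j) ^ k <= (/ 2) ^ j * ((/ (INR j + 1)) ^ k * M (/ (INR j + 1)) k)) /\
  exists n, INR j * U j n <= fst (t j) * snd (t j) ^ n).
{ intro j. exact (proj2_sig (constructive_indefinite_description _ (Hex j))). }
exists (fun j => fst (t j)), (fun j => snd (t j)).
split; [intro j; apply Ht|]. split; [intro j; apply Ht|]. split; [|intro j; apply Ht].
intros l h Hl Hh.
(* Terms with 1/(j + 1) <= m obey the bound for l and h by monotonicity of the matrix. The finitely
   many earlier ones are geometric sequences, which every class dominates. *)
set (m := Rmin l h). assert (Hm : 0 < m) by (apply Rmin_pos; assumption).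
destruct (nfloor (/ m)) as [i Hi]; [left; now apply Rinv_0_lt_compat|].
assert (Hw : forall n, 0 < h ^ n * M l n).
{ intro n. apply Rmult_lt_0_compat; [now apply pow_lt|apply div_gevrey_pos]. }
assert (Hlow : forall J, exists C, 0 <= C /\ forall j n, (j < J)%nat ->
  fst (t j) * snd (t j) ^ n <= C * (h ^ n * M l n) * (/ 2) ^ j).
{ induction J as [|J (C & HC & IH)].
  - exists 0. split; [lra|]. intros j n Hj. lia.
  - destruct (pow_le_div_gevrey l (snd (t J)) h Hl ltac:(apply Ht) Hh) as (D & HD & HDk).
    destruct (Ht J) as (Ha & _). assert (H2 := Hh2 J).
    set (D' := fst (t J) * D / (/ 2) ^ J).
    assert (HD' : 0 <= D') by (apply Rdiv_le_0_compat; [nra|assumption]).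
    exists (C + D'). split; [lra|]. intros j n Hj. assert (Hwn := Hw n). assert (H2j := Hh2 j).
    assert (Hwj : 0 < h ^ n * M l n * (/ 2) ^ j) by now apply Rmult_lt_0_compat.
    destruct (Nat.eq_dec j J) as [->|hj].
    + apply Rle_trans with (D' * (h ^ n * M l n) * (/ 2) ^ J).
      * replace (D' * (h ^ n * M l n) * (/ 2) ^ J) with (fst (t J) * (D * (h ^ n * M l n))) by (unfold D'; field; apply Rgt_not_eq; assumption).
        apply Rmult_le_compat_l; [assumption|apply HDk].
      * rewrite !Rmult_assoc. apply Rmult_le_compat_r; [nra|lra].
    + apply Rle_trans with (1 := IH j n ltac:(lia)).
      rewrite !Rmult_assoc. apply Rmult_le_compat_r; [nra|lra]. }
destruct (Hlow i) as (C & HC & HCj).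
exists (C + 1). split; [lra|]. intros j n.
assert (Hwn := Hw n). assert (H2j := Hh2 j).
assert (Hwj : 0 < h ^ n * M l n * (/ 2) ^ j) by now apply Rmult_lt_0_compat.
destruct (Compare_dec.le_lt_dec i j) as [hj|hj].
- destruct (Ht j) as (_ & _ & Hk & _). apply Rle_trans with (1 := Hk n).
  assert (Hjm : / (INR j + 1) <= m).
  { rewrite <- (Rinv_inv m). apply Rinv_le_contravar; [now apply Rinv_0_lt_compat|].
    apply le_INR in hj. lra. }
  assert (Hml : m <= l) by apply Rmin_l. assert (Hmh : m <= h) by apply Rmin_r.
  assert (E1 : (/ (INR j + 1)) ^ n <= h ^ n).
  { apply pow_incr. specialize (Hpos j). lra. }
  assert (E2 := div_gevrey_monotone (/ (INR j + 1)) l n ltac:(specialize (Hpos j); lra)).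
  assert (E3 : (/ (INR j + 1)) ^ n * M (/ (INR j + 1)) n <= h ^ n * M l n).
  { apply Rmult_le_compat; try assumption; [apply pow_le; left; apply Hpos|left; apply div_gevrey_pos]. }
  apply Rle_trans with ((/ 2) ^ j * (h ^ n * M l n)); [apply Rmult_le_compat_l; lra|]. nra.
- apply Rle_trans with (1 := HCj j n hj). rewrite !Rmult_assoc. apply Rmult_le_compat_r; [nra|lra].
Qed.

Lemma ex_series_geom_half C : ex_series (fun j => C * (/ 2) ^ j) /\ Series (fun j => C * (/ 2) ^ j) = 2 * C.
Proof.
assert (H : Rabs (/ 2) < 1) by (rewrite Rabs_pos_eq; lra).
split.
- apply (ex_series_scal (V := R_NormedModule) C (pow (/ 2))). eexists. now apply is_series_geom.
- rewrite Series_scal_l, Series_geom by assumption. field.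
Qed.

(* Multiplying the lacunary series by a plateau function equal to 1 near t0 makes its
   support compact without changing its derivatives at t0. *)
Lemma localized_hump (U : nat -> nat -> R) t0 d : 0 < d ->
  (forall j, exists N, forall n, (N <= n)%nat ->
     INR j * U j n <= (/ 2) ^ S j * ((/ (INR j + 1)) ^ n * M (/ (INR j + 1)) n)) ->
  exists f, deriv_family f /\
   (forall n x, d <= Rabs (x - t0) -> f n x = 0) /\
   (forall l h, 0 < l -> 0 < h -> exists C, 0 <= C /\ forall n x, Rabs (f n x) <= C * (h ^ n * M l n)) /\
   (forall j, exists n, INR j * U j n <= Rabs (f n t0)).
Proof.
intros Hd HU. destruct (gliding_hump U HU) as (a & r & Ha & Hr & Hle & Hge).
assert (Hser : forall n, ex_series (fun j => a j * r j ^ n)).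
{ intro n. destruct (Hle 1 1 Rlt_0_1 Rlt_0_1) as (C & HC & H).
  apply (ex_series_le (V := R_CompleteNormedModule) _ (fun j => C * (1 ^ n * M 1 n) * (/ 2) ^ j)).
  - intro j. unfold norm; simpl; unfold abs; simpl. rewrite Rabs_pos_eq; [apply H|].
    now apply moment_term_nonneg.
  - apply ex_series_geom_half. }
assert (Hmom : forall l h, 0 < l -> 0 < h -> exists C, 0 <= C /\ forall n,
  moment a r n <= C * (h ^ n * M l n)).
{ intros l h Hl Hh. destruct (Hle l h Hl Hh) as (C & HC & H). exists (2 * C). split; [lra|]. intro n.
  rewrite Rmult_assoc. rewrite <- (proj2 (ex_series_geom_half (C * (h ^ n * M l n)))).
  apply Series_le; [|apply ex_series_geom_half].
  intro j. split; [now apply moment_term_nonneg|apply H]. }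
(* The plateau function has Gevrey order 1 + 1/(q + 1), which must lie below beta - alpha; such a q
   exists because beta - alpha > 1. *)
destruct (nfloor (/ (beta - alpha - 1))) as [q Hqf]; [left; apply Rinv_0_lt_compat; lra|].
assert (Hp : (1 <= S q)%nat) by lia.
assert (Hsb : 1 + / INR (S q) < beta - alpha).
{ rewrite S_INR. assert (/ (INR q + 1) < beta - alpha - 1); [|lra].
  rewrite <- (Rinv_inv (beta - alpha - 1)). apply Rinv_lt_contravar; [|lra].
  assert (0 < / (beta - alpha - 1)) by (apply Rinv_0_lt_compat; lra). assert (Hq0 := pos_INR q).
  apply Rmult_lt_0_compat; lra. }
set (s := 1 + / INR (S q)) in *.
destruct (gevrey_plateau (S q) Hp (t0 - d) (t0 + d / 2) (d / 2)) as (g & Hg & (C1 & B & HC1 & Hgb) & Hg0 & Hg1); [lra|lra|].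
change (1 + / INR (S q)) with s in Hgb.
set (F := trig_series a r t0).
assert (HF : deriv_family F) by now apply trig_series_deriv.
exists (fun n => prod_family g F n 0 0).
split; [now apply prod_family_deriv|]. split; [|split].
- intros n x Hx. apply prod_family_zero_l. intro m. apply Hg0.
  destruct (Rle_dec 0 (x - t0)) as [h|h].
  + rewrite Rabs_pos_eq in Hx by assumption. lra.
  + rewrite Rabs_left in Hx by lra. lra.
- intros l h Hl Hh.
  (* Half of h for each factor, since the product rule adds the two radii. *)
  destruct (Hmom l (h / 2) Hl ltac:(lra)) as (C2 & HC2 & Hm).
  destruct (div_gevrey_absorb l s (B - ln (h / 2)) Hl Hsb) as (C3 & HC3 & Hab).
  exists (C1 * (2 * C2) * C3). split; [apply Rmult_le_pos; nra|].
  intros n x.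
  assert (H := prod_family_bound g F (fun n => C1 * (2 * C2) * C3 * M l n) (h / 2) (h / 2) x).
  assert (Hij : forall i j, Rabs (g i x * F j x) <= (h / 2) ^ i * (h / 2) ^ j * (C1 * (2 * C2) * C3 * M l (i + j))).
  { intros i j. rewrite Rabs_mult.
    assert (E1 := Hgb i x). assert (E2 : Rabs (F j x) <= 2 * (C2 * ((h / 2) ^ j * M l j))).
    { apply Rle_trans with (2 * moment a r j); [now apply trig_series_bound|]. specialize (Hm j). lra. }
    specialize (Hab j i).
    assert (Ei : exp (B * INR i + s * lnfact i) = (h / 2) ^ i * exp ((B - ln (h / 2)) * INR i + s * lnfact i)).
    { rewrite <- (Rpower_pow i (h / 2)) by lra. unfold Rpower. rewrite <- exp_plus. f_equal. ring. }
    rewrite Ei in E1.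
    set (X := exp ((B - ln (h / 2)) * INR i + s * lnfact i)) in *.
    assert (Hpi : 0 <= (h / 2) ^ i) by (apply pow_le; lra).
    assert (Hpj : 0 <= (h / 2) ^ j) by (apply pow_le; lra).
    apply Rle_trans with ((C1 * ((h / 2) ^ i * X)) * (2 * (C2 * ((h / 2) ^ j * M l j)))).
    { apply Rmult_le_compat; auto using Rabs_pos. }
    replace ((C1 * ((h / 2) ^ i * X)) * (2 * (C2 * ((h / 2) ^ j * M l j)))) with
     ((h / 2) ^ i * (h / 2) ^ j * (C1 * (2 * C2)) * (X * M l j)) by ring.
    replace ((h / 2) ^ i * (h / 2) ^ j * (C1 * (2 * C2) * C3 * M l (i + j))) with
     ((h / 2) ^ i * (h / 2) ^ j * (C1 * (2 * C2)) * (C3 * M l (i + j)%nat)) by ring.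
    apply Rmult_le_compat_l; [|exact Hab].
    apply Rmult_le_pos; [now apply Rmult_le_pos|nra]. }
  specialize (H Hij n 0%nat 0%nat). simpl pow in H at 2 3.
  rewrite !Rmult_1_l, !Nat.add_0_r in H. replace (h / 2 + h / 2) with h in H by field.
  apply Rle_trans with (1 := H). right. ring.
- intro j. destruct (Hge j) as [n Hn]. exists n. apply Rle_trans with (1 := Hn).
  destruct (Hg1 t0) as [G0 G1]; [lra|].
  rewrite prod_family_const_l by assumption. rewrite Nat.add_0_r. unfold F.
  rewrite trig_series_center by assumption. now apply moment_ge_term.
Qed.

End Weights.

(** * The resolvent *)

Lemma sum_n_le_const (u : nat -> R) n B : (forall k, (k <= n)%nat -> u k <= B) ->
  sum_n u n <= (INR n + 1) * B.
Proof.
intro H. induction n as [|n IH].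
- rewrite sum_O. simpl. specialize (H 0%nat (le_n _)). lra.
- rewrite sum_Sn, S_INR. unfold plus; simpl.
  assert (H1 := IH (fun k Hk => H k (le_S _ _ Hk))). assert (H2 := H (S n) (le_n _)). lra.
Qed.

Lemma exp_pow x n : exp x ^ n = exp (x * INR n).
Proof.
rewrite <- Rpower_pow by apply exp_pos. unfold Rpower. rewrite ln_exp. f_equal. ring.
Qed.

Section Upper.

Variable sigma : R -> R.
Hypothesis Hs : W0 sigma.
Variables l0 alpha beta : R.
Hypothesis Hl0 : 0 < l0.
Hypothesis Halpha : 0 < alpha.
Hypothesis Hbeta : alpha + 1 < beta.
Hypothesis Hq : almost_increasing_quot (weight_matrix sigma l0) beta.

Definition decay_exponent := Rmin (beta - 1) 2.

(* On the diagonal m = n the factor jet_size n ^ k behaves like n^(-2k), while passing from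
   the k-th to the n-th weight gains (n!/k!)^beta. *)
Lemma jet_term_exponent l Ct : 0 < l -> 0 < Ct -> exists Q, forall n k, (k <= n)%nat ->
  lnfact n + (ln_weight sigma l k + INR k * ln Ct) - lnfact k + INR k * (ln 2 - 2 * ln (INR n + 1)) <=
  Q * INR n + ln_weight sigma l n - decay_exponent * (INR n * ln (INR n + 1)).
Proof.
intros Hl HCt.
destruct (ln_weight_increment sigma Hs l0 alpha beta Hl0 Halpha Hbeta Hq l Hl) as (c & Hc & H).
set (b := ln 2 + ln Ct). assert (Hb := Rle_abs b). assert (Hb0 := Rabs_pos b).
exists (beta - 1 + c + Rabs b). intros n k Hk.
specialize (H k (n - k)%nat). replace (n - k + k)%nat with n in H by lia.
rewrite minus_INR in H by assumption.
assert (HkR := le_INR _ _ Hk). assert (Hk0 := pos_INR k).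
set (t := ln (INR n + 1)). assert (Ht : 0 <= t) by (apply ln_nonneg; lra).
assert (E1 : lnfact k <= INR k * t).
{ apply Rle_trans with (1 := lnfact_le k). apply Rmult_le_compat_l; [assumption|].
  apply ln_monotone; lra. }
assert (E2 := lnfact_ge n). fold t in E2.
set (d := lnfact n - lnfact k) in *.
assert (E3 : (beta - 1) * ((INR n - INR k) * t - INR n) <= (beta - 1) * d).
{ apply Rmult_le_compat_l; [lra|]. unfold d. lra. }
(* Of the n factors, n - k decay with exponent beta - 1 (weights against factorials) and k with
   exponent 2 (size of the jet); the minimum bounds any mixture. *)
assert (E4 : decay_exponent * (INR n * t) <= (beta - 1) * ((INR n - INR k) * t) + 2 * (INR k * t)).
{ assert (F1 : decay_exponent <= beta - 1) by apply Rmin_l.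
  assert (F2 : decay_exponent <= 2) by apply Rmin_r.
  assert (G1 : 0 <= (INR n - INR k) * t) by (apply Rmult_le_pos; lra).
  assert (G2 : 0 <= INR k * t) by (apply Rmult_le_pos; lra).
  assert (decay_exponent * ((INR n - INR k) * t) <= (beta - 1) * ((INR n - INR k) * t)) by (apply Rmult_le_compat_r; lra).
  assert (decay_exponent * (INR k * t) <= 2 * (INR k * t)) by (apply Rmult_le_compat_r; lra). lra. }
assert (E5 : INR k * b <= INR n * Rabs b).
{ apply Rle_trans with (INR k * Rabs b); [apply Rmult_le_compat_l; lra|apply Rmult_le_compat_r; lra]. }
assert (E6 : 0 <= c * INR k) by (apply Rmult_le_pos; lra).
unfold b in E5 at 1. unfold d in H, E3. lra.
Qed.

(** The number of summands, lam^n and 64^n go into Q. It is essential that Q precedes K, v and D: f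
    is built from Q, whereas K comes from a bound assumed afterwards for R_mu f. *)
Lemma pullback_sum_bound l Ct lam T : 0 < l -> 0 < Ct -> 0 < lam ->
  (forall k, 0 <= T k <= Ct ^ k * weight_matrix sigma l k) ->
  exists Q, forall n K v D, 0 <= K -> (forall k, 0 <= v k <= lam ^ (n + 1) * (K * T k)) ->
   D / INR (fact n) * (1 / 64) ^ n <= sum_n (fun k => v k / INR (fact k) * jet_size n ^ k) n ->
   D <= K * lam * exp (Q * INR n + ln_weight sigma l n - decay_exponent * (INR n * ln (INR n + 1))).
Proof.
intros Hl HCt Hlam HT. destruct (jet_term_exponent l Ct Hl HCt) as (Q & HQ).
exists (Q + 1 + ln 64 + ln lam). intros n K v D HK Hv HD.
assert (Hn := pos_INR n).
set (E := Q * INR n + ln_weight sigma l n - decay_exponent * (INR n * ln (INR n + 1))) in *.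
assert (Hlam' : 0 < lam ^ (n + 1)) by now apply pow_lt.
assert (Hfn := INR_fact_lt_0 n).
assert (HKl : 0 <= lam ^ (n + 1) * K) by (apply Rmult_le_pos; lra).
assert (Hsum : sum_n (fun k => v k / INR (fact k) * jet_size n ^ k) n <=
  (INR n + 1) * (lam ^ (n + 1) * K * exp (E - lnfact n))).
{ apply sum_n_le_const. intros k Hk.
  assert (Hfk := INR_fact_lt_0 k).
  assert (H1 : v k / INR (fact k) <= lam ^ (n + 1) * K * (Ct ^ k * weight_matrix sigma l k) * exp (- lnfact k)).
  { rewrite exp_Ropp. unfold lnfact. rewrite exp_ln by assumption. unfold Rdiv.
    apply Rmult_le_compat_r; [left; now apply Rinv_0_lt_compat|].
    apply Rle_trans with (1 := proj2 (Hv k)). rewrite <- Rmult_assoc.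
    apply Rmult_le_compat_l; [assumption|apply HT]. }
  assert (H2 : jet_size n ^ k <= exp (INR k * (ln 2 - 2 * ln (INR n + 1)))).
  { apply Rle_trans with ((2 / (INR n + 1) ^ 2) ^ k).
    - apply pow_incr. split; [apply jet_size_nonneg|apply jet_size_le].
    - right. rewrite (Rmult_comm (INR k)), <- exp_pow. f_equal.
      unfold Rminus. rewrite exp_plus, exp_ln, exp_Ropp by lra. unfold Rdiv. f_equal. f_equal.
      rewrite <- (exp_ln (INR n + 1)) at 1 by lra. rewrite exp_pow. f_equal. simpl. ring. }
  assert (H3 : Ct ^ k * weight_matrix sigma l k = exp (ln_weight sigma l k + INR k * ln Ct)).
  { rewrite <- Rpower_pow by assumption. unfold Rpower, weight_matrix. rewrite <- exp_plus. f_equal.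
    unfold ln_weight. ring. }
  rewrite H3 in H1.
  apply Rle_trans with (lam ^ (n + 1) * K * exp (ln_weight sigma l k + INR k * ln Ct) * exp (- lnfact k) *
     exp (INR k * (ln 2 - 2 * ln (INR n + 1)))).
  { apply Rmult_le_compat; try assumption.
    - apply Rdiv_le_0_compat; [apply Hv|assumption].
    - apply pow_le, jet_size_nonneg. }
  rewrite !(Rmult_assoc (lam ^ (n + 1) * K)), <- !exp_plus.
  apply Rmult_le_compat_l; [assumption|]. apply exp_monotone.
  specialize (HQ n k Hk). unfold E. lra. }
assert (Hall := Rle_trans _ _ _ HD Hsum).
assert (Hn1 : INR n + 1 <= exp (INR n)) by (assert (H := exp_ineq1_le (INR n)); lra).
assert (H64 : (1 / 64) ^ n = exp (- (ln 64 * INR n))).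
{ replace (1 / 64) with (exp (- ln 64)) by (rewrite exp_Ropp, exp_ln; lra). rewrite exp_pow. f_equal. ring. }
assert (Hlamn : lam ^ (n + 1) = lam * exp (ln lam * INR n)).
{ rewrite <- exp_pow, exp_ln by assumption. rewrite pow_add. simpl. ring. }
assert (Hl64 := exp_pos (- (ln 64 * INR n))).
rewrite H64 in Hall.
assert (H : D <= (INR n + 1) * (lam ^ (n + 1) * K * exp (E - lnfact n)) * exp (ln 64 * INR n) * INR (fact n)).
{ apply (Rmult_le_compat_r (exp (ln 64 * INR n) * INR (fact n))) in Hall.
  2:{ apply Rmult_le_pos; [left; apply exp_pos|lra]. }
  rewrite exp_Ropp in Hall.
  replace (D / INR (fact n) * / exp (ln 64 * INR n) * (exp (ln 64 * INR n) * INR (fact n))) with D in Hall.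
  2:{ field. split; [apply Rgt_not_eq, exp_pos|lra]. }
  rewrite <- !Rmult_assoc in *. exact Hall. }
apply Rle_trans with (1 := H).
replace (INR (fact n)) with (exp (lnfact n)) by (unfold lnfact; now apply exp_ln).
rewrite Hlamn.
apply Rle_trans with (exp (INR n) * (lam * exp (ln lam * INR n) * K * exp (E - lnfact n)) * exp (ln 64 * INR n) * exp (lnfact n)).
{ repeat (apply Rmult_le_compat_r; [left; apply exp_pos|]).
  apply Rmult_le_compat_r; [|exact Hn1]. rewrite <- Hlamn. apply Rmult_le_pos; [lra|left; apply exp_pos]. }
right.
replace ((Q + 1 + ln 64 + ln lam) * INR n + ln_weight sigma l n - decay_exponent * (INR n * ln (INR n + 1)))
 with (INR n + ln lam * INR n + (E - lnfact n) + ln 64 * INR n + lnfact n) by (unfold E; ring).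
rewrite !exp_plus. ring.
Qed.

End Upper.

Lemma Series_single (u : nat -> R) m : (forall i, i <> m -> u i = 0) -> Series u = u m.
Proof.
intro H. apply is_series_unique.
assert (Hsum : forall n, sum_n u n = if Compare_dec.le_lt_dec m n then u m else 0).
{ induction n as [|n IH].
  - rewrite sum_O. destruct (Compare_dec.le_lt_dec m 0); [f_equal; lia|apply H; lia].
  - rewrite sum_Sn, IH. unfold plus; simpl.
    destruct (Compare_dec.le_lt_dec m n), (Compare_dec.le_lt_dec m (S n)); try lia.
    + rewrite (H (S n)) by lia. ring.
    + replace m with (S n) by lia. ring.
    + rewrite (H (S n)) by lia. ring. }
apply filterlim_ext_loc with (fun _ => u m).
- exists m. intros n Hn. rewrite Hsum. destruct (Compare_dec.le_lt_dec m n); [reflexivity|lia].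
- apply filterlim_const.
Qed.

Lemma is_series_C (a : nat -> C) : ex_series (fun m => Re (a m)) -> ex_series (fun m => Im (a m)) ->
  is_series (V := C_NormedModule) a (Series (fun m => Re (a m)), Series (fun m => Im (a m))).
Proof.
intros H1 H2. apply Series_correct in H1, H2.
assert (E : forall n, sum_n (G := C_NormedModule) a n = (sum_n (fun m => Re (a m)) n, sum_n (fun m => Im (a m)) n)).
{ induction n as [|n IH].
  - rewrite !sum_O. apply surjective_pairing.
  - rewrite !sum_Sn, IH. reflexivity. }
apply filterlim_ext with (1 := fun n => eq_sym (E n)).
apply filterlim_locally. intro eps.
assert (G1 := proj1 (filterlim_locally _ _) H1 eps).
assert (G2 := proj1 (filterlim_locally _ _) H2 eps).
generalize (filter_and _ _ G1 G2). apply filter_imp. intros n Hn. exact Hn.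
Qed.

Lemma resolvent_is_series mu f B x : 1 < Cmod mu -> (forall x, Cmod (f x) <= B) ->
  is_series (resolvent_term mu f x) (resolvent mu f x).
Proof.
intros Hmu HB.
assert (Hle : forall m, Cmod (resolvent_term mu f x m) <= B * (/ Cmod mu) ^ m).
{ intro m. unfold resolvent_term.
  assert (Hp : 0 < Cmod mu ^ (m + 1)) by (apply pow_lt; lra).
  assert (HB0 : 0 <= B) by (apply Rle_trans with (2 := HB 0); apply Cmod_ge_0).
  rewrite Cmod_div, Cmod_pow by (apply Cmod_gt_0; rewrite Cmod_pow; assumption).
  unfold Rdiv. apply Rmult_le_compat; [apply Cmod_ge_0|left; now apply Rinv_0_lt_compat|apply HB|].
  rewrite pow_inv. apply Rinv_le_contravar; [apply pow_lt; lra|].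
  apply Rle_pow; [lra|lia]. }
assert (Hg : ex_series (fun m => B * (/ Cmod mu) ^ m)).
{ apply (ex_series_scal (V := R_NormedModule) B (pow (/ Cmod mu))). eexists. apply is_series_geom.
  rewrite Rabs_pos_eq by (left; apply Rinv_0_lt_compat; lra).
  rewrite <- Rinv_1. apply Rinv_lt_contravar; lra. }
apply is_series_C; apply (ex_series_le (V := R_CompleteNormedModule) _ (fun m => B * (/ Cmod mu) ^ m)); auto;
  intro m; apply Rle_trans with (2 := Hle m); [apply re_le_Cmod|].
apply Rle_trans with (2 := Rmax_Cmod _). apply Rmax_r.
Qed.

Lemma psi_ge x : x <= psi x.
Proof. unfold psi. assert (H := pow2_ge_0 (x - 1 / 2)). nra. Qed.

Lemma iter_psi_le i j x : (i <= j)%nat -> Nat.iter i psi x <= Nat.iter j psi x.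
Proof.
intro H. induction H as [|j H IH]; [lra|]. apply Rle_trans with (1 := IH). apply psi_ge.
Qed.

(* psi is increasing on [0.73, 0.77] and maps 0.73 beyond 0.77, so this interval is wandering. *)
Lemma orbit_avoids_support m i z : i <> m -> Rabs (Nat.iter m psi z - 3 / 4) < 2 / 100 ->
  2 / 100 <= Rabs (Nat.iter i psi z - 3 / 4).
Proof.
intros Him Hm. apply Rabs_def2 in Hm.
destruct (Compare_dec.le_lt_dec i m) as [h|h].
- destruct m as [|m]; [lia|]. assert (H := iter_psi_le i m z ltac:(lia)).
  simpl in Hm. unfold psi at 1 3 in Hm.
  assert (Nat.iter m psi z <= 73 / 100) by nra.
  rewrite Rabs_left by lra. lra.
- assert (H := iter_psi_le (S m) i z ltac:(lia)). simpl in H. unfold psi at 1 in H.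
  rewrite Rabs_pos_eq by nra. nra.
Qed.

Definition real_valued (f : R -> R) (x : R) : C := RtoC (f x).

Lemma Cpow_neq_0 (mu : C) n : 1 < Cmod mu -> Cpow mu n <> RtoC 0.
Proof.
intro H. apply Cmod_gt_0. rewrite Cmod_pow. apply pow_lt. lra.
Qed.

Lemma resolvent_near_preimage mu f m z : 1 < Cmod mu ->
  (forall x, 2 / 100 <= Rabs (x - 3 / 4) -> f x = 0) ->
  Rabs (Nat.iter m psi z - 3 / 4) < 2 / 100 ->
  resolvent mu (real_valued f) z = Cdiv (RtoC (f (Nat.iter m psi z))) (Cpow mu (m + 1)).
Proof.
intros Hmu Hf Hz. unfold resolvent.
assert (H0 : forall i, i <> m -> resolvent_term mu (real_valued f) z i = RtoC 0).
{ intros i Hi. unfold resolvent_term, real_valued. rewrite Hf by now apply (orbit_avoids_support m).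
  unfold Cdiv. apply Cmult_0_l. }
rewrite (Series_single _ m), (Series_single _ m).
- symmetry. apply surjective_pairing.
- intros i Hi. now rewrite H0.
- intros i Hi. now rewrite H0.
Qed.

Lemma real_valued_smooth D : deriv_family D -> smooth (real_valued (D 0%nat)).
Proof.
intros HD n x. split.
- apply (deriv_family_ex_derive_n D n x HD).
- apply (ex_derive_n_ext (fun _ => 0)); [reflexivity|].
  destruct n; [exact I|]. simpl.
  apply ex_derive_ext with (fun _ => Derive_n (fun _ : R => 0) n 0).
  + intro t. destruct n; [reflexivity|]. now rewrite !Derive_n_const.
  + apply ex_derive_const.
Qed.

Lemma Cmod_CDerive_n_real_valued D n x : deriv_family D ->
  Cmod (CDerive_n (real_valued (D 0%nat)) n x) = Rabs (D n x).
Proof.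
intro HD. unfold CDerive_n.
replace (Derive_n (im_part (real_valued (D 0%nat))) n x) with 0.
- change (Derive_n (re_part (real_valued (D 0%nat))) n x) with (Derive_n (D 0%nat) n x).
  rewrite deriv_family_Derive_n by assumption. apply Cmod_R.
- change (im_part (real_valued (D 0%nat))) with (fun _ : R => 0).
  destruct n; [reflexivity|]. now rewrite Derive_n_const.
Qed.

Lemma weight_matrix_0 sigma l : W0 sigma -> weight_matrix sigma l 0 = 1.
Proof.
intro Hs. unfold weight_matrix. simpl. rewrite Rmult_0_r, phi_star_zero by assumption.
unfold Rdiv. now rewrite Rmult_0_l, exp_0.
Qed.

Lemma seq_preceq_pow (M N : nat -> R) : (forall p, 0 < M p) -> (forall p, 0 < N p) -> M 0%nat = N 0%nat ->
  seq_preceq M N -> exists K, 0 < K /\ forall p, M p <= K ^ p * N p.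
Proof.
intros HM HN H0 [K HK].
assert (HK0 : 0 < K).
{ apply Rlt_le_trans with (2 := HK 1%nat (le_n _)). apply exp_pos. }
exists K. split; [exact HK0|]. intros [|p]; [rewrite H0; simpl; lra|].
specialize (HK (S p) ltac:(lia)).
assert (HR : 0 < M (S p) / N (S p)) by now apply Rdiv_lt_0_compat.
assert (H : (Rpower (M (S p) / N (S p)) (/ INR (S p))) ^ S p <= K ^ S p).
{ apply pow_incr. split; [left; apply exp_pos|exact HK]. }
rewrite <- Rpower_pow, Rpower_mult, Rinv_l, Rpower_1 in H
  by first [apply exp_pos | assumption | apply not_0_INR; lia].
apply (proj1 (Rle_div_l _ _ _ (HN (S p)))), H.
Qed.

(** On the support 1 + |x| <= 2, so the polynomial weight costs 2^k, which the passage from order j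
    to j + k absorbs together with h^(-k). *)
Lemma real_valued_schwartz sigma l0 alpha beta D : W0 sigma -> 0 < l0 -> 0 < alpha -> alpha + 1 < beta ->
  almost_increasing_quot (weight_matrix sigma l0) beta -> deriv_family D ->
  (forall n x, 2 / 100 <= Rabs (x - 3 / 4) -> D n x = 0) ->
  (forall l h, 0 < l -> 0 < h -> exists C, 0 <= C /\ forall n x,
     Rabs (D n x) <= C * (h ^ n * div_gevrey (weight_matrix sigma) alpha l n)) ->
  schwartz_matrix (div_gevrey (weight_matrix sigma) alpha) (real_valued (D 0%nat)).
Proof.
intros Hs Hl0 Ha Hb Hq HD Hsupp Hbd. split; [now apply real_valued_smooth|].
intros l h Hl Hh. destruct (Hbd l h Hl Hh) as (C & HC & H).
destruct (div_gevrey_absorb sigma Hs l0 alpha beta Hl0 Ha Hb Hq l 0 (ln (2 / h)) Hl ltac:(lra)) as (C' & HC' & H').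
exists (C * C'). intros x j k. rewrite Cmod_CDerive_n_real_valued by assumption.
assert (HMp : forall n, 0 < h ^ n * div_gevrey (weight_matrix sigma) alpha l n).
{ intro n. apply Rmult_lt_0_compat; [now apply pow_lt|now apply div_gevrey_pos]. }
apply Rle_div_l; [apply HMp|].
destruct (Rle_dec (2 / 100) (Rabs (x - 3 / 4))) as [hx|hx].
{ rewrite Hsupp, Rabs_R0, Rmult_0_r by assumption. apply Rmult_le_pos; [nra|left; apply HMp]. }
assert (Hx : 1 + Rabs x <= 2).
{ apply Rnot_le_lt, Rabs_def2 in hx. rewrite Rabs_pos_eq; lra. }
apply Rle_trans with (2 ^ k * (C * (h ^ j * div_gevrey (weight_matrix sigma) alpha l j))).
{ apply Rmult_le_compat; try apply Rabs_pos; [|apply pow_incr|apply H].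
  - apply pow_le. assert (H1 := Rabs_pos x). lra.
  - assert (H1 := Rabs_pos x). lra. }
specialize (H' j k). rewrite Rmult_0_l, Rplus_0_r, <- exp_pow, exp_ln in H' by (apply Rdiv_lt_0_compat; lra).
rewrite (Nat.add_comm k j) in H'.
assert (Hhk : 0 < h ^ k) by now apply pow_lt. assert (Hhj : 0 < h ^ j) by now apply pow_lt.
replace (2 ^ k) with ((2 / h) ^ k * h ^ k) by (rewrite <- Rpow_mult_distr; f_equal; field; lra).
rewrite pow_add.
set (Mj := div_gevrey (weight_matrix sigma) alpha l j) in *.
set (Mjk := div_gevrey (weight_matrix sigma) alpha l (j + k)) in *.
replace ((2 / h) ^ k * h ^ k * (C * (h ^ j * Mj))) with ((C * (h ^ j * h ^ k)) * ((2 / h) ^ k * Mj)) by ring.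
replace (C * C' * (h ^ j * h ^ k * Mjk)) with ((C * (h ^ j * h ^ k)) * (C' * Mjk)) by ring.
apply Rmult_le_compat_l; [|exact H']. apply Rmult_le_pos; nra.
Qed.

(* u = resolvent mu f; near the m-th preimage of 3/4 it is f (psi_m) / mu^(m+1). *)
Lemma resolvent_derivative_bound mu D B1 T K n : 1 < Cmod mu -> deriv_family D ->
  (forall m x, 2 / 100 <= Rabs (x - 3 / 4) -> D m x = 0) ->
  (forall m x, Rabs (D m x) <= B1 m) ->
  smooth (resolvent mu (real_valued (D 0%nat))) ->
  (forall m x, Cmod (CDerive_n (resolvent mu (real_valued (D 0%nat))) m x) <= K * T m) ->
  exists v, (forall k, 0 <= v k <= Cmod mu ^ (n + 1) * (K * T k)) /\
    Rabs (D n (3 / 4)) / INR (fact n) * (1 / 64) ^ n <=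
    sum_n (fun k => v k / INR (fact k) * jet_size n ^ k) n.
Proof.
intros Hmu HD Hsupp HB Hsm HK.
set (u := resolvent mu (real_valued (D 0%nat))) in *.
set (w := Cpow mu (n + 1)).
(* V is the k-th derivative of Re(mu^(n+1) u); the real part loses nothing because f is real. The
   number of iterations is taken equal to the order n. *)
set (V := fun k x => Re w * Derive_n (re_part u) k x - Im w * Derive_n (im_part u) k x).
assert (HV : forall k x, Rabs (V k x) <= Cmod mu ^ (n + 1) * (K * T k)).
{ intros k x. rewrite <- Cmod_pow. fold w.
  apply Rle_trans with (Cmod w * Cmod (CDerive_n u k x)).
  - rewrite <- Cmod_mult. apply (re_le_Cmod (w * CDerive_n u k x)%C).
  - apply Rmult_le_compat_l; [apply Cmod_ge_0|apply HK]. }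
assert (HVd : deriv_family V).
{ intros k x. unfold V.
  apply (is_derive_minus (fun x => Re w * Derive_n (re_part u) k x) (fun x => Im w * Derive_n (im_part u) k x));
    apply is_derive_scal; apply Derive_correct; apply (Hsm (S k) x). }
exists (fun k => Rabs (V k (1 / 2 + backward n))). split.
{ intro k. split; [apply Rabs_pos|apply HV]. }
apply (pullback_derivative_bound V D n n (2 / 100) (Cmod mu ^ (n + 1) * (K * T (S n))) (B1 (S n)) (B1 1%nat));
  auto; [lra|].
intros z Hz. unfold V. simpl Derive_n. unfold re_part, im_part, u.
rewrite (resolvent_near_preimage mu (D 0%nat) n z Hmu (Hsupp 0%nat) Hz). fold w.
change (Re (w * (RtoC (D 0%nat (Nat.iter n psi z)) / w))%C = D 0%nat (Nat.iter n psi z)).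
replace (w * (RtoC (D 0%nat (Nat.iter n psi z)) / w))%C with (RtoC (D 0%nat (Nat.iter n psi z))); [reflexivity|].
field. now apply Cpow_neq_0.
Qed.

Theorem theorem6p1 (sigma tau : R -> R) (alpha : R) (mu : C)
  (Hsigma : W0 sigma) (Htau : W0 tau)
  (Halpha : 0 < alpha < 2) (Hmu : 1 < Cmod mu)
  (Ha : exists l0, 0 < l0 /\
     Rbar_lt (alpha + 1) (growth_index (weight_matrix sigma l0)))
  (Hb : little_o_infty sigma (id_pow (1 / alpha)))
  (Hc : exists k0, 0 < k0 /\ forall l, 0 < l ->
     seq_preceq (weight_matrix tau k0) (weight_matrix sigma l)) :
  (forall f : R -> C,
     schwartz_weight
       (arg_pow (iota (legendre (arg_pow sigma alpha))) (1 / alpha)) f <->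
     schwartz_weight (conj_hat sigma (id_pow (1 / alpha))) f) /\
  (forall f : R -> C,
     schwartz_weight (conj_hat sigma (id_pow (1 / alpha))) f <->
     schwartz_matrix (div_gevrey (weight_matrix sigma) alpha) f) /\
  (exists f : R -> C,
     schwartz_weight
       (arg_pow (iota (legendre (arg_pow sigma alpha))) (1 / alpha)) f /\
     (forall x : R, is_series (resolvent_term mu f x) (resolvent mu f x)) /\
     ~ schwartz_weight tau (resolvent mu f)).
Proof.
destruct Ha as (l0 & Hl0 & Hg).
destruct (growth_index_gt _ (alpha + 1) ltac:(lra) Hg) as (beta & Hbeta & Hq).
assert (Ha0 : 0 < alpha) by lra.
assert (Hleg : forall f, schwartz_weight
       (arg_pow (iota (legendre (arg_pow sigma alpha))) (1 / alpha)) f <->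
     schwartz_weight (conj_hat sigma (id_pow (1 / alpha))) f).
{ intro f. apply schwartz_weight_ext. intros t Ht.
  apply legendre_conj_hat; auto. apply (W0_zero _ Hsigma). lra. }
assert (Hdiv : forall f, schwartz_weight (conj_hat sigma (id_pow (1 / alpha))) f <->
     schwartz_matrix (div_gevrey (weight_matrix sigma) alpha) f).
{ intro f. apply (schwartz_conj_hat_div_gevrey sigma alpha l0 beta); auto; lra. }
split; [exact Hleg|]. split; [exact Hdiv|].
destruct Hc as (k0 & Hk0 & Hc).
set (T := weight_matrix tau k0).
assert (HT : forall l, 0 < l -> exists Ct, 0 < Ct /\ forall k, 0 <= T k <= Ct ^ k * weight_matrix sigma l k).
{ intros l Hl. destruct (seq_preceq_pow T (weight_matrix sigma l)) as (Ct & HCt & H); auto.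
  - intro p; apply exp_pos.
  - intro p; apply exp_pos.
  - unfold T. now rewrite !weight_matrix_0.
  - exists Ct. split; [exact HCt|]. intro k. split; [left; apply exp_pos|apply H]. }
assert (Hl : forall j, 0 < / (INR j + 1)).
{ intro j. apply Rinv_0_lt_compat. assert (H := pos_INR j). lra. }
set (E := fun q j n => q * INR n + ln_weight sigma (/ (INR j + 1)) n -
   decay_exponent beta * (INR n * ln (INR n + 1))).
assert (HQ : forall j, exists q, forall n K v D, 0 <= K ->
   (forall k, 0 <= v k <= Cmod mu ^ (n + 1) * (K * T k)) ->
   D / INR (fact n) * (1 / 64) ^ n <= sum_n (fun k => v k / INR (fact k) * jet_size n ^ k) n ->
   D <= K * Cmod mu * exp (E q j n)).
{ intro j. destruct (HT _ (Hl j)) as (Ct & HCt & H).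
  apply (pullback_sum_bound sigma Hsigma l0 alpha beta Hl0 Ha0 Hbeta Hq _ Ct); auto. lra. }
(* The constants of the upper estimates for all l = 1/(j + 1) are fixed before f is chosen. *)
set (Q := fun j => proj1_sig (constructive_indefinite_description _ (HQ j))).
assert (HQ' := fun j => proj2_sig (constructive_indefinite_description _ (HQ j))).
cbv beta in HQ'. fold Q in HQ'.
destruct (localized_hump sigma Hsigma l0 alpha beta Hl0 Ha0 Hbeta Hq (fun j n => exp (E (Q j) j n)) (3 / 4) (2 / 100) ltac:(lra))
  as (D & HD & Hsupp & Hbd & Hbig).
{ intro j.
  (* In logarithms the condition on the hump asks that (a - alpha) n ln(n + 1) exceed a linear
     function of n, where a is [decay_exponent beta]; a > alpha combines alpha < 2 with alpha < beta
     - 1. *)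
  destruct (n_ln_n_dominates (decay_exponent beta - alpha) (Q j + ln (INR j + 1)) (INR j + ln 2 * INR (S j))) as [N HN].
  { assert (alpha < decay_exponent beta); [|lra]. unfold decay_exponent. apply Rmin_glb_lt; lra. }
  exists N. intros n Hn. specialize (HN n Hn).
  rewrite div_gevrey_exp. fold (ln_weight sigma (/ (INR j + 1)) n).
  assert (Hj := pos_INR j).
  replace (/ 2) with (exp (- ln 2)) by (rewrite exp_Ropp, exp_ln; lra).
  replace ((/ (INR j + 1)) ^ n) with (exp (- ln (INR j + 1) * INR n))
    by (rewrite <- exp_pow, exp_Ropp, exp_ln; [reflexivity|lra]).
  rewrite exp_pow, <- !exp_plus.
  assert (Hje : INR j <= exp (INR j)) by (assert (H := exp_ineq1_le (INR j)); lra).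
  apply Rle_trans with (exp (INR j) * exp (E (Q j) j n)).
  { apply Rmult_le_compat_r; [left; apply exp_pos|exact Hje]. }
  rewrite <- exp_plus. apply exp_monotone. unfold E.
  assert (H := lnfact_le n).
  assert (alpha * lnfact n <= alpha * (INR n * ln (INR n + 1))) by (apply Rmult_le_compat_l; lra).
  lra. }
assert (HB : exists B1, forall m x, Rabs (D m x) <= B1 m).
{ destruct (Hbd 1 1 Rlt_0_1 Rlt_0_1) as (C1 & _ & H). eexists. intros m x. apply (H m x). }
destruct HB as [B1 HB1].
exists (real_valued (D 0%nat)). split; [|split].
- apply Hleg, Hdiv. now apply (real_valued_schwartz sigma l0 alpha beta).
- intro x. apply (resolvent_is_series mu _ (B1 0%nat) x Hmu).
  intro y. unfold real_valued. rewrite Cmod_R. apply HB1.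
- intros [Hsm Hw]. destruct (Hw k0 Hk0) as [K HK].
  assert (HK' : forall m x, Cmod (CDerive_n (resolvent mu (real_valued (D 0%nat))) m x) <= K * T m).
  { intros m x. specialize (HK x m 0%nat). rewrite Nat.add_0_r, Rmult_1_l in HK.
    apply Rle_div_l in HK; [exact HK|apply exp_pos]. }
  assert (HK0 : 0 <= K).
  { assert (H := HK' 0%nat 0). assert (H1 := Rle_trans _ _ _ (Cmod_ge_0 _) H).
    assert (HT0 : 0 < T 0%nat) by apply exp_pos. nra. }
  (* The hump of index j + 1 > K |mu| contradicts the bound with constant K. *)
  destruct (nfloor (K * Cmod mu)) as [j Hj]; [apply Rmult_le_pos; lra|].
  destruct (Hbig (S j)) as [n Hn].
  destruct (resolvent_derivative_bound mu D B1 T K n Hmu HD Hsupp HB1 Hsm HK') as (v & Hv & HDn).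
  assert (H := HQ' (S j) n K v _ HK0 Hv HDn).
  assert (He := exp_pos (E (Q (S j)) (S j) n)).
  assert (Hlt : K * Cmod mu * exp (E (Q (S j)) (S j) n) < INR (S j) * exp (E (Q (S j)) (S j) n)).
  { apply Rmult_lt_compat_r; [exact He|]. rewrite S_INR. lra. }
  apply (Rlt_irrefl (Rabs (D n (3 / 4)))).
  apply Rle_lt_trans with (1 := H), Rlt_le_trans with (1 := Hlt), Hn.
Qed.
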